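(* Let $p(\varrho)=\varrho^2$. There exist Lipschitz continuous initial data $(\varrho_0,v_0):\mathbb{R}^2\to\mathbb{R}^+\times\mathbb{R}^2$ such that there are infinitely many energy conserving weak solutions $(\varrho,v)$ on $[0,\infty)\times\mathbb{R}^2$ to the two-dimensional isentropic compressible Euler equations $$\partial_t\varrho+\operatorname{div}_x(\varrho v)=0,\qquad \partial_t(\varrho v)+\operatorname{div}_x(\varrho v\otimes v)+\nabla_x p(\varrho)=0,\qquad \varrho(0,x)=\varrho_0(x),\quad v(0,x)=v_0(x).$$
   Context: Here $\mathbb{R}^+=(0,\infty)$; the unknowns are the density $\varrho=\varrho(t,x)\in\mathbb{R}^+$ and the velocity $v=v(t,x)\in\mathbb{R}^2$ for $t\in[0,\infty)$, $x\in\mathbb{R}^2$. The pressure potential associated with $p(\varrho)=\varrho^2$ is $P(\varrho)=\varrho^2$. Weak solution: a pair $(\varrho,v)\in L^\infty_{loc}([0,\infty)\times\mathbb{R}^2;\mathbb{R}^+\times\mathbb{R}^2)$ such that for all $\psi\in C_c^\infty([0,\infty)\times\mathbb{R}^2,\mathbb{R})$ and all $\phi\in C_c^\infty([0,\infty)\times\mathbb{R}^2,\mathbb{R}^2)$, $$\int_0^\infty\int_{\mathbb{R}^2}\big(\varrho\,\partial_t\psi+\varrho v\cdot\nabla_x\psi\big)\,dx\,dt+\int_{\mathbb{R}^2}\varrho_0(x)\,\psi(0,x)\,dx=0,$$ $$\int_0^\infty\int_{\mathbb{R}^2}\big(\varrho v\cdot\partial_t\phi+\varrho\,(v\otimes v):D_x\phi+p(\varrho)\operatorname{div}_x\phi\big)\,dx\,dt+\int_{\mathbb{R}^2}\varrho_0(x)v_0(x)\cdot\phi(0,x)\,dx=0.$$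 Energy conserving weak solution: a weak solution for which the energy equality $$\partial_t\Big(\tfrac12\varrho|v|^2+P(\varrho)\Big)+\operatorname{div}_x\Big[\Big(\tfrac12\varrho|v|^2+P(\varrho)+p(\varrho)\Big)v\Big]=0$$ holds in the weak sense, i.e. for all $\varphi\in C_c^\infty([0,\infty)\times\mathbb{R}^2,\mathbb{R})$, $$\int_0^\infty\int_{\mathbb{R}^2}\Big[\Big(\tfrac12\varrho|v|^2+P(\varrho)\Big)\partial_t\varphi+\Big(\tfrac12\varrho|v|^2+P(\varrho)+p(\varrho)\Big)v\cdot\nabla_x\varphi\Big]dx\,dt+\int_{\mathbb{R}^2}\Big(\tfrac12\varrho_0|v_0|^2+P(\varrho_0)\Big)\varphi(0,x)\,dx=0.$$ Solutions are identified if they agree almost everywhere on $(0,\infty)\times\mathbb{R}^2$. *)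

(* Defs.v *)
From HB Require Import structures.
From mathcomp Require Import all_boot all_order all_algebra.
From mathcomp Require Import all_classical all_reals all_analysis.
Import Order.TTheory GRing.Theory Num.Theory numFieldNormedType.Exports.

Set Implicit Arguments.
Unset Strict Implicit.
Unset Printing Implicit Defensive.

Local Open Scope classical_set_scope.
Local Open Scope ring_scope.

(* Lebesgue measure on R^2 and on R x R^2, as products of the library's
   (Borel) Lebesgue measure. The sigma-finite instance is needed because the
   library's generic one for products is not found by inference. *)
Definition leb2 (R : realType) := (@lebesgue_measure R \x @lebesgue_measure R)%E.

HB.instance Definition _ (R : realType) := Measure.on (@leb2 R).

Lemma leb2_sigma_finite (R : realType) : sigma_finite setT (@leb2 R).
Proof.
have /sigma_finiteP[F [TF ndF Foo]] := sigma_finiteT (@lebesgue_measure R).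
exists (fun n => F n `*` F n).
  rewrite -setXTT {1 2}TF predeqE => -[x y]; split.
    move=> [/= [n _ Fnx] [k _ Fky]]; exists (maxn n k) => //; split.
    - by move: x Fnx; exact/subsetPset/ndF/leq_maxl.
    - by move: y Fky; exact/subsetPset/ndF/leq_maxr.
  by move=> [n _ []/= ? ?]; split; exists n.
move=> k; have [mF Fk] := Foo k; split; first exact: measurableX.
by rewrite /leb2 product_measure1E// lte_mul_pinfty// ge0_fin_numE.
Qed.

HB.instance Definition _ (R : realType) :=
  Measure_isSigmaFinite.Build _ _ _ (@leb2 R) (@leb2_sigma_finite R).

Definition leb3 (R : realType) := (@lebesgue_measure R \x @leb2 R)%E.
HB.instance Definition _ (R : realType) := Measure.on (@leb3 R).
Arguments leb2 : clear implicits.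
Arguments leb3 : clear implicits.

(* The half-space [0, +oo[ x R^2. Functions on it are given by functions on
   the whole of R x R^2 whose values for t < 0 are irrelevant. *)
Definition halfspace (R : realType) : set (R * (R * R)) :=
  [set z | 0 <= z.1].
Arguments halfspace : clear implicits.

Section TestFunctions.
Context (R : realType) (W : normedModType R).
Implicit Types f : R * (R * R) -> W.

Definition axis_t : R * (R * R) := (1, (0, 0)).
Definition axis_1 : R * (R * R) := (0, (1, 0)).
Definition axis_2 : R * (R * R) := (0, (0, 1)).

Definition Dt f : R * (R * R) -> W := 'D_axis_t f.
Definition D1 f : R * (R * R) -> W := 'D_axis_1 f.
Definition D2 f : R * (R * R) -> W := 'D_axis_2 f.

Fixpoint Ck (n : nat) f : Prop :=
  match n with
  | 0 => continuous f
  | m.+1 => [/\ continuous f,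
      forall z, [/\ derivable f z axis_t, derivable f z axis_1
                  & derivable f z axis_2],
      Ck m (Dt f), Ck m (D1 f) & Ck m (D2 f)]
  end.

(* The elements of C_c^oo([0, +oo[ x R^2) are the restrictions to t >= 0 of
   the elements of C_c^oo(R x R^2); in particular they need not vanish at
   t = 0. *)
Definition test_function f : Prop :=
  (forall n, Ck n f) /\ compact (closure [set z | f z != 0]).

End TestFunctions.

Section Euler.
Context (R : realType).
Local Notation spacetime := (R * (R * R))%type.
Implicit Types (p P : R -> R) (rho : spacetime -> R) (v : spacetime -> R * R).

Definition Linfty_loc (f : spacetime -> R) : Prop :=
  measurable_fun
    (halfspace R : set (measurableTypeR R *
                        (measurableTypeR R * measurableTypeR R)))
    f /\
  forall K : set spacetime, compact K -> K `<=` halfspace R ->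
    exists M : R, \forall z \ae leb3 R, K z -> `|f z| <= M.

Definition dot (a b : R * R) : R := a.1 * b.1 + a.2 * b.2.

Definition grad (psi : spacetime -> R) z : R * R := (D1 psi z, D2 psi z).

Definition div (phi : spacetime -> R * R) z : R :=
  (D1 phi z).1 + (D2 phi z).2.

(* (a (x) b) : D_x phi, where (D_x phi)_ij = d phi_i / d x_j *)
Definition tensor_contract (a b : R * R) (phi : spacetime -> R * R) z : R :=
  a.1 * b.1 * (D1 phi z).1 + a.1 * b.2 * (D2 phi z).1 +
  a.2 * b.1 * (D1 phi z).2 + a.2 * b.2 * (D2 phi z).2.

Definition weak_mass (rho0 : R * R -> R) rho v : Prop :=
  forall psi : spacetime -> R, test_function psi ->
    \int[leb3 R]_(z in halfspace R)
       (rho z * Dt psi z + rho z * dot (v z) (grad psi z))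
    + \int[leb2 R]_x (rho0 x * psi (0, x)) = 0.

Definition weak_momentum p (rho0 : R * R -> R) (v0 : R * R -> R * R)
    rho v : Prop :=
  forall phi : spacetime -> R * R, test_function phi ->
    \int[leb3 R]_(z in halfspace R)
       (rho z * dot (v z) (Dt phi z)
        + rho z * tensor_contract (v z) (v z) phi z
        + p (rho z) * div phi z)
    + \int[leb2 R]_x (rho0 x * dot (v0 x) (phi (0, x))) = 0.

Definition weak_solution p (rho0 : R * R -> R) (v0 : R * R -> R * R)
    rho v : Prop :=
  [/\ [/\ Linfty_loc rho, Linfty_loc (fun z => (v z).1)
        & Linfty_loc (fun z => (v z).2)],
      \forall z \ae leb3 R, halfspace R z -> 0 < rho z,
      weak_mass rho0 rho v
    & weak_momentum p rho0 v0 rho v].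

Definition energy P (r : R) (w : R * R) : R := 2^-1 * r * dot w w + P r.

Definition weak_energy p P (rho0 : R * R -> R) (v0 : R * R -> R * R)
    rho v : Prop :=
  forall psi : spacetime -> R, test_function psi ->
    \int[leb3 R]_(z in halfspace R)
       (energy P (rho z) (v z) * Dt psi z
        + (energy P (rho z) (v z) + p (rho z)) * dot (v z) (grad psi z))
    + \int[leb2 R]_x (energy P (rho0 x) (v0 x) * psi (0, x)) = 0.

Definition energy_conserving_weak_solution p P
    (rho0 : R * R -> R) (v0 : R * R -> R * R) rho v : Prop :=
  weak_solution p rho0 v0 rho v /\ weak_energy p P rho0 v0 rho v.

Definition same_solution
    (u w : (spacetime -> R) * (spacetime -> R * R)) : Prop :=
  \forall z \ae leb3 R, 0 < z.1 -> u.1 z = w.1 z /\ u.2 z = w.2 z.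

End Euler.

(* S has infinitely many elements up to the equivalence E: the set of the
   E-classes of its elements is infinite. *)
Definition infinite_modulo (T : Type) (E : T -> T -> Prop) (S : set T) : Prop :=
  infinite_set [set C : set T | exists2 u, S u & C = [set w | E u w]].

(* Main.v *)
(* The initial data depend on x1 only and launch two simple waves that focus at
   t = 1 into the Riemann data rho = 2, v = (2, 0) for x1 < 0 and v = (-2, 0) for
   x1 > 0, which for t > 1 persist outside the wedge |x1| <= 2 (t - 1). In the wedge
   rho = 4 and v is a wild incompressible field: div v = 0 and
   v_t + div (v (x) v - I) = 0 with |v|^2 = 2, where v and v (x) v - I, extended by zero,
   solve these linear equations on all of space-time. Then the density, momentum and
   energy in the wedge are those of a constant state with velocity zero, pressure
   16 + 4 and energy 20, and the Rankine-Hugoniot conditions across x1 = +-2 (t - 1)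
   hold for mass, momentum and energy.

   Wild fields come from convex integration in each cell of a tiling of the wedge. A
   subsolution is a C^1 solution (v, u) of v_t + div u = 0, div v = 0, supported in the
   cell, with I + u - v (x) v positive definite. Adding localized plane waves on a fine
   grid increases the integral of |v|^2 by a multiple of the integral of the squared
   deficit (2 - |v|^2)^2, while the increment is nearly orthogonal to finitely many given
   fields. Iterating, v converges in L^2 and the deficit tends to 0 a.e. Two starting
   subsolutions give two different limits in each cell, hence infinitely many solutions. *)
Require Import Defs.
From HB Require Import structures.
From mathcomp Require Import all_boot all_order all_algebra.
From mathcomp Require Import all_classical all_reals all_analysis.
From mathcomp Require Import measurable_realfun zify ring lra.
Import Order.TTheory GRing.Theory Num.Theory numFieldNormedType.Exports.
Set Implicit Arguments.
Unset Strict Implicit.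
Unset Printing Implicit Defensive.
Local Open Scope classical_set_scope.
Local Open Scope ring_scope.

(** * Integration on R x R^2 *)

(** A constant middle state at rest has only its density and the shock speed to meet three
    Rankine-Hugoniot conditions. The kinetic energy of the wild field is the third unknown: for
    colliding streams of density 2 and speed 2, the shock speed 2, density 4 and |v|^2 = 2 meet all
    three. Inside the wedge energy is conserved because rho and |v|^2 are constant there, so that
    the energy flux is a constant multiple of the solenoidal v.

    The obstacle of the iteration is that the lower bound on I + u - v (x) v shrinks by a fixed
    factor at every step. The gain must depend only on the trace 2 - |v|^2 of this matrix. This is
    achieved by oscillating along the eigenvector of the largest eigenvalue, which is at least half
    the trace.

    Near orthogonality to all earlier fields gives strong convergence: the energies are bounded and
    increase up to summable errors, so they are Cauchy, and orthogonality makes the fields Cauchy in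
    L^2. A fast subsequence converges almost everywhere, which identifies the nonlinear stress. *)

Section ProductMeasurability.
Context (R : realType).
Local Notation T1 := (measurableTypeR R).
Local Notation T2 := (T1 * T1)%type.
Local Notation T3 := (T1 * T2)%type.

(** Only the factor R needs a countable base: for a rational interval I, the points y with I x {y}
    inside U form a set with open interior, and U is the union of these countably many rectangles.
    The maps [i] and [j] pass between the measurable and the topological copy of the second
    factor. *)
Lemma open_measurable_prodR d (Y : measurableType d) (Y' : pseudoMetricType R)
    (j : Y' -> Y) (i : Y -> Y') : cancel j i -> cancel i j ->
  (forall V : set Y', open V -> measurable (i @^-1` V)) ->
  forall U : set (R * Y'), open U ->
    measurable [set z : T1 * Y | U (z.1, i z.2)].
Proof.
move=> ji ij mV U oU.
pose W (q : rat * rat) : set Y' :=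
  [set y | forall x, ratr q.1 < x < ratr q.2 -> U (x, y)].
have -> : [set z : T1 * Y | U (z.1, i z.2)] =
    \bigcup_(q1 in @setT rat) \bigcup_(q2 in @setT rat)
      (`]ratr q1, ratr q2[%classic `*` (i @^-1` (W (q1, q2))^°)).
  apply/seteqP; split => [[x y]/= Uxy|[x y] [q1 _ [q2 _ [/= xq /interior_subset]]]];
    last by move=> /(_ x); apply; move: xq; rewrite in_itv.
  have /nbhs_ballP[e /= e0 eU] : nbhs (x, i y) U.
    by rewrite nbhsE; exists U => //; split.
  have /rat_in_itvoo[q1 /[!in_itv]/= /andP[q1l q1r]] : x - e < x.
    by rewrite ltrBlDr ltrDl.
  have /rat_in_itvoo[q2 /[!in_itv]/= /andP[q2l q2r]] : x < x + e.
    by rewrite ltrDl.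
  exists q1 => //; exists q2 => //; split => /=; first by rewrite in_itv/= q1r.
  apply/nbhs_ballP; exists e => //= y' yy' x' /andP[/= xl xr].
  apply: eU; split => //=.
  rewrite /ball/= ltr_norml; apply/andP; split; lra.
apply: bigcupT_measurable_rat => q1; apply: bigcupT_measurable_rat => q2.
apply: measurableX; first exact: measurable_itv.
by apply: mV; exact: open_interior.
Qed.

Lemma open_measurable2 (U : set (R * R)) : open U -> measurable (U : set T2).
Proof.
move=> oU; have := @open_measurable_prodR _ T1 R id id (fun=> erefl)
  (fun=> erefl) (fun V oV => open_measurable oV) U oU.
by congr (measurable _); apply/seteqP; split=> -[x y].
Qed.

Lemma open_measurable3 (U : set (R * (R * R))) :
  open U -> measurable (U : set T3).
Proof.
move=> oU; have := @open_measurable_prodR _ T2 (R * R)%type id id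
  (fun=> erefl) (fun=> erefl) open_measurable2 U oU.
by congr (measurable _); apply/seteqP; split=> -[x y].
Qed.

Lemma continuous_measurable3 (f : R * (R * R) -> R) :
  continuous f -> measurable_fun setT (f : T3 -> R).
Proof.
move=> /continuousP cf; apply: (measurability _ (RGenOpens.measurableE R)).
move=> _ [_ [a [b ->] <-]]; rewrite setTI; apply: open_measurable3.
exact/cf/interval_open.
Qed.

End ProductMeasurability.

Section CompactlySupportedIntegration.
Context (R : realType).
Local Notation T1 := (measurableTypeR R).
Local Notation T2 := (T1 * T1)%type.
Local Notation T3 := (T1 * T2)%type.
Local Notation leb := (@lebesgue_measure R).
Implicit Types f g : R * (R * R) -> R.

(* lbm: locally bounded measurable; cbm: bounded measurable with compact support *)
Definition lbm f := measurable_fun setT (f : T3 -> R) /\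
  forall r, exists C, forall z, `|z| <= r -> `|f z| <= C.

Definition cbm f := measurable_fun setT (f : T3 -> R) /\
  exists C r, forall z, `|f z| <= C /\ (r < `|z| -> f z = 0).

Lemma norm3E (z : R * (R * R)) :
  `|z| = Num.max `|z.1| (Num.max `|z.2.1| `|z.2.2|).
Proof. by []. Qed.

Lemma norm2E (z : R * R) : `|z| = Num.max `|z.1| `|z.2|.
Proof. by []. Qed.

Lemma compact_ball3 r : compact [set z : R * (R * R) | `|z| <= r].
Proof.
have cI : compact (`[- r, r]%classic : set R) by exact: segment_compact.
rewrite (_ : [set _ | _] = `[- r, r] `*` (`[- r, r] `*` `[- r, r]));
  first by do 2?apply: compact_setX.
apply/seteqP; split => -[t [x y]] /=; rewrite norm3E/= !ge_max !in_itv/= -!ler_norml.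
  by move=> /and3P[].
by move=> [-> [-> ->]].
Qed.

Lemma continuous_lbm f : continuous f -> lbm f.
Proof.
move=> cf; split; first exact: continuous_measurable3.
move=> r.
have : compact (f @` [set z : R * (R * R) | `|z| <= r]).
  by apply: continuous_compact; [exact: continuous_subspaceT|exact: compact_ball3].
move=> /compact_bounded[M [_ fM]]; exists (M + 1) => z zr.
by apply: (fM (M + 1)); rewrite ?ltrDl //=; exists z.
Qed.

Lemma lbm_cst c : lbm (fun=> c).
Proof. by split => //; move=> r; exists `|c|. Qed.

Lemma lbmD f g : lbm f -> lbm g -> lbm (fun z => f z + g z).
Proof.
move=> [mf bf] [mg bg]; split; first exact: measurable_funD.
move=> r; have [C fC] := bf r; have [D gD] := bg r; exists (C + D) => z zr.
by rewrite (le_trans (ler_normD _ _))// lerD ?fC ?gD.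
Qed.

Lemma lbmM f g : lbm f -> lbm g -> lbm (fun z => f z * g z).
Proof.
move=> [mf bf] [mg bg]; split; first exact: measurable_funM.
move=> r; have [C fC] := bf r; have [D gD] := bg r; exists (C * D) => z zr.
by rewrite normrM ler_pM ?fC ?gD.
Qed.

Lemma lbmN f : lbm f -> lbm (fun z => - f z).
Proof.
move=> lf; rewrite (_ : (fun _ => _) = (fun z => - 1 * f z)).
  by apply: lbmM => //; exact: lbm_cst.
by apply/funext => z; rewrite mulN1r.
Qed.

Lemma lbmB f g : lbm f -> lbm g -> lbm (fun z => f z - g z).
Proof. by move=> lf lg; apply: lbmD => //; exact: lbmN. Qed.

Lemma lbmX f n : lbm f -> lbm (fun z => f z ^+ n).
Proof.
move=> lf; elim: n => [|n ih].
  by under eq_fun do rewrite expr0; exact: lbm_cst.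
by under eq_fun do rewrite exprS; exact: lbmM.
Qed.

Lemma cbm_lbm f : cbm f -> lbm f.
Proof. by move=> [mf [C [r fC]]]; split => // s; exists C => z _; case: (fC z). Qed.

Lemma lbm_cbm f r : lbm f -> (forall z, r < `|z| -> f z = 0) -> cbm f.
Proof.
move=> [mf bf] f0; split => //; have [C fC] := bf r; exists `|C|, r => z; split; last exact: f0.
by have [/fC/le_trans->//|/f0->] := leP `|z| r; rewrite ?ler_norm// normr0.
Qed.

Lemma cbmMl f g : lbm f -> cbm g -> cbm (fun z => f z * g z).
Proof.
move=> lf cg; have [_ [? [r gr]]] := cg; apply: (@lbm_cbm _ r).
  exact: lbmM (cbm_lbm _).
by move=> z /(gr z).2 ->; rewrite mulr0.
Qed.

Lemma cbmMr f g : cbm f -> lbm g -> cbm (fun z => f z * g z).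
Proof. by move=> cf lg; under eq_fun do rewrite mulrC; exact: cbmMl. Qed.

Lemma cbmD f g : cbm f -> cbm g -> cbm (fun z => f z + g z).
Proof.
move=> cf cg; have [_ [? [r fr]]] := cf; have [_ [? [s gs]]] := cg.
apply: (@lbm_cbm _ (Num.max r s)); first by apply: lbmD; exact: cbm_lbm.
by move=> z; rewrite gt_max => /andP[/(fr z).2 -> /(gs z).2 ->]; rewrite addr0.
Qed.

Lemma cbm0 : cbm (fun=> 0).
Proof. by split => //; exists 0, 0 => z; rewrite normr0. Qed.

Lemma cbmN f : cbm f -> cbm (fun z => - f z).
Proof.
move=> cf; rewrite (_ : (fun _ => _) = (fun z => - 1 * f z)).
  by apply: cbmMl => //; exact: lbm_cst.
by apply/funext => z; rewrite mulN1r.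
Qed.

Lemma cbmB f g : cbm f -> cbm g -> cbm (fun z => f z - g z).
Proof. by move=> lf lg; apply: cbmD => //; exact: cbmN. Qed.

Lemma lbm_restrict f (D : set T3) : measurable D -> lbm f -> lbm (f \_ D).
Proof.
move=> mD [mf bf]; split.
  by apply/(measurable_restrictT f mD); exact: measurable_funTS.
move=> r; have [C fC] := bf r; exists `|C| => z zr; rewrite /patch; case: ifPn => _.
  by rewrite (le_trans (fC _ zr))// ler_norm.
by rewrite normr0.
Qed.

Lemma cbm_restrict f (D : set T3) : measurable D -> cbm f -> cbm (f \_ D).
Proof.
move=> mD cf; have [_ [? [r fr]]] := cf; apply: (@lbm_cbm _ r).
  by apply: lbm_restrict => //; exact: cbm_lbm.
by move=> z /(fr z).2 f0; rewrite /patch f0 if_same.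
Qed.

Lemma bounded_support_integrable d (X : measurableType d)
    (mu : {measure set X -> \bar R}) (f : X -> R) (B : set X) C :
  measurable B -> (mu B < +oo)%E -> measurable_fun setT f ->
  (forall x, `|f x| <= C) -> (forall x, ~ B x -> f x = 0) ->
  mu.-integrable setT (EFin \o f).
Proof.
move=> mB Bfin mf fC f0.
rewrite (_ : EFin \o f = (EFin \o f) \_ B); last first.
  apply/funext => x; rewrite /patch; case: ifPn => //= xB.
  by rewrite f0//; move: xB; rewrite notin_setE.
apply/(integrable_mkcond _ mB).
apply: measurable_bounded_integrable => //; first exact: measurable_funTS.
exists C; split; first exact: num_real.
by move=> M CM x _; exact: le_trans (fC x) (ltW CM).
Qed.

Lemma measure_itvNr_fin (r : R) : (leb [set` `[- r, r]%R] < +oo)%E.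
Proof. by rewrite lebesgue_measure_itv/=; case: ifPn => // _; rewrite -EFinB ltry. Qed.

Lemma integrable1 (h : R -> R) C r : measurable_fun setT (h : T1 -> R) ->
  (forall x, `|h x| <= C /\ (r < `|x| -> h x = 0)) ->
  leb.-integrable setT (EFin \o h).
Proof.
move=> mh hC; apply: (@bounded_support_integrable _ _ leb h `[- r, r] C) => //.
- exact: measure_itvNr_fin.
- by move=> x; case: (hC x).
- move=> x; rewrite /= in_itv/= -ler_norml => /negP; rewrite -ltNge; exact: (hC x).2.
Qed.

Lemma measure_box2_fin (r : R) :
  (leb2 R ([set` `[- r, r]%R] `*` [set` `[- r, r]%R]) < +oo)%E.
Proof.
rewrite /leb2 product_measure1E//; apply: lte_mul_pinfty => //.
  by rewrite ge0_fin_numE//; exact: measure_itvNr_fin.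
exact: measure_itvNr_fin.
Qed.

Lemma integrable2 (h : R * R -> R) C r : measurable_fun setT (h : T2 -> R) ->
  (forall x, `|h x| <= C /\ (r < `|x| -> h x = 0)) ->
  (leb2 R).-integrable setT (EFin \o h).
Proof.
move=> mh hC.
apply: (@bounded_support_integrable _ _ (leb2 R) h (`[- r, r] `*` `[- r, r]) C) => //.
- exact: measurableX.
- exact: measure_box2_fin.
- by move=> x; case: (hC x).
- move=> [x y]; rewrite /= !in_itv/= -!ler_norml => xy; apply: (hC _).2.
  rewrite ltNge norm2E/= ge_max; apply/negP => /andP[? ?]; exact: xy.
Qed.

Lemma measure_box3_fin (r : R) : (leb3 R
  ([set` `[- r, r]%R] `*` ([set` `[- r, r]%R] `*` [set` `[- r, r]%R])) < +oo)%E.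
Proof.
rewrite /leb3 product_measure1E//; last exact: measurableX.
apply: lte_mul_pinfty => //.
  by rewrite ge0_fin_numE//; exact: measure_itvNr_fin.
exact: measure_box2_fin.
Qed.

Lemma integrable3 f : cbm f -> (leb3 R).-integrable setT (EFin \o f).
Proof.
move=> [mh [C [r hC]]].
apply: (@bounded_support_integrable _ _ (leb3 R) f
  (`[- r, r] `*` (`[- r, r] `*` `[- r, r])) C) => //.
- by apply: measurableX => //; exact: measurableX.
- exact: measure_box3_fin.
- by move=> x; case: (hC x).
- move=> [t [x y]]; rewrite /= !in_itv/= -!ler_norml => xy; apply: (hC _).2.
  rewrite ltNge norm3E/= !ge_max; apply/negP => /and3P[? ? ?]; exact: xy.
Qed.

Lemma integrable3_in f (D : set T3) : measurable D -> cbm f ->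
  (leb3 R).-integrable D (EFin \o f).
Proof. by move=> mD /integrable3; apply: integrableS. Qed.

Lemma cbm_section_t f (x : R * R) : cbm f ->
  leb.-integrable setT (EFin \o (fun t => f (t, x))).
Proof.
move=> [mf [C [r fC]]]; apply: (@integrable1 _ C r).
  by apply: (measurableT_comp mf); exact: measurable_pair2.
move=> t; split; first by case: (fC (t, x)).
by move=> rt; apply: (fC _).2; rewrite norm3E lt_max rt.
Qed.

Lemma cbm_section_x f (t : R) : cbm f ->
  (leb2 R).-integrable setT (EFin \o (fun x => f (t, x))).
Proof.
move=> [mf [C [r fC]]]; apply: (@integrable2 _ C r).
  by apply: (measurableT_comp mf); exact: measurable_pair1.
move=> x; split; first by case: (fC (t, x)).
by move=> rt; apply: (fC _).2; rewrite norm3E !lt_max -lt_max -norm2E rt orbT.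
Qed.

Lemma cbm_section_1 f (t y : R) : cbm f ->
  leb.-integrable setT (EFin \o (fun x => f (t, (x, y)))).
Proof.
move=> [mf [C [r fC]]]; apply: (@integrable1 _ C r).
  apply: (measurableT_comp mf).
  by apply: (measurableT_comp (measurable_pair1 t)); exact: measurable_pair2.
move=> x; split; first by case: (fC (t, (x, y))).
by move=> rt; apply: (fC _).2; rewrite norm3E/= !lt_max rt orbT.
Qed.

Lemma cbm_section_2 f (t x : R) : cbm f ->
  leb.-integrable setT (EFin \o (fun y => f (t, (x, y)))).
Proof.
move=> [mf [C [r fC]]]; apply: (@integrable1 _ C r).
  apply: (measurableT_comp mf).
  by apply: (measurableT_comp (measurable_pair1 t)); exact: measurable_pair1.
move=> y; split; first by case: (fC (t, (x, y))).
by move=> rt; apply: (fC _).2; rewrite norm3E/= !lt_max rt !orbT.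
Qed.

(** Time is integrated first and the inner value [g] is kept, because integration over a half-line
    of times leaves a boundary term at t = 0. *)
Lemma Rint3_t f (g : R * R -> R) : cbm f ->
  (forall x, \int[leb]_t f (t, x) = g x) ->
  \int[leb3 R]_z f z = \int[leb2 R]_x g x.
Proof.
move=> cf fg; congr fine.
rewrite -[LHS](integral21_prod_meas1 (integrable3 cf)); apply: eq_integral => x _.
rewrite /fubini_G -fg [RHS]fineK//.
exact: integrable_fin_num (cbm_section_t x cf).
Qed.

Lemma Rint3_1 f : cbm f ->
  (forall t y, \int[leb]_x f (t, (x, y)) = 0) ->
  \int[leb3 R]_z f z = 0.
Proof.
move=> cf f0; rewrite /Rintegral.
rewrite -(integral12_prod_meas1 (integrable3 cf)) integral0_eq ?fine0// => t _.
rewrite /fubini_F -(integral21_prod_meas1 (cbm_section_x t cf)).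
apply: integral0_eq => y _; rewrite /fubini_G -[LHS]fineK.
  by have := f0 t y; rewrite /Rintegral => ->.
exact: integrable_fin_num (cbm_section_1 t y cf).
Qed.

Lemma Rint3_2 f : cbm f ->
  (forall t x, \int[leb]_y f (t, (x, y)) = 0) ->
  \int[leb3 R]_z f z = 0.
Proof.
move=> cf f0; rewrite /Rintegral.
rewrite -(integral12_prod_meas1 (integrable3 cf)) integral0_eq ?fine0// => t _.
rewrite /fubini_F -(integral12_prod_meas1 (cbm_section_x t cf)).
apply: integral0_eq => y _; rewrite /fubini_F -[LHS]fineK.
  by have := f0 t y; rewrite /Rintegral => ->.
exact: integrable_fin_num (cbm_section_2 t y cf).
Qed.

Lemma measurable_halfspace : measurable (halfspace R : set T3).
Proof.
rewrite (_ : halfspace R = `[0, +oo[%classic `*` setT).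
  by apply: measurableX => //; exact: measurable_itv.
apply/seteqP; split => -[t x]; rewrite /halfspace/= in_itv/= andbT.
  by move=> ->.
by move=> [].
Qed.

Lemma Rint_half_t f (g : R * R -> R) : cbm f ->
  (forall x, \int[leb]_(t in `[0, +oo[) f (t, x) = g x) ->
  \int[leb3 R]_(z in halfspace R) f z = \int[leb2 R]_x g x.
Proof.
move=> cf fg; rewrite Rintegral_mkcond; apply: Rint3_t.
  exact: cbm_restrict measurable_halfspace cf.
move=> x; rewrite -fg [RHS]Rintegral_mkcond; apply: eq_Rintegral => t _.
by rewrite /patch !mem_setE/= in_itv/= andbT.
Qed.

Lemma Rint_half_1 f : cbm f ->
  (forall t y, 0 <= t -> \int[leb]_x f (t, (x, y)) = 0) ->
  \int[leb3 R]_(z in halfspace R) f z = 0.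
Proof.
move=> cf f0; rewrite Rintegral_mkcond; apply: Rint3_1.
  exact: cbm_restrict measurable_halfspace cf.
move=> t y; have [t0|t0] := leP 0 t.
  rewrite -[RHS](f0 t y)//; apply: eq_Rintegral => x _.
  by rewrite /patch mem_set.
rewrite -[RHS](Rintegral_set0 leb (fun=> 0)) [RHS]Rintegral_mkcond.
apply: eq_Rintegral => x _; rewrite /patch in_set0 memNset//=.
by rewrite /halfspace/= leNgt t0.
Qed.

Lemma Rint_half_2 f : cbm f ->
  (forall t x, 0 <= t -> \int[leb]_y f (t, (x, y)) = 0) ->
  \int[leb3 R]_(z in halfspace R) f z = 0.
Proof.
move=> cf f0; rewrite Rintegral_mkcond; apply: Rint3_2.
  exact: cbm_restrict measurable_halfspace cf.
move=> t x; have [t0|t0] := leP 0 t.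
  rewrite -[RHS](f0 t x)//; apply: eq_Rintegral => y _.
  by rewrite /patch mem_set.
rewrite -[RHS](Rintegral_set0 leb (fun=> 0)) [RHS]Rintegral_mkcond.
apply: eq_Rintegral => y _; rewrite /patch in_set0 memNset//=.
by rewrite /halfspace/= leNgt t0.
Qed.

Lemma RintD3 f g (D : set T3) : measurable D -> cbm f -> cbm g ->
  \int[leb3 R]_(z in D) (f z + g z) =
  \int[leb3 R]_(z in D) f z + \int[leb3 R]_(z in D) g z.
Proof. by move=> mD cf cg; rewrite RintegralD//; exact: integrable3_in. Qed.

Lemma RintB3 f g (D : set T3) : measurable D -> cbm f -> cbm g ->
  \int[leb3 R]_(z in D) (f z - g z) =
  \int[leb3 R]_(z in D) f z - \int[leb3 R]_(z in D) g z.
Proof. by move=> mD cf cg; rewrite RintegralB//; exact: integrable3_in. Qed.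

Lemma RintZ3 f c (D : set T3) : measurable D -> cbm f ->
  \int[leb3 R]_(z in D) (c * f z) = c * \int[leb3 R]_(z in D) f z.
Proof. by move=> mD cf; rewrite RintegralZl//; exact: integrable3_in. Qed.

End CompactlySupportedIntegration.

(** * The fundamental theorem of calculus and test functions *)

Section LineIntegrals.
Context (R : realType).
Local Notation leb := (@lebesgue_measure R).
Implicit Types (f g D : R -> R) (s : seq R).

(** Each exceptional point cuts the segment in two, and continuity glues the two constants
    together. *)
Lemma zero_derive_const D (a b : R) s : a <= b -> {within `[a, b], continuous D} ->
  (forall x, a < x < b -> x \notin s -> is_derive x 1 D 0) -> D a = D b.
Proof.
elim: s a b => [|c s ih] a b ab cD D0.
  have [||x _ /eqP] := @MVT_segment _ D (fun=> 0) a b ab => //.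
    by move=> x; rewrite in_itv/= => xab; exact: D0.
  by rewrite mul0r subr_eq0 => /eqP.
have [/andP[ac cb]|nc] := boolP (a < c < b); last first.
  apply: ih => // x xab xs; apply: D0 => //; rewrite inE negb_or xs andbT.
  by apply: contra nc => /eqP <-.
transitivity (D c); apply: ih; [exact: ltW| | |exact: ltW| |].
- apply: continuous_subspaceW cD; apply: subset_itvl; rewrite bnd_simp; exact: ltW.
- move=> x /andP[ax xc] xs; apply: D0; first by rewrite ax (lt_trans xc).
  by rewrite inE negb_or xs lt_eqF.
- apply: continuous_subspaceW cD; apply: subset_itvr; rewrite bnd_simp; exact: ltW.
- move=> x /andP[cx xb] xs; apply: D0; first by rewrite xb (lt_trans ac).
  by rewrite inE negb_or xs gt_eqF.
Qed.

(* The integrand may fail to be the derivative at finitely many points. *)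
Lemma piecewise_FTC2 f g (a b : R) s : a <= b -> {within `[a, b], continuous f} ->
  leb.-integrable `[a, b] (EFin \o g) ->
  (forall x, a < x < b -> x \notin s ->
    is_derive x 1 f (g x) /\ {for x, continuous g}) ->
  \int[leb]_(x in `[a, b]) g x = f b - f a.
Proof.
rewrite le_eqVlt => /predU1P[<- _ _ _|ab cf ig fg].
  by rewrite set_itv1 Rintegral_set1 subrr.
pose G x := \int[leb]_(t in `[a, x]) g t.
have cG : {within `[a, b], continuous G}.
  exact: (parameterized_integral_continuous (ltW ab) ig).
have Ga : G a = 0 by rewrite /G set_itv1 Rintegral_set1.
(* The difference from the indefinite integral [G] is continuous and has zero derivative off [s]. *)
suff E : (f - G) a = (f - G) b.
  by move: E; rewrite !fctE Ga subr0 => ->; rewrite subKr.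
apply: (@zero_derive_const (f - G) a b s (ltW ab)).
- by move=> x; apply: cvgB; [exact: cf|exact: cG].
- move=> x xab xs; have [dfx cgx] := fg x xab xs.
  have /andP[ax xb] := xab.
  have [dG G'] := continuous_FTC1_closed xb ig ax cgx.
  have dGx : is_derive x 1 G (g x).
    exact: (DeriveDef dG (etrans (esym (derive1E G x)) G')).
  by rewrite -(subrr (g x)); exact: is_deriveB.
Qed.

Lemma Rintegral_support (A B : set R) g : measurable A -> measurable B ->
  (forall x, A x -> ~ B x -> g x = 0) ->
  \int[leb]_(x in A) g x = \int[leb]_(x in A `&` B) g x.
Proof.
move=> mA mB g0; rewrite Rintegral_mkcondr; apply: eq_Rintegral => x.
rewrite inE => Ax; rewrite /patch; case: ifPn => //.
by rewrite notin_setE; exact: g0.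
Qed.

Lemma Rintegral_derive_line f g s r : continuous f ->
  leb.-integrable setT (EFin \o g) ->
  (forall x, r < `|x| -> f x = 0 /\ g x = 0) ->
  (forall x, x \notin s -> is_derive x 1 f (g x) /\ {for x, continuous g}) ->
  \int[leb]_x g x = 0.
Proof.
move=> cf ig fg0 fg; pose q := `|r| + 1.
have rq : r < q by rewrite (le_lt_trans (ler_norm r))// ltrDl.
have q0 : 0 < q by rewrite ltr_wpDl.
rewrite (@Rintegral_support _ `[- q, q]) ?setTI//; last first.
  move=> x _ /=; rewrite in_itv/= -ler_norml => /negP; rewrite -ltNge => xq.
  by apply: (fg0 _ _).2; exact: lt_trans xq.
rewrite (@piecewise_FTC2 f g _ _ s).
- by rewrite !(fg0 _ _).1 ?subrr// ?normrN gtr0_norm.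
- lra.
- exact: continuous_subspaceT.
- exact: integrableS ig.
- by move=> x _; exact: fg.
Qed.

Lemma Rintegral_derive_halfline f g s r : {in `[0, +oo[, continuous f} ->
  leb.-integrable setT (EFin \o g) ->
  (forall x, r < `|x| -> f x = 0 /\ g x = 0) ->
  (forall x, 0 < x -> x \notin s -> is_derive x 1 f (g x) /\ {for x, continuous g}) ->
  \int[leb]_(x in `[0, +oo[) g x = - f 0.
Proof.
move=> cf ig fg0 fg; pose q := `|r| + 1.
have rq : r < q by rewrite (le_lt_trans (ler_norm r))// ltrDl.
have q0 : 0 < q by rewrite ltr_wpDl.
rewrite (@Rintegral_support _ `[- q, q])//; last first.
  move=> x _ /=; rewrite in_itv/= -ler_norml => /negP; rewrite -ltNge => xq.
  by apply: (fg0 _ _).2; exact: lt_trans xq.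
rewrite (_ : _ `&` _ = `[0, q]%classic); last first.
  apply/seteqP; split => x /=; rewrite !in_itv/= ?andbT.
    by move=> [-> /andP[]].
  by move=> /andP[x0 ->]; rewrite x0 andbT; split => //; lra.
rewrite (@piecewise_FTC2 f g _ _ s).
- by rewrite (fg0 q _).1 ?sub0r// gtr0_norm.
- lra.
- apply: continuous_in_subspaceT => x /[!inE]/=; rewrite in_itv/= => /andP[x0 _].
  by apply: cf; rewrite in_itv/= x0.
- exact: integrableS ig.
- by move=> x /andP[x0 _]; exact: fg.
Qed.

End LineIntegrals.

(** * Derivatives along the axes and symmetry of mixed derivatives *)

Section AxisDerivatives.
Context (R : realType).
Local Notation leb := (@lebesgue_measure R).
Local Notation T := (R * (R * R))%type.
Implicit Types (f g psi : T -> R).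

Definition ax (j : nat) : T :=
  match j with 0 => axis_t R | 1 => axis_1 R | _ => axis_2 R end.

Lemma is_derive_axis_t f t x d :
  is_derive (t, x) (ax 0) f d <-> is_derive t 1 (fun s => f (s, x)) d.
Proof.
have E : (fun h : R => h^-1 *: ((f \o shift (t, x)) (h *: ax 0) - f (t, x))) =
    (fun h : R => h^-1 *: (((fun s => f (s, x)) \o shift t) (h *: 1) - f (t, x))).
  apply/funext => h /=; congr (_ *: (f _ - _)).
  by case: x => x y; rewrite /axis_t; congr (_, (_, _)) => /=; rewrite ?scaler0 ?add0r.
by split => -[dv de]; split; move: dv de; rewrite /derivable /derive E.
Qed.

Lemma is_derive_axis_1 f t x y d :
  is_derive (t, (x, y)) (ax 1) f d <-> is_derive x 1 (fun s => f (t, (s, y))) d.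
Proof.
have E : (fun h : R => h^-1 *: ((f \o shift (t, (x, y))) (h *: ax 1) - f (t, (x, y)))) =
    (fun h : R => h^-1 *: (((fun s => f (t, (s, y))) \o shift x) (h *: 1) - f (t, (x, y)))).
  apply/funext => h /=; congr (_ *: (f _ - _)).
  by rewrite /axis_1; congr (_, (_, _)) => /=; rewrite ?scaler0 ?add0r.
by split => -[dv de]; split; move: dv de; rewrite /derivable /derive E.
Qed.

Lemma is_derive_axis_2 f t x y d :
  is_derive (t, (x, y)) (ax 2) f d <-> is_derive y 1 (fun s => f (t, (x, s))) d.
Proof.
have E : (fun h : R => h^-1 *: ((f \o shift (t, (x, y))) (h *: ax 2) - f (t, (x, y)))) =
    (fun h : R => h^-1 *: (((fun s => f (t, (x, s))) \o shift y) (h *: 1) - f (t, (x, y)))).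
  apply/funext => h /=; congr (_ *: (f _ - _)).
  by rewrite /axis_2; congr (_, (_, _)) => /=; rewrite ?scaler0 ?add0r.
by split => -[dv de]; split; move: dv de; rewrite /derivable /derive E.
Qed.

Lemma continuous_pair (X Y Z : topologicalType) (f : X -> Y) (g : X -> Z) x :
  {for x, continuous f} -> {for x, continuous g} ->
  {for x, continuous (fun s => (f s, g s))}.
Proof. move=> cf cg; exact: (@cvg_pair _ _ _ (nbhs x) (nbhs (f x)) (nbhs (g x))). Qed.

Lemma continuous_section_t f x : continuous f -> continuous (fun s => f (s, x)).
Proof.
move=> cf t; apply: (@continuous_comp _ _ _ (fun s : R => (s, x)) f); last exact: cf.
by apply: continuous_pair; [exact: cvg_id|exact: cvg_cst].
Qed.

Lemma continuous_section_1 f t y : continuous f -> continuous (fun s => f (t, (s, y))).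
Proof.
move=> cf x; apply: (@continuous_comp _ _ _ (fun s : R => (t, (s, y))) f); last exact: cf.
apply: continuous_pair; first exact: cvg_cst.
by apply: continuous_pair; [exact: cvg_id|exact: cvg_cst].
Qed.

Lemma continuous_section_2 f t x : continuous f -> continuous (fun s => f (t, (x, s))).
Proof.
move=> cf y; apply: (@continuous_comp _ _ _ (fun s : R => (t, (x, s))) f); last exact: cf.
apply: continuous_pair; first exact: cvg_cst.
by apply: continuous_pair; [exact: cvg_cst|exact: cvg_id].
Qed.

Lemma Rint3_derive j f g : continuous f -> continuous g -> cbm f -> cbm g ->
  (forall z, is_derive z (ax j) f (g z)) -> \int[leb3 R]_z g z = 0.
Proof.
move=> cf cg bf bg fg.
have [_ [? [r f0]]] := bf; have [_ [? [q g0]]] := bg.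
pose m := Num.max r q.
have fg0 z : m < `|z| -> f z = 0 /\ g z = 0.
  by rewrite gt_max => /andP[rz qz]; split; [exact: (f0 z).2|exact: (g0 z).2].
case: j fg => [|[|j]] fg.
- rewrite (@Rint3_t _ _ (fun=> 0) bg); first by rewrite Rintegral_cst ?mul0r.
  move=> x; apply: (@Rintegral_derive_line _ (fun t => f (t, x)) _ [::] m).
  + exact: continuous_section_t.
  + exact: cbm_section_t.
  + by move=> t mt; apply: fg0; rewrite norm3E lt_max mt.
  + move=> t _; split; first exact/is_derive_axis_t.
    exact: (continuous_section_t (x := x) cg).
- apply: Rint3_1 => // t y.
  apply: (@Rintegral_derive_line _ (fun s => f (t, (s, y))) _ [::] m).
  + exact: continuous_section_1.
  + exact: cbm_section_1.
  + by move=> s ms; apply: fg0; rewrite norm3E/= !lt_max ms !orbT.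
  + move=> s _; split; first exact/is_derive_axis_1.
    exact: (continuous_section_1 (t := t) (y := y) cg).
- apply: Rint3_2 => // t x.
  apply: (@Rintegral_derive_line _ (fun s => f (t, (x, s))) _ [::] m).
  + exact: continuous_section_2.
  + exact: cbm_section_2.
  + by move=> s ms; apply: fg0; rewrite norm3E/= !lt_max ms !orbT.
  + move=> s _; split; first exact/is_derive_axis_2.
    exact: (continuous_section_2 (t := t) (x := x) cg).
Qed.

(** Schwarz's theorem. Two mean value theorems, taken in either order, write the same second
    difference over a square of side h as h^2 times a value of [f01] or of [f10] near the given
    point, and both functions are continuous. *)
Lemma mixed_derive_sym f f0 f1 f01 f10 : continuous f -> continuous f0 -> continuous f1 ->
  continuous f01 -> continuous f10 ->
  (forall z, is_derive z (ax 0) f (f0 z)) -> (forall z, is_derive z (ax 1) f (f1 z)) ->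
  (forall z, is_derive z (ax 0) f1 (f01 z)) -> (forall z, is_derive z (ax 1) f0 (f10 z)) ->
  f01 = f10.
Proof.
move=> cf cf0 cf1 cf01 cf10 df0 df1 df01 df10.
apply/funext => -[t [x y]]; apply/eqP; rewrite -subr_eq0 -normr_le0.
apply/ler_addgt0Pr => e e0; rewrite add0r.
have e2 : 0 < e / 2 by lra.
have [d /= d0 dH] : exists2 d : R, 0 < d & forall z : T, `|(t, (x, y)) - z| < d ->
   `|f01 (t, (x, y)) - f01 z| < e / 2 /\
   `|f10 (t, (x, y)) - f10 z| < e / 2.
  have /cvgrPdist_lt/(_ _ e2) h1 := cf01 (t, (x, y)).
  have /cvgrPdist_lt/(_ _ e2) h2 := cf10 (t, (x, y)).
  have /nbhs_ballP[d /= d0 dd] : \forall z \near (t, (x, y)),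
    `|f01 (t, (x, y)) - f01 z| < e / 2 /\
    `|f10 (t, (x, y)) - f10 z| < e / 2.
    exact: filterI h1 h2.
  by exists d => // z zd; apply: dd; rewrite -ball_normE.
pose h := d / 2.
have h0 : 0 < h by rewrite /h; lra.
have hd : h + h = d by rewrite /h; lra.
have th : t < t + h by lra.
have xh : x < x + h by lra.
have near_z s s' : s \in `]t, t + h[ -> s' \in `]x, x + h[ ->
    `|(t, (x, y)) - (s, (s', y))| < d.
  rewrite !in_itv/= => /andP[? ?] /andP[? ?].
  rewrite norm3E/= !gt_max subrr normr0 d0 andbT.
  by apply/andP; split; rewrite ltr_norml; apply/andP; split; lra.
have [s1 s1t E1] : exists2 c, c \in `]t, t + h[ &
    (f (t + h, (x + h, y)) - f (t + h, (x, y))) - (f (t, (x + h, y)) - f (t, (x, y))) =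
    (f0 (c, (x + h, y)) - f0 (c, (x, y))) * (t + h - t).
  apply: (@MVT _ (fun s => f (s, (x + h, y)) - f (s, (x, y)))
    (fun s => f0 (s, (x + h, y)) - f0 (s, (x, y))) _ _ th).
    by move=> s _; apply: is_deriveB; exact/is_derive_axis_t.
  by apply: continuous_subspaceT => s; apply: cvgB; exact: (continuous_section_t cf).
have [s2 s2x E2] : exists2 c, c \in `]x, x + h[ &
    f0 (s1, (x + h, y)) - f0 (s1, (x, y)) =
    f10 (s1, (c, y)) * (x + h - x).
  apply: (@MVT _ (fun s => f0 (s1, (s, y)))
    (fun s => f10 (s1, (s, y))) _ _ xh).
    by move=> s _; exact/is_derive_axis_1.
  by apply: continuous_subspaceT => s; exact: (continuous_section_1 cf0).
have [s3 s3x E3] : exists2 c, c \in `]x, x + h[ &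
    (f (t + h, (x + h, y)) - f (t, (x + h, y))) - (f (t + h, (x, y)) - f (t, (x, y))) =
    (f1 (t + h, (c, y)) - f1 (t, (c, y))) * (x + h - x).
  apply: (@MVT _ (fun s => f (t + h, (s, y)) - f (t, (s, y)))
    (fun s => f1 (t + h, (s, y)) - f1 (t, (s, y))) _ _ xh).
    by move=> s _; apply: is_deriveB; exact/is_derive_axis_1.
  by apply: continuous_subspaceT => s; apply: cvgB; exact: (continuous_section_1 cf).
have [s4 s4t E4] : exists2 c, c \in `]t, t + h[ &
    f1 (t + h, (s3, y)) - f1 (t, (s3, y)) =
    f01 (c, (s3, y)) * (t + h - t).
  apply: (@MVT _ (fun s => f1 (s, (s3, y)))
    (fun s => f01 (s, (s3, y))) _ _ th).
    by move=> s _; exact/is_derive_axis_t.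
  by apply: continuous_subspaceT => s; exact: (continuous_section_t cf1).
have E : f01 (s4, (s3, y)) = f10 (s1, (s2, y)).
  have hh : t + h - t != 0 by rewrite addrAC subrr add0r gt_eqF.
  apply: (mulIf hh); rewrite -E4.
  apply: (mulIf (_ : x + h - x != 0)); first by rewrite addrAC subrr add0r gt_eqF.
  by rewrite -E3 [in RHS]mulrAC -E2 -E1; ring.
have [+ _] := dH _ (near_z _ _ s4t s3x).
have [_] := dH _ (near_z _ _ s1t s2x).
rewrite E distrC => h1 h2.
rewrite ltW// (splitr e) -(subrKA (f10 (s1, (s2, y)))).
by rewrite (le_lt_trans (ler_normD _ _))// ltrD.
Qed.

Definition Dax (j : nat) : (T -> R) -> T -> R :=
  match j with 0 => @Dt R R | 1 => @D1 R R | _ => @D2 R R end.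

Arguments Dax : simpl never.

Lemma Ck_Dax n f j : Ck n.+1 f ->
  [/\ continuous f, forall z, is_derive z (ax j) f (Dax j f z) & Ck n (Dax j f)].
Proof.
move=> [cf df c0 c1 c2]; split => //.
- by case: j => [|[|j]] z; have [d0 d1 d2] := df z;
    [exact: (derivableP d0)|exact: (derivableP d1)|exact: (derivableP d2)].
- by case: j => [|[|j]]; [exact: c0|exact: c1|exact: c2].
Qed.

Lemma Dax_support f j r : (forall z, r < `|z| -> f z = 0) ->
  forall z, r < `|z| -> Dax j f z = 0.
Proof.
move=> f0 z rz.
have E : \near z, f z = cst 0 z.
  have : \forall w \near z, r < `|w|.
    exact: (@norm_continuous _ _ z _ (lt_nbhsr rz)).
  by apply: filterS => w; exact: f0.
by case: j => [|[|j]]; rewrite /Dax /Dt /D1 /D2 (near_eq_derive _ E) ?derive_cst//;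
  rewrite xpair_eqE ?xpair_eqE oner_eq0 ?andbF.
Qed.

Lemma test_support f : test_function f -> exists r, forall z, r < `|z| -> f z = 0.
Proof.
move=> [_ /compact_bounded[M [_ fM]]]; exists (M + 1) => z Mz.
apply/eqP; apply: contraTT Mz => fz; rewrite -leNgt.
by apply: (fM (M + 1)); rewrite ?ltrDl//; exact: subset_closure.
Qed.

Lemma Ck_continuous n f : Ck n f -> continuous f.
Proof. by case: n => // n []. Qed.

Lemma test_Dax f j : test_function f ->
  [/\ continuous f, cbm f, forall z, is_derive z (ax j) f (Dax j f z) ,
      continuous (Dax j f) & cbm (Dax j f)].
Proof.
move=> tf; have [r f0] := test_support tf; have [+ _] := tf.
move=> /(_ 2%N) /(Ck_Dax j)[cf df /Ck_continuous cD]; split => //.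
- by apply: (@lbm_cbm _ _ r) => //; exact: continuous_lbm.
- apply: (@lbm_cbm _ _ r); first exact: continuous_lbm.
  exact: Dax_support.
Qed.

Lemma test_Dax2 f i j : test_function f ->
  [/\ forall z, is_derive z (ax i) (Dax j f) (Dax i (Dax j f) z),
    continuous (Dax i (Dax j f)) & cbm (Dax i (Dax j f))].
Proof.
move=> tf; have [r f0] := test_support tf; have [+ _] := tf.
move=> /(_ 3%N) /(Ck_Dax j)[_ _ /(Ck_Dax i)[cf df /Ck_continuous cD]]; split => //.
apply: (@lbm_cbm _ _ r); first exact: continuous_lbm.
by apply: Dax_support; exact: Dax_support.
Qed.

Lemma test_Dt_D1 f : test_function f -> Dax 0 (Dax 1 f) = Dax 1 (Dax 0 f).
Proof.
move=> tf.
have [cf _ df0 cf0 _] := test_Dax 0 tf; have [_ _ df1 cf1 _] := test_Dax 1 tf.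
have [df01 cf01 _] := test_Dax2 0 1 tf; have [df10 cf10 _] := test_Dax2 1 0 tf.
exact: (mixed_derive_sym cf cf0 cf1 cf01 cf10 df0 df1 df01 df10).
Qed.

End AxisDerivatives.

(** * Self-similar conservation laws *)

Section PointwiseDerivatives.
Context (R : realType) (V : normedModType R).
Implicit Types (f g : V -> R) (z v : V).

Lemma dE f z v a b : is_derive z v f a -> a = b -> is_derive z v f b.
Proof. by move=> + <-. Qed.

Lemma dD f g z v a b : is_derive z v f a -> is_derive z v g b ->
  is_derive z v (fun x => f x + g x) (a + b).
Proof. exact: is_deriveD. Qed.

Lemma dB f g z v a b : is_derive z v f a -> is_derive z v g b ->
  is_derive z v (fun x => f x - g x) (a - b).
Proof. exact: is_deriveB. Qed.

Lemma dM f g z v a b : is_derive z v f a -> is_derive z v g b ->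
  is_derive z v (fun x => f x * g x) (a * g z + f z * b).
Proof.
move=> df dg; apply: dE (is_deriveM df dg) _.
by rewrite addrC /GRing.scale/= [a * _]mulrC.
Qed.

Lemma dC c z v : is_derive z v (fun=> c : R) 0.
Proof. exact: is_derive_cst. Qed.

Lemma dZ f c z v a : is_derive z v f a -> is_derive z v (fun x => c * f x) (c * a).
Proof. by move=> df; apply: dE (dM (dC c z v) df) _; rewrite mul0r add0r. Qed.

End PointwiseDerivatives.

Section PotentialLaw.
Context (R : realType).
Local Notation leb := (@lebesgue_measure R).
Local Notation T := (R * (R * R))%type.

Lemma Rint2_section f (t : R) : cbm f ->
  (forall y, \int[leb]_x f (t, (x, y)) = 0) -> \int[leb2 R]_x f (t, x) = 0.
Proof.
move=> cf f0; rewrite /Rintegral -(integral21_prod_meas1 (cbm_section_x t cf)).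
rewrite integral0_eq ?fine0// => y _; rewrite /fubini_G -[LHS]fineK.
  by have := f0 y; rewrite /Rintegral => ->.
exact: integrable_fin_num (cbm_section_1 t y cf).
Qed.

(* If H_x = q0 and H_t = - q1, then (q0, q1) satisfies the conservation law
   q0_t + q1_x = 0 in the weak sense, with initial value q0(0, .). *)
Lemma potential_weak_law (q0 q1 H : R -> R -> R) psi :
  lbm (fun z : T => q0 z.1 z.2.1) -> lbm (fun z : T => q1 z.1 z.2.1) ->
  lbm (fun z : T => H z.1 z.2.1) ->
  (forall t, 0 <= t -> continuous (H t) /\ exists s : seq R, forall x, x \notin s ->
     is_derive x 1 (H t) (q0 t x) /\ {for x, continuous (q0 t)}) ->
  (forall x, {in `[0, +oo[, continuous (H ^~ x)} /\
     exists s : seq R, forall t, 0 < t -> t \notin s ->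
     is_derive t 1 (H ^~ x) (- q1 t x) /\ {for t, continuous (q1 ^~ x)}) ->
  test_function psi ->
  \int[leb3 R]_(z in halfspace R) (q0 z.1 z.2.1 * Dt psi z + q1 z.1 z.2.1 * D1 psi z) +
  \int[leb2 R]_x (q0 0 x.1 * psi (0, x)) = 0.
Proof.
move=> l0 l1 lH Hx Ht tpsi.
have [cp bp dp0 cp0 bp0] := test_Dax 0 tpsi; have [_ _ dp1 cp1 bp1] := test_Dax 1 tpsi.
have [dp01 cp01 bp01] := test_Dax2 0 1 tpsi; have [dp10 cp10 bp10] := test_Dax2 1 0 tpsi.
have sym := test_Dt_D1 tpsi.
have [_ [? [r0 p0]]] := bp; have [_ [? [r1 p1]]] := bp0.
have [_ [? [r2 p2]]] := bp1; have [_ [? [r3 p3]]] := bp01.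
move: p0 p1 p2 p3 dp10 cp10 bp10; rewrite -sym.
rewrite -/(Dax 0 psi) -/(Dax 1 psi).
move: (Dax 0 psi) (Dax 1 psi) (Dax 0 (Dax 1 psi)) dp0 dp1 cp0 cp1 bp0 bp1 cp01 bp01 dp01.
move=> {sym tpsi} pt px ptx dp0 dp1 cp0 cp1 bp0 bp1 cpx bpx dpx p0 p1 p2 p3 dpt _ _.
(* [F1] is the x-derivative of H psi_t and [F2] the t-derivative of H psi_x. The mixed term H psi_tx
   cancels in F1 - F2, which is the integrand of the weak law; across the jumps of [q0] and [q1]
   only the continuity of [H] enters. *)
pose F1 (z : T) := q0 z.1 z.2.1 * pt z + H z.1 z.2.1 * ptx z.
pose F2 (z : T) := - q1 z.1 z.2.1 * px z + H z.1 z.2.1 * ptx z.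
have bF1 : cbm F1 by apply: cbmD; [exact: (cbmMl l0)|exact: (cbmMl lH)].
have bF2 : cbm F2 by apply: cbmD; [exact: (cbmMl (lbmN l1))|exact: (cbmMl lH)].
pose m := Num.max (Num.max r0 r1) (Num.max r2 r3).
have big z : m < `|z| -> [/\ psi z = 0, pt z = 0, px z = 0 & ptx z = 0].
  rewrite !gt_max => /andP[/andP[a b] /andP[c d]].
  by split; [exact: (p0 z).2|exact: (p1 z).2|exact: (p2 z).2|exact: (p3 z).2].
have I1 : \int[leb3 R]_(z in halfspace R) F1 z = 0.
  apply: Rint_half_1 => // t y t0; have [cH [s dH]] := Hx t t0.
  apply: (@Rintegral_derive_line _ (fun x => H t x * pt (t, (x, y))) _ s m).
  - by move=> x; apply: cvgM; [exact: cH|exact: (continuous_section_1 cp0)].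
  - exact: cbm_section_1.
  - move=> x xm; have [|_ E1 _ E2] := big (t, (x, y)); last by rewrite /F1 E1 E2 !mulr0 addr0.
    by rewrite (lt_le_trans xm)// norm3E/= !le_max lexx ?orbT.
  - move=> x xs; have [dHx cqx] := dH x xs; split.
      by have := dM dHx (iffLR (is_derive_axis_1 _ _ _ _ _) (dpt (t, (x, y)))).
    apply: cvgD; apply: cvgM => //; [exact: (continuous_section_1 cp0)|exact: cH|].
    exact: (continuous_section_1 cpx).
have I2 : \int[leb3 R]_(z in halfspace R) F2 z =
    \int[leb2 R]_x (- (H 0 x.1 * px (0, x))).
  apply: Rint_half_t => // -[x y]; have [cH [s dH]] := Ht x.
  apply: (@Rintegral_derive_halfline _ (fun t => H t x * px (t, (x, y))) _ s m).
  - by move=> t t0; apply: cvgM; [exact: cH|exact: (continuous_section_t cp1)].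
  - exact: cbm_section_t.
  - move=> t xm; have [|_ _ E1 E2] := big (t, (x, y)); last by rewrite /F2 E1 E2 !mulr0 addr0.
    by rewrite (lt_le_trans xm)// norm3E/= !le_max lexx ?orbT.
  - move=> t t0 ts; have [dHt cqt] := dH t t0 ts; split.
      by have := dM dHt (iffLR (is_derive_axis_t _ _ _ _) (dpx (t, (x, y)))).
    apply: cvgD; apply: cvgM => //; first exact: cvgN.
    + exact: (continuous_section_t cp1).
    + exact: differentiable_continuous ((derivable1_diffP _ _).1 (@ex_derive _ _ _ _ _ _ _ dHt)).
    + exact: (continuous_section_t cpx).
have E12 : \int[leb3 R]_(z in halfspace R) (q0 z.1 z.2.1 * pt z + q1 z.1 z.2.1 * px z) =
    - \int[leb2 R]_x (- (H 0 x.1 * px (0, x))).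
  rewrite -I2 -[RHS]add0r -I1 -RintB3//; last exact: measurable_halfspace.
  by apply: eq_Rintegral => z _; rewrite /F1 /F2; ring.
have c3 : cbm (fun z => - (H z.1 z.2.1 * px z)) by apply: cbmN; exact: (cbmMl lH).
have c4 : cbm (fun z => q0 z.1 z.2.1 * psi z) by exact: (cbmMl l0).
rewrite E12 addrC -RintegralB//; last 2 first.
- exact: (cbm_section_x 0 c4).
- exact: (cbm_section_x 0 c3).
(* What remains at t = 0 is q0 psi + H psi_x, the x-derivative of H psi. *)
apply: (@Rint2_section (fun z => q0 z.1 z.2.1 * psi z - - (H z.1 z.2.1 * px z)) 0).
  exact: cbmB.
move=> y; have [cH [s dH]] := Hx 0 (lexx _).
apply: (@Rintegral_derive_line _ (fun x => H 0 x * psi (0, (x, y))) _ s m).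
- by move=> x; apply: cvgM; [exact: cH|exact: (continuous_section_1 cp)].
- exact: (cbm_section_1 0 y (cbmB c4 c3)).
- move=> x xm; have [|E0 _ E1 _] := big (0, (x, y)); last by rewrite E0 E1 !mulr0 !oppr0 addr0.
  by rewrite (lt_le_trans xm)// norm3E/= !le_max lexx ?orbT.
- move=> x xs; have [dHx cqx] := dH x xs; split.
    have := dM dHx (iffLR (is_derive_axis_1 _ _ _ _ _) (dp1 (0, (x, y)))).
    by move/dE; apply; rewrite /= opprK.
  apply: cvgB; [apply: cvgM => //|apply: cvgN; apply: cvgM].
  + exact: (continuous_section_1 cp).
  + exact: cH.
  + exact: (continuous_section_1 cp1).
Qed.

End PotentialLaw.

Section ContinuityTools.
Context (R : realType).

Lemma cvg_max (X : Type) (F : set_system X) (FF : Filter F) (f g : X -> R) (a b : R) :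
  f @ F --> a -> g @ F --> b -> (fun y => Num.max (f y) (g y)) @ F --> Num.max a b.
Proof.
move=> fa gb; rewrite maxr_absE; under eq_fun do rewrite maxr_absE.
by apply: cvgMl; apply: cvgD; [exact: cvgD|apply: cvg_norm; exact: cvgB].
Qed.

Lemma cvg_min (X : Type) (F : set_system X) (FF : Filter F) (f g : X -> R) (a b : R) :
  f @ F --> a -> g @ F --> b -> (fun y => Num.min (f y) (g y)) @ F --> Num.min a b.
Proof.
move=> fa gb; rewrite minr_absE; under eq_fun do rewrite minr_absE.
by apply: cvgMl; apply: cvgB; [exact: cvgD|apply: cvg_norm; exact: cvgB].
Qed.

Lemma near_eq_continuous (X : topologicalType) (f g : X -> R) x :
  (\near x, f x = g x) -> {for x, continuous f} -> {for x, continuous g}.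
Proof.
move=> fg cf; rewrite /prop_for /continuous_at -(nbhs_singleton fg).
by apply: cvg_trans cf; apply: near_eq_cvg; apply: filterS fg => y ->.
Qed.

Lemma dcomp1 (h l : R -> R) (x a b : R) : is_derive x 1 l b ->
  is_derive (l x) 1 h a -> is_derive x 1 (fun y => h (l y)) (a * b).
Proof. by move=> dl dh; exact: is_derive1_comp. Qed.

End ContinuityTools.

Section SelfSimilarLaw.
Context (R : realType).
Local Notation T := (R * (R * R))%type.
Implicit Types (F : R -> R) (t x w : R).

(* The profile A is meant to be constant beyond -4 and 4, and w is the value
   in the wedge |x| <= 2 (t - 1) that opens after the focusing time t = 1. *)
Definition selfsim (A : R -> R) (w t x : R) : R :=
  if t < 1 then A (x / (1 - t)) else
  if `|x| <= 2 * (t - 1) then w else if x < 0 then A (- 4) else A 4.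

Variables (A B : R -> R) (wA wB : R) (S : seq R).
Hypotheses (cA : continuous A) (cB : continuous B).
Hypotheses (A4 : forall x : R, 4 <= x -> A x = A 4) (AN4 : forall x : R, x <= - 4 -> A x = A (- 4)).
Hypotheses (B4 : forall x : R, 4 <= x -> B x = B 4) (BN4 : forall x : R, x <= - 4 -> B x = B (- 4)).
(** On the axis x = 0 the similarity variable x / (1 - t) is 0 for all t < 1, so a kink at 0 would
    not be confined to finitely many times. *)
Hypothesis S0 : 0 \notin S.
Hypothesis dAB : forall x, x \notin S ->
  exists a, is_derive x 1 A a /\ is_derive x 1 B (- x * a).
Hypotheses (RH4 : 2 * (A 4 - wA) = B 4 - wB) (RHN4 : - 2 * (A (- 4) - wA) = B (- 4) - wB).

Local Notation q0 := (selfsim A wA).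
Local Notation q1 := (selfsim B wB).
(** The potential with H_x = q0 and H_t = - q1. Both fields are homogeneous of degree 0 about the
    focusing point (1, 0), so the potential is of degree 1 and Euler's formula gives H = x H_x + (t
    - 1) H_t. *)
Let H t x : R := x * q0 t x - (t - 1) * q1 t x.

Lemma selfsim_lt1 F w t x : t < 1 -> selfsim F w t x = F (x / (1 - t)).
Proof. by rewrite /selfsim => ->. Qed.

Lemma selfsim_in F w t x : 1 <= t -> `|x| <= 2 * (t - 1) -> selfsim F w t x = w.
Proof. by rewrite /selfsim leNgt => /negbTE -> ->. Qed.

Lemma selfsim_right F w t x : (forall x : R, 4 <= x -> F x = F 4) ->
  0 < x -> 4 * (1 - t) < x -> 2 * (t - 1) < x -> selfsim F w t x = F 4.
Proof.
move=> F4 x0 h1 h2; rewrite /selfsim; case: ltP => t1.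
  by rewrite F4// ler_pdivlMr ?subr_gt0// ltW.
by rewrite gtr0_norm// leNgt h2/= ltNge (ltW x0).
Qed.

Lemma selfsim_left F w t x : (forall x : R, x <= - 4 -> F x = F (- 4)) ->
  x < 0 -> 4 * (1 - t) < - x -> 2 * (t - 1) < - x -> selfsim F w t x = F (- 4).
Proof.
move=> F4 x0 h1 h2; rewrite /selfsim; case: ltP => t1.
  by rewrite F4// ler_pdivrMr ?subr_gt0//; lra.
by rewrite ltr0_norm// leNgt h2/= x0.
Qed.

Lemma near_selfsim_lt1 F w t x : t < 1 ->
  \forall s \near t, F (x / (1 - s)) = selfsim F w s x.
Proof. by move=> /lt_nbhsl; apply: filterS => s /selfsim_lt1 ->. Qed.

Lemma near_selfsim_in F w t x : `|x| < 2 * (t - 1) ->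
  \forall s \near t, w = selfsim F w s x.
Proof.
move=> xt; have : `|x| / 2 + 1 < t by lra.
move=> /lt_nbhsr; apply: filterS => s xs; rewrite selfsim_in//.
  by have := normr_ge0 x; lra.
by lra.
Qed.

Lemma near_selfsim_right F w t x : (forall x : R, 4 <= x -> F x = F 4) ->
  0 < x -> 4 * (1 - t) < x -> 2 * (t - 1) < x ->
  \forall s \near t, F 4 = selfsim F w s x.
Proof.
move=> F4 x0 h1 h2; have : 1 - x / 4 < t by lra.
have : t < 1 + x / 2 by lra.
move=> /lt_nbhsl a /lt_nbhsr b; near=> s.
have sl : s < 1 + x / 2 by near: s.
have sr : 1 - x / 4 < s by near: s.
by rewrite selfsim_right//; lra.
Unshelve. all: by end_near. Qed.

Lemma near_selfsim_left F w t x : (forall x : R, x <= - 4 -> F x = F (- 4)) ->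
  x < 0 -> 4 * (1 - t) < - x -> 2 * (t - 1) < - x ->
  \forall s \near t, F (- 4) = selfsim F w s x.
Proof.
move=> F4 x0 h1 h2; have : 1 + x / 4 < t by lra.
have : t < 1 - x / 2 by lra.
move=> /lt_nbhsl a /lt_nbhsr b; near=> s.
have sl : s < 1 - x / 2 by near: s.
have sr : 1 + x / 4 < s by near: s.
by rewrite selfsim_left//; lra.
Unshelve. all: by end_near. Qed.

(** The potential for t >= 1 in terms of max and min, where continuity is evident even at t = 1.
    Outside the wedge it agrees with [H] exactly by the Rankine-Hugoniot conditions [RH4] and [RHN4]
    for the shock speeds 2 and - 2. *)
Let G t x : R := wA * Num.max (- (2 * (t - 1))) (Num.min (2 * (t - 1)) x) - (t - 1) * wB
  + A 4 * Num.max 0 (x - 2 * (t - 1)) + A (- 4) * Num.min 0 (x + 2 * (t - 1)).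

Let HG t x : 1 <= t -> H t x = G t x.
Proof.
move=> t1; rewrite /H /G /selfsim ltNge t1/=.
have [|xl] := leP `|x| (2 * (t - 1)).
  rewrite ler_norml => /andP[h1 h2].
  have -> : Num.min (2 * (t - 1)) x = x by rewrite min_r.
  have -> : Num.max (- (2 * (t - 1))) x = x by rewrite max_r.
  have -> : Num.max 0 (x - 2 * (t - 1)) = 0 by rewrite max_l; lra.
  have -> : Num.min 0 (x + 2 * (t - 1)) = 0 by rewrite min_l; lra.
  by ring.
have [x0|x0] := ltP x 0.
  rewrite ltr0_norm// in xl.
  have -> : Num.min (2 * (t - 1)) x = x by rewrite min_r; lra.
  have -> : Num.max (- (2 * (t - 1))) x = - (2 * (t - 1)) by rewrite max_l; lra.
  have -> : Num.max 0 (x - 2 * (t - 1)) = 0 by rewrite max_l; lra.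
  have -> : Num.min 0 (x + 2 * (t - 1)) = x + 2 * (t - 1) by rewrite min_r; lra.
  have -> : B (- 4) = wB + - 2 * (A (- 4) - wA) by rewrite RHN4 addrC subrK.
  by ring.
rewrite ger0_norm// in xl.
have -> : Num.min (2 * (t - 1)) x = 2 * (t - 1) by rewrite min_l; lra.
have -> : Num.max (- (2 * (t - 1))) (2 * (t - 1)) = 2 * (t - 1) by rewrite max_r; lra.
have -> : Num.max 0 (x - 2 * (t - 1)) = x - 2 * (t - 1) by rewrite max_r; lra.
have -> : Num.min 0 (x + 2 * (t - 1)) = 0 by rewrite min_l; lra.
have -> : B 4 = wB + 2 * (A 4 - wA) by rewrite RH4 addrC subrK.
by ring.
Qed.

Let cG1 t : continuous (G t).
Proof.
move=> x; apply: cvgD; [apply: cvgD; [apply: cvgB|]|]; try exact: cvg_cst.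
- apply: cvgM; first exact: cvg_cst.
  by apply: cvg_max; [exact: cvg_cst|apply: cvg_min; [exact: cvg_cst|exact: cvg_id]].
- apply: cvgM; first exact: cvg_cst.
  by apply: cvg_max; [exact: cvg_cst|apply: cvgB; [exact: cvg_id|exact: cvg_cst]].
- apply: cvgM; first exact: cvg_cst.
  by apply: cvg_min; [exact: cvg_cst|apply: cvgD; [exact: cvg_id|exact: cvg_cst]].
Qed.

Let cG2 x : continuous (G ^~ x).
Proof.
have c2 : continuous (fun t : R => 2 * (t - 1)).
  by move=> t; apply: cvgM; [exact: cvg_cst|apply: cvgB; [exact: cvg_id|exact: cvg_cst]].
move=> t; apply: cvgD; [apply: cvgD; [apply: cvgB|]|].
- apply: cvgM; first exact: cvg_cst.
  apply: cvg_max; first by apply: cvgN; exact: c2.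
  by apply: cvg_min; [exact: c2|exact: cvg_cst].
- by apply: cvgM; [apply: cvgB; [exact: cvg_id|exact: cvg_cst]|exact: cvg_cst].
- apply: cvgM; first exact: cvg_cst.
  by apply: cvg_max; [exact: cvg_cst|apply: cvgB; [exact: cvg_cst|exact: c2]].
- apply: cvgM; first exact: cvg_cst.
  by apply: cvg_min; [exact: cvg_cst|apply: cvgD; [exact: cvg_cst|exact: c2]].
Qed.

Let cdiv F t : continuous F -> continuous (fun x : R => F (x / (1 - t))).
Proof.
move=> cF x; apply: (@continuous_comp _ _ _ (fun x : R => x / (1 - t)) F); last exact: cF.
by apply: cvgM; [exact: cvg_id|exact: cvg_cst].
Qed.

Let cdivt F x t : continuous F -> t < 1 -> {for t, continuous (fun t : R => F (x / (1 - t)))}.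
Proof.
move=> cF t1; apply: (@continuous_comp _ _ _ (fun t : R => x / (1 - t)) F); last exact: cF.
apply: cvgM; first exact: cvg_cst.
apply: cvgV; first by rewrite subr_eq0 gt_eqF.
by apply: cvgB; [exact: cvg_cst|exact: cvg_id].
Qed.

Lemma selfsim_Hx t : continuous (H t).
Proof.
have [t1|t1] := ltP t 1; last first.
  by rewrite (_ : H t = G t)//; apply/funext => x; exact: HG.
rewrite (_ : H t = fun x : R => x * A (x / (1 - t)) - (t - 1) * B (x / (1 - t))); last first.
  by apply/funext => x; rewrite /H !selfsim_lt1.
move=> x; apply: cvgB; apply: cvgM; [exact: cvg_id| |exact: cvg_cst|]; exact: cdiv.
Qed.

Lemma selfsim_Ht x : continuous (H ^~ x).
Proof.
have cB1 : continuous (fun t : R => t - 1).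
  by move=> t; apply: cvgB; [exact: cvg_id|exact: cvg_cst].
move=> t; have [t1|t1|->] := ltgtP t 1.
- apply: (@near_eq_continuous _ _ (fun t : R => x * A (x / (1 - t)) - (t - 1) * B (x / (1 - t)))).
    by apply: filterS (lt_nbhsl t1) => s s1; rewrite /H !selfsim_lt1.
  by apply: cvgB; apply: cvgM; [exact: cvg_cst|exact: cdivt|exact: cB1|exact: cdivt].
- apply: (@near_eq_continuous _ _ (G ^~ x)); last exact: cG2.
  by apply: filterS (lt_nbhsr t1) => s s1; rewrite HG// ltW.
(* At the focusing time: for x different from 0 both fields are constant in t near t = 1, and at x =
   0 the factor t - 1 absorbs the jump of [q1]. *)
- have [x0|x0|->] := ltgtP x 0.
  + apply: (@near_eq_continuous _ _ (fun t : R => x * A (- 4) - (t - 1) * B (- 4))).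
      have h1 := @near_selfsim_left A wA 1 x AN4 x0.
      have h2 := @near_selfsim_left B wB 1 x BN4 x0.
      near=> s; rewrite /H; congr (_ * _ - _ * _); near: s.
        by apply: h1; lra.
      by apply: h2; lra.
    by apply: cvgB; [exact: cvg_cst|apply: cvgM; [exact: cB1|exact: cvg_cst]].
  + apply: (@near_eq_continuous _ _ (fun t : R => x * A 4 - (t - 1) * B 4)).
      have h1 := @near_selfsim_right A wA 1 x A4 x0.
      have h2 := @near_selfsim_right B wB 1 x B4 x0.
      near=> s; rewrite /H; congr (_ * _ - _ * _); near: s.
        by apply: h1; lra.
      by apply: h2; lra.
    by apply: cvgB; [exact: cvg_cst|apply: cvgM; [exact: cB1|exact: cvg_cst]].
  + rewrite (_ : H ^~ 0 = fun t : R => B 0 * Num.max 0 (1 - t) - wB * Num.max 0 (t - 1)).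
      apply: cvgB; (apply: cvgM; first exact: cvg_cst); apply: cvg_max;
        try exact: cvg_cst; last exact: cB1.
      by apply: cvgB; [exact: cvg_cst|exact: cvg_id].
    apply/funext => s; rewrite /H mul0r sub0r.
    have [s1|s1] := ltP s 1.
      rewrite selfsim_lt1// mul0r max_r ?subr_ge0 ?(ltW s1)//.
      by rewrite max_l ?subr_le0 ?(ltW s1)//; ring.
    rewrite selfsim_in//; last by rewrite normr0; lra.
    rewrite max_l ?subr_le0// max_r ?subr_ge0//; ring.
Unshelve. all: by end_near. Qed.

Lemma selfsim_dHx t : exists s : seq R, forall x, x \notin s ->
  is_derive x 1 (H t) (q0 t x) /\ {for x, continuous (q0 t)}.
Proof.
have [t1|t1] := ltP t 1.
  have t0 : 1 - t != 0 by rewrite subr_eq0 gt_eqF.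
  have -> : H t = fun x : R => x * A (x / (1 - t)) - (t - 1) * B (x / (1 - t)).
    by apply/funext => x; rewrite /H !selfsim_lt1.
  have -> : q0 t = fun x : R => A (x / (1 - t)).
    by apply/funext => x; rewrite !selfsim_lt1.
  exists [seq (1 - t) * y | y <- S] => x xs; split; last exact: cdiv.
  have xS : x / (1 - t) \notin S.
    by apply: contra xs => h; apply/mapP; exists (x / (1 - t)) => //; rewrite mulrC divfK.
  have [a [dA dB']] := dAB xS.
  have di : is_derive x 1 (fun x : R => x / (1 - t)) ((1 - t)^-1).
    by apply: dE (dM (is_derive_id x 1) (dC _ _ _)) _; rewrite mul1r mulr0 addr0.
  have := dB (dM (is_derive_id x 1) (dcomp1 di dA))
             (dZ (t - 1) (dcomp1 di dB')).
  by move/dE; apply; rewrite /=; field.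
exists [:: 2 * (t - 1); - (2 * (t - 1))] => x.
rewrite !inE negb_or => /andP[xn1 xn2].
have [xin|xout] := ltP `|x| (2 * (t - 1)).
  have nr : \near x, `|x| < 2 * (t - 1).
    exact: (@norm_continuous _ _ x _ (lt_nbhsl xin)).
  split; last first.
    apply: near_eq_continuous (cvg_cst wA).
    by apply: filterS nr => y yt; rewrite selfsim_in// ltW.
  rewrite (selfsim_in _ _ t1 (ltW xin)).
  apply: (@near_eq_is_derive _ _ _ (fun x : R => x * wA - (t - 1) * wB)).
    by apply: filterS nr => y yt; rewrite /H !selfsim_in// ltW.
  apply: dE (dB (dM (is_derive_id x 1) (dC _ _ _)) (dC _ _ _)) _.
  by rewrite /=; ring.
have [x0|x0] : x < - (2 * (t - 1)) \/ 2 * (t - 1) < x.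
  move: xout xn1 xn2; have [x0|x0] := ltP x 0.
    rewrite ltr0_norm// => h _ xn; left; rewrite lt_neqAle xn/=; lra.
  by rewrite ger0_norm// => h xn _; right; rewrite lt_neqAle eq_sym xn.
- have nr : \forall y \near x, y < - (2 * (t - 1)) by exact: (lt_nbhsl x0).
  have E F w y : (forall x : R, x <= - 4 -> F x = F (- 4)) -> y < - (2 * (t - 1)) ->
      selfsim F w t y = F (- 4).
    by move=> hF hy; rewrite selfsim_left//; lra.
  split; last first.
    apply: near_eq_continuous (cvg_cst (A (- 4))).
    by apply: filterS nr => y yt; rewrite E.
  rewrite E//.
  apply: (@near_eq_is_derive _ _ _ (fun x : R => x * A (- 4) - (t - 1) * B (- 4))).
    by apply: filterS nr => y yt; rewrite /H !E.
  apply: dE (dB (dM (is_derive_id x 1) (dC _ _ _)) (dC _ _ _)) _.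
  by rewrite /=; ring.
- have nr : \forall y \near x, 2 * (t - 1) < y by exact: (lt_nbhsr x0).
  have E F w y : (forall x : R, 4 <= x -> F x = F 4) -> 2 * (t - 1) < y ->
      selfsim F w t y = F 4.
    by move=> hF hy; rewrite selfsim_right//; lra.
  split; last first.
    apply: near_eq_continuous (cvg_cst (A 4)).
    by apply: filterS nr => y yt; rewrite E.
  rewrite E//.
  apply: (@near_eq_is_derive _ _ _ (fun x : R => x * A 4 - (t - 1) * B 4)).
    by apply: filterS nr => y yt; rewrite /H !E.
  apply: dE (dB (dM (is_derive_id x 1) (dC _ _ _)) (dC _ _ _)) _.
  by rewrite /=; ring.
Qed.

Let near_const_dH x t a b : (\forall s \near t, a = q0 s x) ->
  (\forall s \near t, b = q1 s x) ->
  is_derive t 1 (H ^~ x) (- q1 t x) /\ {for t, continuous (q1 ^~ x)}.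
Proof.
move=> na nb; split; last exact: near_eq_continuous nb (cvg_cst b).
rewrite -(nbhs_singleton nb).
apply: (@near_eq_is_derive _ _ _ (fun t : R => x * a - (t - 1) * b)).
  by near=> s; rewrite /H; congr (_ * _ - _ * _); near: s.
apply: dE (dB (dC _ _ _) (dM (dB (is_derive_id t 1) (dC 1 _ _)) (dC _ _ _))) _.
by rewrite /=; ring.
Unshelve. all: by end_near. Qed.

Lemma selfsim_dHt x : exists s : seq R, forall t, 0 < t -> t \notin s ->
  is_derive t 1 (H ^~ x) (- q1 t x) /\ {for t, continuous (q1 ^~ x)}.
Proof.
(* For fixed x the exceptional times are the focusing time, the passage of an edge of the wedge, and
   the times 1 - x / y at which the similarity variable equals a kink y. *)
exists (1 :: 1 + `|x| / 2 :: [seq 1 - x / y | y <- S]) => t _.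
rewrite !inE !negb_or => /and3P[tn1 tnx tS].
have [t1|t1] := ltP t 1.
  have t0 : 1 - t != 0 by rewrite subr_eq0 gt_eqF.
  have xS : x / (1 - t) \notin S.
    apply: contra tS => h; apply/mapP; exists (x / (1 - t)) => //.
    have [x0|x0] := eqVneq x 0; first by move: h; rewrite x0 mul0r => /(negP S0).
    by rewrite invf_div mulrCA divff// mulr1 subKr.
  split; last first.
    by apply: near_eq_continuous (cdivt (x := x) cB t1); exact: near_selfsim_lt1.
  have [a [dA dB']] := dAB xS.
  apply: (@near_eq_is_derive _ _ _ (fun t : R => x * A (x / (1 - t)) - (t - 1) * B (x / (1 - t)))).
    by apply: filterS (lt_nbhsl t1) => s s1; rewrite /H !selfsim_lt1.
  have di : is_derive t 1 (fun t : R => x / (1 - t)) (x / (1 - t) ^+ 2).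
    have d1 : is_derive t 1 (fun t : R => 1 - t) (- 1).
      by apply: dE (dB (dC 1 _ _) (is_derive_id t 1)) _; rewrite sub0r.
    apply: dE (dZ x (@is_deriveV _ (fun t : R => 1 - t) t (- 1) 1 t0 d1)) _.
    by rewrite /GRing.scale/=; field.
  have := dB (dZ x (dcomp1 di dA))
     (dM (dB (is_derive_id t 1) (dC 1 _ _)) (dcomp1 di dB')).
  by rewrite selfsim_lt1//; move/dE; apply; rewrite /=; field.
have t2 : 1 < t by rewrite lt_def tn1.
have [xin|xout] := ltP `|x| (2 * (t - 1)).
  by apply: (@near_const_dH _ _ wA wB); exact: near_selfsim_in.
have {}xout : 2 * (t - 1) < `|x|.
  rewrite lt_neqAle xout andbT; apply: contra tnx => /eqP <-.
  by apply/eqP; field.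
have [x0|x0] := ltP x 0.
  rewrite ltr0_norm// in xout.
  by apply: (@near_const_dH _ _ (A (- 4)) (B (- 4))); apply: near_selfsim_left => //; lra.
rewrite ger0_norm// in xout.
by apply: (@near_const_dH _ _ (A 4) (B 4)); apply: near_selfsim_right => //; lra.
Qed.

Lemma lbm_selfsim F w C : continuous F -> (forall x, `|F x| <= C) ->
  lbm (fun z : T => selfsim F w z.1 z.2.1).
Proof.
move=> cF FC; split; last first.
  move=> r; exists (Num.max C `|w|) => z _; rewrite /selfsim.
  by do 3?case: ifPn => _; rewrite le_max ?FC ?lexx ?orbT.
have mt : measurable_fun setT (fun z : measurableTypeR R * (measurableTypeR R * measurableTypeR R) => z.1).
  exact: measurable_fst.
have mx : measurable_fun setT (fun z : measurableTypeR R * (measurableTypeR R * measurableTypeR R) => z.2.1).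
  by apply: (measurableT_comp measurable_fst); exact: measurable_snd.
(* The factor 1 / (1 - t) is cut off at t = 1, where [selfsim] stops reading it, to make it
   measurable on the whole line. *)
pose tau (t : measurableTypeR R) : R := if t < 1 then (1 - t)^-1 else 0.
have mtau : measurable_fun setT tau.
  apply: measurable_fun_if => //.
  - by apply: measurable_fun_ltr => //; exact: measurable_id.
  - rewrite setTI; apply: open_continuous_measurable_fun.
      rewrite (_ : _ @^-1` _ = [set t | t < 1]); first exact: open_lt.
      by apply/seteqP; split.
    move=> t; rewrite inE/= => t1; apply: cvgV; first by rewrite subr_eq0 gt_eqF.
    by apply: cvgB; [exact: cvg_cst|exact: cvg_id].
rewrite (_ : (fun _ => _) = (fun z : T => if z.1 < 1 then F (z.2.1 * tau z.1) else
  if `|z.2.1| <= 2 * (z.1 - 1) then w else if z.2.1 < 0 then F (- 4) else F 4)); last first.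
  by apply/funext => z; rewrite /selfsim /tau; case: ifPn.
apply: measurable_fun_ifT.
- by apply: measurable_fun_ltr => //; exact: measurable_cst.
- apply: (measurableT_comp (continuous_measurable_fun cF)).
  by apply: measurable_funM => //; exact: (measurableT_comp mtau).
- apply: measurable_fun_ifT.
  + apply: measurable_fun_ler; first exact: measurableT_comp.
    by apply: measurable_funM => //; apply: measurable_funB.
  + exact: measurable_cst.
  + apply: measurable_fun_ifT => //.
    by apply: measurable_fun_ltr => //; exact: measurable_cst.
Qed.

Lemma selfsim_weak_law C psi : (forall x, `|A x| <= C) -> (forall x, `|B x| <= C) ->
  test_function psi ->
  \int[leb3 R]_(z in halfspace R) (q0 z.1 z.2.1 * Dt psi z + q1 z.1 z.2.1 * D1 psi z) +
  \int[leb2 R]_x (A x.1 * psi (0, x)) = 0.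
Proof.
move=> AC BC tpsi.
have l0 := @lbm_selfsim A wA C cA AC; have l1 := @lbm_selfsim B wB C cB BC.
have lt : lbm (fun z : T => z.1) by apply: continuous_lbm => z; exact: cvg_fst.
have lx : lbm (fun z : T => z.2.1).
  apply: continuous_lbm => z; apply: (@continuous_comp _ _ _ snd fst);
    [exact: cvg_snd|exact: cvg_fst].
have lH : lbm (fun z : T => H z.1 z.2.1).
  by apply: lbmB; [exact: lbmM|apply: lbmM => //; apply: lbmB => //; exact: lbm_cst].
rewrite -[RHS](@potential_weak_law R _ _ H psi l0 l1 lH) //.
- congr (_ + _); apply: eq_Rintegral => x _.
  by rewrite selfsim_lt1 ?ltr01// subr0 divr1.
- by move=> t _; split; [exact: selfsim_Hx|exact: selfsim_dHx].
- by move=> x; split; [move=> t _; exact: selfsim_Ht|exact: selfsim_dHt].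
Qed.

End SelfSimilarLaw.

(** * Localized plane waves *)

Section Bumps.
Context (R : realType).
Implicit Types (f g : R -> R) (x : R).

Fixpoint Cn n f : Prop :=
  if n is m.+1 then (forall x, derivable f x 1) /\ Cn m (derive1 f) else continuous f.

Lemma derivable_continuous f : (forall x, derivable f x 1) -> continuous f.
Proof. by move=> df x; apply: differentiable_continuous; exact/derivable1_diffP. Qed.

Lemma Cn_continuous n f : Cn n f -> continuous f.
Proof. by case: n => // n [df _]; exact: derivable_continuous. Qed.

Lemma CnS n f g : (forall x, is_derive x 1 f (g x)) -> Cn n g -> Cn n.+1 f.
Proof.
move=> df cg; split; first by move=> x; exact: ex_derive.
rewrite (_ : derive1 f = g)//; apply/funext => x; rewrite derive1E.
exact: derive_val.
Qed.

Lemma Cn_is_derive n f : Cn n.+1 f -> forall x, is_derive x 1 f (derive1 f x).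
Proof. by move=> [df _] x; rewrite derive1E; exact/derivableP. Qed.

Lemma Cn_pred n f : Cn n.+1 f -> Cn n f.
Proof.
elim: n f => [|n ih] f; first by move=> [df _]; exact: derivable_continuous.
by move=> [df cf]; split => //; exact: ih.
Qed.

Lemma Cn_cst n (c : R) : Cn n (fun=> c).
Proof.
elim: n c => [|n ih] c; first by move=> x; exact: cvg_cst.
by apply: (@CnS _ _ (fun=> 0)) => // x; exact: dC.
Qed.

Lemma CnD n f g : Cn n f -> Cn n g -> Cn n (fun x => f x + g x).
Proof.
elim: n f g => [|n ih] f g cf cg; first by move=> x; apply: cvgD; [exact: cf|exact: cg].
apply: (@CnS _ _ (fun x => derive1 f x + derive1 g x)).
  by move=> x; apply: dD; [exact: (Cn_is_derive cf)|exact: (Cn_is_derive cg)].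
by apply: ih; [exact: cf.2|exact: cg.2].
Qed.

Lemma CnM n f g : Cn n f -> Cn n g -> Cn n (fun x => f x * g x).
Proof.
elim: n f g => [|n ih] f g cf cg; first by move=> x; apply: cvgM; [exact: cf|exact: cg].
apply: (@CnS _ _ (fun x => derive1 f x * g x + f x * derive1 g x)).
  by move=> x; apply: dM; [exact: (Cn_is_derive cf)|exact: (Cn_is_derive cg)].
apply: CnD; apply: ih; [exact: cf.2|exact: Cn_pred|exact: Cn_pred|exact: cg.2].
Qed.

Lemma CnX n m f : Cn n f -> Cn n (fun x => f x ^+ m).
Proof.
move=> cf; elim: m => [|m ih]; first by under eq_fun do rewrite expr0; exact: Cn_cst.
by under eq_fun do rewrite exprS; exact: CnM.
Qed.

Definition pos_part (x : R) := Num.max 0 x.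

Lemma continuous_pos_part : continuous pos_part.
Proof. by move=> x; apply: cvg_max; [exact: cvg_cst|exact: cvg_id]. Qed.

Lemma pos_part0 x : x <= 0 -> pos_part x = 0. Proof. exact: max_l. Qed.

Lemma pos_part_id x : 0 <= x -> pos_part x = x. Proof. exact: max_r. Qed.

Lemma derive_pos_part k x :
  is_derive x 1 (fun y => pos_part y ^+ k.+2) (k.+2%:R * pos_part x ^+ k.+1).
Proof.
have [x0|x0|->] := ltgtP x 0.
- apply: (@near_eq_is_derive _ _ _ (fun=> 0)).
    apply: filterS (lt_nbhsl x0) => y y0.
    by rewrite pos_part0 ?expr0n// ltW.
  by rewrite pos_part0 ?ltW// expr0n/= mulr0; exact: dC.
- apply: (@near_eq_is_derive _ _ _ (fun y : R => y ^+ k.+2)).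
    by apply: filterS (lt_nbhsr x0) => y y0; rewrite pos_part_id// ltW.
  rewrite pos_part_id ?ltW//; apply: DeriveDef; first exact: exprn_derivable.
  by rewrite exp_derive /GRing.scale/= mulr1.
- apply/is_derive1_caratheodory; exists (fun y => pos_part y ^+ k.+1); split.
  + move=> y; rewrite (pos_part0 (lexx 0)) expr0n subr0 subr0.
    have [y0|y0] := leP y 0; first by rewrite pos_part0// !expr0n mul0r.
    by rewrite pos_part_id ?ltW// exprSr.
  + by apply: (@continuous_comp _ _ _ pos_part (fun y => y ^+ k.+1));
      [exact: continuous_pos_part|exact: exprn_continuous].
  + by rewrite pos_part0// expr0n/= mulr0.
Qed.

Lemma Cn_pos_part k : Cn k (fun x => pos_part x ^+ k.+1).
Proof.
elim: k => [|k ih]; first by move=> x; rewrite /continuous_at; under eq_fun do rewrite expr1;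
  rewrite expr1; exact: continuous_pos_part.
apply: (@CnS _ _ (fun x => k.+2%:R * pos_part x ^+ k.+1)); first by move=> x;
  exact: derive_pos_part.
by apply: CnM => //; exact: Cn_cst.
Qed.

Lemma Cn_pos_part1 k : Cn k (fun x => pos_part (1 - x) ^+ k.+1).
Proof.
have d1 x : is_derive x 1 (fun y : R => 1 - y) (- 1).
  by apply: dE (dB (dC 1 x _) (is_derive_id x 1)) _; rewrite sub0r.
elim: k => [|k ih].
  move=> x; rewrite /continuous_at; under eq_fun do rewrite expr1.
  rewrite expr1; apply: (@continuous_comp _ _ _ (fun y : R => 1 - y) pos_part).
    by apply: cvgB; [exact: cvg_cst|exact: cvg_id].
  exact: continuous_pos_part.
apply: (@CnS _ _ (fun x => (- k.+2%:R) * pos_part (1 - x) ^+ k.+1)).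
  move=> x; apply: dE (dcomp1 (h :=
    fun y => pos_part y ^+ k.+2) (d1 x) (derive_pos_part k (1 - x))) _.
  by rewrite mulrN1 mulNr.
by apply: CnM => //; exact: Cn_cst.
Qed.

(** Four derivatives, because the fields are third derivatives of a potential and must themselves be
    C^1. *)
Definition bump_family (B : nat -> R -> R) :=
  [/\ forall k, (k <= 4)%N -> continuous (B k),
      forall k (x : R), (k < 4)%N -> is_derive x 1 (B k) (B k.+1 x) &
      forall k x, (k <= 4)%N -> (x <= 0) || (1 <= x) -> B k x = 0].

(** On [0, 1] this is (4 x (1 - x))^5, of maximum 1; the fifth powers make it C^4 across 0 and 1. *)
Definition bump0 (x : R) := 1024%:R * (pos_part x ^+ 5 * pos_part (1 - x) ^+ 5).

Lemma Cn_bump0 : Cn 4 bump0.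
Proof.
apply: CnM; first exact: Cn_cst.
by apply: CnM; [exact: Cn_pos_part|exact: Cn_pos_part1].
Qed.

Lemma bump0_out x : (x <= 0) || (1 <= x) -> bump0 x = 0.
Proof.
rewrite /bump0 => /orP[x0|x1]; first by rewrite pos_part0// expr0n/= mul0r mulr0.
by rewrite (pos_part0 (_ : 1 - x <= 0)) ?subr_le0// expr0n/= !mulr0.
Qed.

Lemma bump0_in x : 0 < x < 1 -> 0 < bump0 x <= 1.
Proof.
move=> /andP[x0 x1]; rewrite /bump0.
rewrite (pos_part_id (ltW x0)) (pos_part_id (_ : 0 <= 1 - x)); last by lra.
have -> : 1024%:R * (x ^+ 5 * (1 - x) ^+ 5) = (4 * (x * (1 - x))) ^+ 5 by ring.
have h : 0 < x * (1 - x) by apply: mulr_gt0 => //; lra.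
have h1 : 4 * (x * (1 - x)) <= 1 by have := sqr_ge0 (2 * x - 1); nra.
by apply/andP; split; [apply: exprn_gt0; lra|apply: exprn_ile1; lra].
Qed.

(** The index k counts derivatives. As l grows, the cutoffs tend to 1 on the open interval, so that
    almost no volume of a cell is lost. *)
Definition bumpn (l k : nat) := derive1n k (fun x : R => 1 - (1 - bump0 x) ^+ l).

Lemma Cn_derive1n k n f : Cn (k + n) f -> Cn n (derive1n k f).
Proof.
by elim: k f => [|k ih] f; rewrite ?derive1n0// addSn derive1Sn => -[_]; exact: ih.
Qed.

Lemma bump_bumpn l : bump_family (bumpn l).
Proof.
have c4 : Cn 4 (fun x : R => 1 - (1 - bump0 x) ^+ l).
  rewrite (_ : (fun _ => _) = (fun x => 1 + (- 1) * (1 + (- 1) * bump0 x) ^+ l)).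
    apply: CnD; first exact: Cn_cst.
    apply: CnM; first exact: Cn_cst.
    apply: CnX; apply: CnD; first exact: Cn_cst.
    by apply: CnM; [exact: Cn_cst|exact: Cn_bump0].
  by apply/funext => x; rewrite !mulN1r.
have ck k : (k <= 4)%N -> Cn (4 - k) (bumpn l k).
  by move=> k4; apply: Cn_derive1n; rewrite subnKC.
have cc k : (k <= 4)%N -> continuous (bumpn l k) by move=> /ck /Cn_continuous.
split=> //.
- move=> k x k4; have := ck k (ltnW k4).
  rewrite (_ : (4 - k)%N = (3 - k).+1); last by rewrite -subSn.
  move=> /Cn_is_derive/(_ x).
  by rewrite /bumpn derive1nS.
- have oo k : (k <= 4)%N -> forall x, (x < 0) || (1 < x) -> bumpn l k x = 0.
    elim: k => [|k ih] k4 x x01.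
      rewrite /bumpn derive1n0 bump0_out ?subr0 ?expr1n ?subrr//.
      by case/orP: x01 => /ltW ->; rewrite ?orbT.
    have E : \near x, bumpn l k x = 0.
      case/orP: x01 => h.
        by apply: filterS (lt_nbhsl h) => y y0; rewrite ih ?y0// ltnW.
      by apply: filterS (lt_nbhsr h) => y y0; rewrite ih ?y0 ?orbT// ltnW.
    rewrite /bumpn derive1nS derive1E (near_eq_derive _ E) ?oner_eq0//.
    by rewrite derive_cst.
  (* At the endpoints 0 and 1 the value is the limit from outside, where the function vanishes
     identically. *)
  move=> k x k4; rewrite !le_eqVlt => /orP[/orP[/eqP ->|h]|/orP[/eqP <-|h]]; try (by apply: oo;
    rewrite ?h ?orbT).
  + have h : bumpn l k y @[y --> 0^'-] --> bumpn l k 0 by apply: cvg_at_left_filter; exact: cc.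
    have e0 : bumpn l k x @[x --> 0^'-] --> (0 : R).
      by apply: cvg_near_cst; near=> y; rewrite oo//; apply/orP; left; near: y; exact: nbhs_left_lt.
    exact: (cvg_unique (@Rhausdorff R) h e0).
  + have h : bumpn l k y @[y --> 1^'+] --> bumpn l k 1 by apply: cvg_at_right_filter; exact: cc.
    have e0 : bumpn l k x @[x --> 1^'+] --> (0 : R).
      by apply: cvg_near_cst; near=> y; rewrite oo//; apply/orP; right; near: y;
        exact: nbhs_right_gt.
    exact: (cvg_unique (@Rhausdorff R) h e0).
Unshelve. all: by end_near. Qed.

Lemma bumpn_01 l x : 0 <= bumpn l 0 x <= 1.
Proof.
have [h|] := boolP ((x <= 0) || (1 <= x)).
  by have [_ _ ->] := bump_bumpn l; rewrite ?lexx ?ler01.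
rewrite negb_or -!ltNge => /bump0_in/andP[h0 h1].
rewrite /bumpn derive1n0 subr_ge0 lerBlDr lerDl exprn_ge0 ?subr_ge0// andbT.
by rewrite exprn_ile1 ?subr_ge0// lerBlDr lerDl ltW.
Qed.

Lemma bumpn_cvg x : 0 < x < 1 -> (fun l => bumpn l 0 x) @ \oo --> (1 : R).
Proof.
move=> /bump0_in/andP[h0 h1].
rewrite /bumpn; under eq_fun do rewrite derive1n0.
have h : `|1 - bump0 x| < 1 by rewrite ger0_norm; lra.
by have := cvgB (cvg_cst (1 : R)) (cvg_expr h); rewrite subr0; apply.
Qed.

Lemma bump_bounded B k : bump_family B -> (k <= 4)%N -> exists C, forall x, `|B k x| <= C.
Proof.
move=> [cB _ B0] k4.
have : compact (B k @` `[0, 1]).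
  apply: continuous_compact; last exact: segment_compact.
  by apply: continuous_subspaceT; exact: cB.
move=> /compact_bounded[M [_ bM]]; exists (Num.max 0 (M + 1)) => x.
have [h|] := boolP ((x <= 0) || (1 <= x)); first by rewrite B0// normr0 le_max lexx.
rewrite negb_or -!ltNge => /andP[x0 x1]; rewrite le_max; apply/orP; right.
apply: (bM (M + 1)); rewrite ?ltrDl//; exists x => //=.
by rewrite in_itv/= !ltW.
Qed.

End Bumps.

Section DirectionalTools.
Context (R : realType) (V : normedModType R).
Implicit Types (f l : V -> R) (z v : V).

Lemma is_derive_line f z v d :
  is_derive z v f d <-> is_derive (0 : R) 1 (fun s => f (s *: v + z)) d.
Proof.
have E : (fun h : R => h^-1 *: ((f \o shift z) (h *: v) - f z)) =
    (fun h : R => h^-1 *: (((fun s => f (s *: v + z)) \o shift 0) (h *: 1) - f (0 *: v + z))).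
  by apply/funext => h /=; rewrite scale0r add0r addr0 [h%:A]mulr1.
by split => -[dv de]; split; move: dv de; rewrite /derivable /derive E.
Qed.

Lemma dcompV (h : R -> R) l z v a b : is_derive z v l b ->
  is_derive (l z) 1 h a -> is_derive z v (fun y => h (l y)) (a * b).
Proof.
move=> /is_derive_line dl dh; apply/is_derive_line.
by apply: (dcomp1 dl); rewrite scale0r add0r.
Qed.

Lemma is_derive_affine f z v c : (forall h : R, f (h *: v + z) = h * c + f z) ->
  is_derive z v f c.
Proof.
move=> fE; apply/is_derive_line; under eq_fun do rewrite fE.
by apply: dE (dD (dM (is_derive_id (0 : R) 1) (dC c _ _)) (dC _ _ _)) _; rewrite /=; ring.
Qed.

End DirectionalTools.

Section Waves.
Context (R : realType).
Local Notation T := (R * (R * R))%type.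
Implicit Types (z : T) (i j : nat).

(* The wedge is {lf 0 >= 0, lf 1 >= 0}; lfd j i is the derivative of lf i along ax j. *)
Definition lf i z : R :=
  match i with
  | 0 => 2 * (z.1 - 1) - z.2.1
  | 1 => 2 * (z.1 - 1) + z.2.1
  | _ => z.2.2
  end.

Definition lfd j i : R :=
  match j, i with
  | 0, 0 | 0, 1 => 2
  | 1, 0 => - 1
  | 1, 1 => 1
  | 0, _ | 1, _ | _, 0 | _, 1 => 0
  | _, _ => 1
  end.

Lemma is_derive_lf i j z : is_derive z (ax R j) (lf i) (lfd j i).
Proof.
apply: is_derive_affine => h; case: z => t [x y].
by case: j => [|[|j]]; case: i => [|[|i]]; rewrite /lf /lfd /ax /axis_t /axis_1 /axis_2 /=
  /GRing.scale /=; ring.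
Qed.

Lemma continuous_fst3 : continuous (fun z : T => z.1).
Proof. by move=> z; exact: cvg_fst. Qed.

Lemma continuous_snd1 : continuous (fun z : T => z.2.1).
Proof.
by move=> z; apply: (@continuous_comp _ _ _ snd fst); [exact: cvg_snd|exact: cvg_fst].
Qed.

Lemma continuous_snd2 : continuous (fun z : T => z.2.2).
Proof.
by move=> z; apply: (@continuous_comp _ _ _ snd snd); [exact: cvg_snd|exact: cvg_snd].
Qed.

Lemma continuous_lf i : continuous (lf i).
Proof.
have c0 : continuous (fun z : T => 2 * (z.1 - 1)).
  move=> z; apply: cvgM; first exact: cvg_cst.
  by apply: cvgB; [exact: continuous_fst3|exact: cvg_cst].
case: i => [|[|i]] z.
- by apply: cvgB; [exact: c0|exact: continuous_snd1].
- by apply: cvgD; [exact: c0|exact: continuous_snd1].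
- exact: continuous_snd2.
Qed.

Section Cell.
Variables (n : R) (o : nat -> R) (B : nat -> R -> R).
Hypothesis bB : bump_family B.

Definition cellf i z := n * lf i z - o i.

Lemma is_derive_cellf i j z : is_derive z (ax R j) (cellf i) (n * lfd j i).
Proof.
by apply: dE (dB (dZ n (is_derive_lf i j z)) (dC _ _ _)) _; rewrite subr0.
Qed.

Lemma continuous_cellf i : continuous (cellf i).
Proof.
move=> z; apply: cvgB; last exact: cvg_cst.
by apply: cvgM; [exact: cvg_cst|exact: continuous_lf].
Qed.

(** A partial derivative of the cutoff of the cell, of orders p, q, s in the coordinates [lf 0],
    [lf 1], [lf 2]; the power of n comes from the side 1 / n of the cell. *)
Definition chi (p q s : nat) z := n ^+ (p + q + s) *
  (B p (cellf 0 z) * B q (cellf 1 z) * B s (cellf 2 z)).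

Lemma continuous_chi p q s : (p + q + s <= 4)%N -> continuous (chi p q s).
Proof.
move=> pqs z; have [cB _ _] := bB.
have c k i : (k <= 4)%N -> {for z, continuous (fun z => B k (cellf i z))}.
  move=> k4; apply: (@continuous_comp _ _ _ (cellf i) (B k)); first exact: continuous_cellf.
  exact: cB.
apply: cvgM; first exact: cvg_cst.
by apply: cvgM; [apply: cvgM|]; apply: c; lia.
Qed.

Lemma is_derive_chi p q s j z : (p + q + s < 4)%N ->
  is_derive z (ax R j) (chi p q s) (lfd j 0 * chi p.+1 q s z +
    lfd j 1 * chi p q.+1 s z + lfd j 2 * chi p q s.+1 z).
Proof.
move=> pqs; have [_ dB' _] := bB.
have d k i : (k < 4)%N -> is_derive z (ax R j) (fun z => B k (cellf i z))
    (B k.+1 (cellf i z) * (n * lfd j i)).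
  by move=> k4; apply: dcompV (is_derive_cellf i j z) _; exact: dB'.
have [p4 q4 s4] : [/\ (p < 4)%N, (q < 4)%N & (s < 4)%N] by split; lia.
have := dM (dM (d p 0%N p4) (d q 1%N q4)) (d s 2%N s4).
move=> /(dZ (n ^+ (p + q + s))) /dE; apply.
rewrite /chi !addSn !addnS addSn !exprS; ring.
Qed.

Lemma chi_out p q s z : (p + q + s <= 4)%N ->
  (exists2 i, (i < 3)%N & (cellf i z <= 0) || (1 <= cellf i z)) -> chi p q s z = 0.
Proof.
move=> pqs [i i3 zi]; have [_ _ B0] := bB; rewrite /chi.
by case: i i3 zi => [|[|[|]]]// _ zi; rewrite (B0 _ _ _ zi) ?(mul0r, mulr0)//; lia.
Qed.

Lemma chi_bounded p q s : (p + q + s <= 4)%N -> exists C, forall z, `|chi p q s z| <= C.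
Proof.
move=> pqs.
have [C0 H0] : exists C, forall x, `|B p x| <= C by apply: bump_bounded => //; lia.
have [C1 H1] : exists C, forall x, `|B q x| <= C by apply: bump_bounded => //; lia.
have [C2 H2] : exists C, forall x, `|B s x| <= C by apply: bump_bounded => //; lia.
exists (`|n| ^+ (p + q + s) * (C0 * C1 * C2)) => z.
by rewrite /chi !normrM normrX ler_wpM2l ?exprn_ge0// ler_pM ?mulr_ge0// ler_pM.
Qed.

Variables (k : nat -> R) (c0 s0 : R).

(* The eps-rescaled derivative along the directions in l of
   chi * (c0 cos(kz / eps) + s0 sin(kz / eps)) is
   (wave l).1 * cos(kz / eps) + (wave l).2 * sin(kz / eps). *)
Fixpoint wave (eps : R) (l : seq nat) (p q s : nat) z : R * R :=
  match l with
  | [::] => (c0 * chi p q s z, s0 * chi p q s z)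
  | j :: l' =>
    let w0 := wave eps l' p.+1 q s z in let w1 := wave eps l' p q.+1 s z in
    let w2 := wave eps l' p q s.+1 z in let w := wave eps l' p q s z in
    (eps * (lfd j 0 * w0.1 + lfd j 1 * w1.1 + lfd j 2 * w2.1) + k j * w.2,
     eps * (lfd j 0 * w0.2 + lfd j 1 * w1.2 + lfd j 2 * w2.2) - k j * w.1)
  end.

(** Derivatives commute by algebra on the recursion, without Schwarz's theorem; the linear equations
    for the fields reduce to such swaps. *)
Lemma wave_swap eps i j l p q s z :
  wave eps (i :: j :: l) p q s z = wave eps (j :: i :: l) p q s z.
Proof. by rewrite /=; congr (_, _); ring. Qed.

Lemma wave_congr eps i l l' : (forall p q s z, wave eps l p q s z = wave eps l' p q s z) ->
  forall p q s z, wave eps (i :: l) p q s z = wave eps (i :: l') p q s z.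
Proof. by move=> E p q s z; rewrite /= !E. Qed.

Lemma wave_out eps l p q s z : (size l + (p + q + s) <= 4)%N ->
  (exists2 i, (i < 3)%N & (cellf i z <= 0) || (1 <= cellf i z)) ->
  wave eps l p q s z = (0, 0).
Proof.
elim: l p q s => [|j l ih] p q s pqs zo; first by rewrite /= chi_out ?mulr0.
rewrite /= !ih//=; first by rewrite !mulr0 !addr0 mulr0 subr0.
all: by move: pqs => /=; lia.
Qed.

Lemma is_derive_wave eps l p q s j z : (size l + (p + q + s) < 4)%N ->
  is_derive z (ax R j) (fun z => (wave eps l p q s z).1)
    (lfd j 0 * (wave eps l p.+1 q s z).1 + lfd j 1 * (wave eps l p q.+1 s z).1 +
     lfd j 2 * (wave eps l p q s.+1 z).1) /\
  is_derive z (ax R j) (fun z => (wave eps l p q s z).2)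
    (lfd j 0 * (wave eps l p.+1 q s z).2 + lfd j 1 * (wave eps l p q.+1 s z).2 +
     lfd j 2 * (wave eps l p q s.+1 z).2).
Proof.
elim: l p q s => [|i l ih] p q s pqs.
  by split; apply: dE (dZ _ (is_derive_chi j z _)) _; rewrite //=; ring.
have pqs' : (size l + (p + q + s) < 4)%N by move: pqs => /=; lia.
have [a1 a2] := ih p q s pqs'.
have [|b1 b2] := ih p.+1 q s; first by move: pqs => /=; lia.
have [|d1 d2] := ih p q.+1 s; first by move: pqs => /=; lia.
have [|e1 e2] := ih p q s.+1; first by move: pqs => /=; lia.
split.
  apply: dE (dD (dZ eps (dD (dD (dZ _ b1) (dZ _ d1)) (dZ _ e1))) (dZ (k i) a2)) _.
  by rewrite /=; ring.
apply: dE (dB (dZ eps (dD (dD (dZ _ b2) (dZ _ d2)) (dZ _ e2))) (dZ (k i) a1)) _.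
by rewrite /=; ring.
Qed.

Lemma continuous_wave eps l p q s : (size l + (p + q + s) <= 4)%N ->
  continuous (fun z => (wave eps l p q s z).1) /\
  continuous (fun z => (wave eps l p q s z).2).
Proof.
elim: l p q s => [|i l ih] p q s pqs.
  by split => z; apply: cvgM; try exact: cvg_cst; exact: continuous_chi.
have pqs' : (size l + (p + q + s) <= 4)%N by move: pqs => /=; lia.
have [a1 a2] := ih p q s pqs'.
have [|b1 b2] := ih p.+1 q s; first by move: pqs => /=; lia.
have [|d1 d2] := ih p q.+1 s; first by move: pqs => /=; lia.
have [|e1 e2] := ih p q s.+1; first by move: pqs => /=; lia.
have cZ (c : R) (f : T -> R) : continuous f -> continuous (fun z => c * f z).
  by move=> cf z; apply: cvgM; [exact: cvg_cst|exact: cf].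
have cD (f g : T -> R) : continuous f -> continuous g -> continuous (fun z => f z + g z).
  by move=> cf cg z; apply: cvgD; [exact: cf|exact: cg].
have cB' (f g : T -> R) : continuous f -> continuous g -> continuous (fun z => f z - g z).
  by move=> cf cg z; apply: cvgB; [exact: cf|exact: cg].
split.
  apply: (cD (fun z => _) (fun z => _)); last exact: cZ.
  apply: (cZ _ (fun z => _)).
  by apply: (cD (fun z => _) (fun z => _)); [apply: (cD (fun z => _) (fun z => _))|]; exact: cZ.
apply: (cB' (fun z => _) (fun z => _)); last exact: cZ.
apply: (cZ _ (fun z => _)).
by apply: (cD (fun z => _) (fun z => _)); [apply: (cD (fun z => _) (fun z => _))|]; exact: cZ.
Qed.

Lemma wave_bounded l p q s : (size l + (p + q + s) <= 4)%N ->
  exists2 C, 0 <= C & forall eps z, 0 <= eps <= 1 ->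
    `|(wave eps l p q s z).1| <= C /\ `|(wave eps l p q s z).2| <= C.
Proof.
elim: l p q s => [|i l ih] p q s pqs.
  have [C HC] := chi_bounded pqs; exists (Num.max (`|c0| * C) (`|s0| * C)).
    by rewrite le_max mulr_ge0// (le_trans _ (HC point)).
  by move=> eps z _; split; rewrite /= normrM le_max ler_wpM2l ?orbT//.
have [|a a0 Ha] := ih p q s; first by move: pqs => /=; lia.
have [|b b0 Hb] := ih p.+1 q s; first by move: pqs => /=; lia.
have [|d d0 Hd] := ih p q.+1 s; first by move: pqs => /=; lia.
have [|e e0 He] := ih p q s.+1; first by move: pqs => /=; lia.
exists (`|lfd i 0| * b + `|lfd i 1| * d + `|lfd i 2| * e + `|k i| * a).
  by rewrite !addr_ge0// mulr_ge0.
move=> eps z eps01; have /andP[eps0 eps1] := eps01.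
have [a1 a2] := Ha eps z eps01; have [b1 b2] := Hb eps z eps01.
have [d1 d2] := Hd eps z eps01; have [e1 e2] := He eps z eps01.
have H (x y u v : R) : `|x| <= b -> `|y| <= d -> `|u| <= e -> `|v| <= a ->
    `|eps * (lfd i 0 * x + lfd i 1 * y + lfd i 2 * u)| + `|k i * v| <=
     `|lfd i 0| * b + `|lfd i 1| * d + `|lfd i 2| * e + `|k i| * a.
  move=> xb yd ue va; apply: lerD; last by rewrite normrM ler_wpM2l.
  rewrite normrM ger0_norm// -[leRHS]mul1r ler_pM//.
  rewrite (le_trans (ler_normD _ _))// lerD//; last by rewrite normrM ler_wpM2l.
  by rewrite (le_trans (ler_normD _ _))// lerD// normrM ler_wpM2l.
split; rewrite /=; first by rewrite (le_trans (ler_normD _ _))// H.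
by rewrite (le_trans (ler_normB _ _))// H.
Qed.

(** A derivative that falls on the cutoff carries a factor eps, so the value at eps = 0 keeps only
    the derivatives that fall on the phase. *)
Lemma wave_leading l p q s : (size l + (p + q + s) <= 4)%N ->
  exists2 C, 0 <= C & forall eps z, 0 <= eps <= 1 ->
    `|(wave eps l p q s z).1 - (wave 0 l p q s z).1| <= C * eps /\
    `|(wave eps l p q s z).2 - (wave 0 l p q s z).2| <= C * eps.
Proof.
elim: l p q s => [|i l ih] p q s pqs.
  by exists 0 => // eps z _; rewrite /= !subrr normr0 mul0r.
have [|a a0 Ha] := ih p q s; first by move: pqs => /=; lia.
have [|b b0 Hb] := @wave_bounded l p.+1 q s; first by move: pqs => /=; lia.
have [|d d0 Hd] := @wave_bounded l p q.+1 s; first by move: pqs => /=; lia.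
have [|e e0 He] := @wave_bounded l p q s.+1; first by move: pqs => /=; lia.
exists (`|lfd i 0| * b + `|lfd i 1| * d + `|lfd i 2| * e + `|k i| * a).
  by rewrite !addr_ge0// mulr_ge0.
move=> eps z eps01; have /andP[eps0 eps1] := eps01.
have [a1 a2] := Ha eps z eps01; have [b1 b2] := Hb eps z eps01.
have [d1 d2] := Hd eps z eps01; have [e1 e2] := He eps z eps01.
have H (x y u v : R) : `|x| <= b -> `|y| <= d -> `|u| <= e -> `|v| <= a * eps ->
    `|eps * (lfd i 0 * x + lfd i 1 * y + lfd i 2 * u)| + `|k i * v| <=
     (`|lfd i 0| * b + `|lfd i 1| * d + `|lfd i 2| * e + `|k i| * a) * eps.
  move=> xb yd ue va; rewrite [leRHS]mulrDl; apply: lerD; last first.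
    by rewrite normrM -mulrA ler_wpM2l.
  rewrite normrM ger0_norm// mulrC ler_wpM2r//.
  rewrite (le_trans (ler_normD _ _))// lerD//; last by rewrite normrM ler_wpM2l.
  by rewrite (le_trans (ler_normD _ _))// lerD// normrM ler_wpM2l.
split; rewrite /= !mul0r !add0r.
  by rewrite -addrA -mulrBr (le_trans (ler_normD _ _))// H.
rewrite opprK -addrA [- _ + _]addrC -mulrBr -opprB mulrN.
by rewrite (le_trans (ler_normB _ _))// H.
Qed.

Definition phase z := k 0 * z.1 + k 1 * z.2.1 + k 2 * z.2.2.

Lemma is_derive_phase j z : (j < 3)%N -> is_derive z (ax R j) phase (k j).
Proof.
move=> j3; apply: is_derive_affine => h; case: z => t [x y].
by case: j j3 => [|[|[|]]]// _; rewrite /phase /ax /axis_t /axis_1 /axis_2 /=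
  /GRing.scale /=; ring.
Qed.

Lemma continuous_phase : continuous phase.
Proof.
move=> z; apply: cvgD; [apply: cvgD|]; (apply: cvgM; first exact: cvg_cst).
- exact: continuous_fst3.
- exact: continuous_snd1.
- exact: continuous_snd2.
Qed.

Definition wavef eps l z : R := (wave eps l 0 0 0 z).1 * cos (phase z / eps) +
  (wave eps l 0 0 0 z).2 * sin (phase z / eps).

Lemma is_derive_wavef eps l j z : 0 < eps -> (j < 3)%N -> (size l < 4)%N ->
  is_derive z (ax R j) (wavef eps l) (eps^-1 * wavef eps (j :: l) z).
Proof.
move=> eps0 j3 l4; have [|d1 d2] := @is_derive_wave eps l 0 0 0 j z; first by lia.
have dp : is_derive z (ax R j) (fun z => phase z / eps) (k j / eps).
  by apply: dE (dM (is_derive_phase z j3) (dC _ _ _)) _; rewrite mulr0 addr0.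
apply: dE (dD (dM d1 (dcompV dp (is_derive_cos _))) (dM d2 (dcompV dp (is_derive_sin _)))) _.
by rewrite /wavef /=; field; rewrite gt_eqF.
Qed.

Lemma continuous_wavef eps l : (size l <= 4)%N -> continuous (wavef eps l).
Proof.
move=> l4 z; have [|c1 c2] := @continuous_wave eps l 0 0 0; first by lia.
have cp : {for z, continuous (fun z => phase z / eps)}.
  by apply: cvgM; [exact: continuous_phase|exact: cvg_cst].
apply: cvgD; apply: cvgM; [exact: c1| |exact: c2|].
  by apply: (@continuous_comp _ _ _ (fun z => phase z / eps) cos) => //; exact: continuous_cos.
by apply: (@continuous_comp _ _ _ (fun z => phase z / eps) sin) => //; exact: continuous_sin.
Qed.

Lemma wavef_out eps l z : (size l <= 4)%N ->
  (exists2 i, (i < 3)%N & (cellf i z <= 0) || (1 <= cellf i z)) -> wavef eps l z = 0.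
Proof. by move=> l4 zo; rewrite /wavef wave_out ?addn0// !mul0r addr0. Qed.

Lemma wavef_leading i j l : exists2 C, 0 <= C & forall eps z, 0 < eps <= 1 ->
  `|wavef eps [:: i; j; l] z - k i * k j * k l * chi 0 0 0 z *
     (c0 * sin (phase z / eps) - s0 * cos (phase z / eps))| <= C * eps.
Proof.
have [//|C C0 HC] := @wave_leading [:: i; j; l] 0 0 0.
exists (C + C); first exact: addr_ge0.
move=> eps z /andP[eps0 eps1]; have [|h1 h2] := HC eps z; first by rewrite ltW.
have -> : k i * k j * k l * chi 0 0 0 z *
     (c0 * sin (phase z / eps) - s0 * cos (phase z / eps)) =
  (wave 0 [:: i; j; l] 0 0 0 z).1 * cos (phase z / eps) +
  (wave 0 [:: i; j; l] 0 0 0 z).2 * sin (phase z / eps) by rewrite /=; ring.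
rewrite /wavef opprD addrACA -!mulrBl [leRHS]mulrDl.
rewrite (le_trans (ler_normD _ _))// lerD// normrM -[leRHS]mulr1 ler_pM//.
  by rewrite ler_norml cos_geN1 cos_le1.
by rewrite ler_norml sin_geN1 sin_le1.
Qed.

End Cell.
End Waves.

(** * States and admissible segments *)

Section StateAlgebra.
Context (R : realType).
Implicit Types (x e : nat -> R) (d : R).

(* A state x = (v1, v2, f, g) stands for the velocity v and the traceless stress
   u = [[f, g], [g, -f]]; quad x is the quadratic form of I + u - v (x) v. *)
Definition quad x (a b : R) := (1 + x 2 - x 0 ^+ 2) * a ^+ 2 +
  2 * (x 3 - x 0 * x 1) * (a * b) + (1 - x 2 - x 1 ^+ 2) * b ^+ 2.

Definition posdef d x := forall a b, d * (a ^+ 2 + b ^+ 2) <= quad x a b.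

(** The trace of I + u - v (x) v, since u is traceless. *)
Definition deficit x := 2 - x 0 ^+ 2 - x 1 ^+ 2.

Lemma posdef_le d d' x : d' <= d -> posdef d x -> posdef d' x.
Proof.
move=> dd px a b; apply: le_trans (px a b); apply: ler_wpM2r => //.
by rewrite addr_ge0// sqr_ge0.
Qed.

Lemma posdef_deficit d x : posdef d x -> 2 * d <= deficit x.
Proof.
move=> px; have := px 1 0; have := px 0 1; rewrite /quad /deficit; nra.
Qed.

Lemma posdef_bound x : posdef 0 x ->
  [/\ `|x 0| <= 2, `|x 1| <= 2 & 0 <= deficit x <= 2].
Proof.
move=> px; have := posdef_deficit px; rewrite mulr0 /deficit => h.
have h0 := sqr_ge0 (x 0); have h1 := sqr_ge0 (x 1).
by split; [rewrite ler_norml; apply/andP; split; nra|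
  rewrite ler_norml; apply/andP; split; nra|apply/andP; split; lra].
Qed.

(** The entries of a positive semidefinite matrix are bounded by its trace. A vanishing deficit
    therefore forces u = v (x) v - I, which recovers the nonlinear equation in the limit. *)
Lemma posdef_stress x : posdef 0 x ->
  `|1 + x 2 - x 0 ^+ 2| <= deficit x /\ `|x 3 - x 0 * x 1| <= deficit x.
Proof.
move=> px; have h10 := px 1 0; have h01 := px 0 1; have h11 := px 1 1; have h1N := px 1 (-1).
move: h10 h01 h11 h1N; rewrite /quad /deficit => h10 h01 h11 h1N.
by split; rewrite ler_norml; apply/andP; split; lra.
Qed.

Lemma posdef_perturb d h x e : 0 <= h <= 1 -> `|x 0| <= 4 -> `|x 1| <= 4 ->
  (forall i, (i < 4)%N -> `|e i| <= h) -> posdef d x ->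
  posdef (d - 36 * h) (fun i => x i + e i).
Proof.
move=> /andP[h0 h1] x0 x1 he px a b.
have -> : quad (fun i => x i + e i) a b = quad x a b + (e 2 * (a ^+ 2 - b ^+ 2) +
    2 * e 3 * (a * b) - (2 * (x 0 * a + x 1 * b) + (e 0 * a + e 1 * b)) * (e 0 * a + e 1 * b)).
  by rewrite /quad; ring.
rewrite mulrBl lerD//.
have ab0 : 0 <= `|a| + `|b| by rewrite addr_ge0.
pose n2 := a ^+ 2 + b ^+ 2.
have ab2 : (`|a| + `|b|) ^+ 2 <= 2 * n2.
  have := sqr_ge0 (`|a| - `|b|);
    rewrite /n2 -[a ^+ 2](real_normK (num_real a)) -[b ^+ 2](real_normK (num_real b)); nra.
have n20 : 0 <= n2 by rewrite addr_ge0// sqr_ge0.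
have e01 : `|e 0 * a + e 1 * b| <= h * (`|a| + `|b|).
  rewrite (le_trans (ler_normD _ _))// mulrDr !normrM lerD// ler_wpM2r//; exact: he.
have xab : `|x 0 * a + x 1 * b| <= 4 * (`|a| + `|b|).
  by rewrite (le_trans (ler_normD _ _))// mulrDr !normrM lerD// ler_wpM2r.
have B1 : `|(2 * (x 0 * a + x 1 * b) + (e 0 * a + e 1 * b)) * (e 0 * a + e 1 * b)| <=
    18 * h * n2.
  rewrite normrM; apply: (@le_trans _ _ ((9 * (`|a| + `|b|)) * (h * (`|a| + `|b|)))).
    apply: ler_pM => //; rewrite (le_trans (ler_normD _ _))// normrM ger0_norm//.
    nra.
  nra.
have B2 : `|e 2 * (a ^+ 2 - b ^+ 2)| <= h * n2.
  rewrite normrM ler_pM ?he// ler_norml /n2; have := sqr_ge0 a; have := sqr_ge0 b.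
  by move=> ? ?; apply/andP; split; lra.
have B3 : `|2 * e 3 * (a * b)| <= 2 * h * n2.
  rewrite normrM ler_pM//; first by rewrite normrM ger0_norm// ler_pM2l// he.
  rewrite ler_norml /n2; have := sqr_ge0 (a - b); have := sqr_ge0 (a + b).
  by move=> ? ?; apply/andP; split; nra.
(* The three errors add up to 21 h (a^2 + b^2), within the allowance of 36 h. *)
move: B1 B2 B3; rewrite !ler_norml => /andP[_ ?] /andP[? _] /andP[? _].
rewrite -/n2; nra.
Qed.

(** The pair (c, s) is a unit eigenvector of the traceless matrix [[X, Y], [Y, - X]] for the
    eigenvalue r >= 0; in polar form, (X, Y) has twice the angle of (c, s). *)
Lemma half_angle (X Y : R) : exists r c s : R,
  [/\ 0 <= r, c ^+ 2 + s ^+ 2 = 1, X = r * (c ^+ 2 - s ^+ 2) & Y = r * (2 * c * s)].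
Proof.
have [/eqP|XY] := eqVneq (X ^+ 2 + Y ^+ 2) 0.
  rewrite paddr_eq0 ?sqr_ge0// !sqrf_eq0 => /andP[/eqP -> /eqP ->].
  by exists 0, 1, 0; split; rewrite ?mul0r// expr1n expr0n addr0.
pose r := Num.sqrt (X ^+ 2 + Y ^+ 2).
have XY0 : 0 < X ^+ 2 + Y ^+ 2 by rewrite lt0r XY addr_ge0// sqr_ge0.
have r0 : 0 < r by rewrite sqrtr_gt0.
have r2 : r ^+ 2 = X ^+ 2 + Y ^+ 2 by rewrite sqr_sqrtr// ltW.
have Xr : - r <= X <= r by apply/andP; split; nra.
have {Xr} [X1 X2] : X <= r /\ - r <= X by case/andP: Xr.
pose c := Num.sqrt ((r + X) / (2 * r)).
pose s0 := Num.sqrt ((r - X) / (2 * r)).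
have c2 : c ^+ 2 = (r + X) / (2 * r).
  by rewrite sqr_sqrtr// divr_ge0//; lra.
have s2 : s0 ^+ 2 = (r - X) / (2 * r).
  by rewrite sqr_sqrtr// divr_ge0//; lra.
have cs : (r * (2 * c * s0)) ^+ 2 = Y ^+ 2.
  rewrite !exprMn c2 s2; have -> : Y ^+ 2 = r ^+ 2 - X ^+ 2 by rewrite r2; ring.
  by field; rewrite gt_eqF.
have [YE|YE] : r * (2 * c * s0) = Y \/ r * (2 * c * s0) = - Y.
- by move/eqP: cs; rewrite eqf_sqr => /orP[] /eqP ->; [left|right].
- exists r, c, s0; split; rewrite ?ltW ?c2 ?s2//; by field; rewrite gt_eqF.
- exists r, c, (- s0); split; rewrite ?ltW ?sqrrN ?c2 ?s2//; try (by field; rewrite gt_eqF).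
  by rewrite -[LHS]opprK -YE; ring.
Qed.

(* The segment direction is (m, v.n (m (x) n + n (x) m)) with n orthogonal to m, along which
   I + u - v (x) v changes only by a multiple of m (x) m; taking m to be the eigenvector
   of the largest eigenvalue leaves room of order the deficit. *)
Lemma wave_segment d x : 0 <= d -> posdef d x -> exists n1 n2 : R,
  n1 ^+ 2 + n2 ^+ 2 = 1 /\ forall t, `|t| <= deficit x / 8 ->
  let q := t * (x 0 * n1 + x 1 * n2) in
  posdef (d / 6) (fun i => x i + match i with
    | 0 => - t * n2 | 1 => t * n1 | 2 => - q * (2 * n1 * n2) | _ => - q * (n2 ^+ 2 - n1 ^+ 2) end).
Proof.
move=> d0 px; have dd := posdef_deficit px.
have [x0b x1b Db] := posdef_bound (posdef_le d0 px).
(* Subtracting half the deficit makes I + u - v (x) v traceless, so m is its eigenvector for the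
   largest eigenvalue D / 2 + r. *)
have [r [m1 [m2 [r0 m12 Xm Ym]]]] := half_angle
  ((1 + x 2 - x 0 ^+ 2) - deficit x / 2) (x 3 - x 0 * x 1).
exists m2, (- m1); split; first by rewrite sqrrN addrC.
move=> t tL q a b; set D := deficit x in Xm dd Db tL.
have qE : quad x a b = (D / 2 - r) * (a ^+ 2 + b ^+ 2) + 2 * r * (m1 * a + m2 * b) ^+ 2.
  have E1 : 1 + x 2 - x 0 ^+ 2 = D / 2 + r * (m1 ^+ 2 - m2 ^+ 2) by rewrite -Xm; ring.
  have E2 : 1 - x 2 - x 1 ^+ 2 = D / 2 - r * (m1 ^+ 2 - m2 ^+ 2).
    by rewrite -Xm /D /deficit; field.
  have -> : (D / 2 - r) * (a ^+ 2 + b ^+ 2) =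
      D / 2 * (a ^+ 2 + b ^+ 2) - r * (m1 ^+ 2 + m2 ^+ 2) * (a ^+ 2 + b ^+ 2).
    by rewrite m12; ring.
  by rewrite /quad E1 E2 Ym; ring.
have dr : d <= D / 2 - r.
  have := px (- m2) m1; rewrite /quad.
  have E1 : 1 + x 2 - x 0 ^+ 2 = D / 2 + r * (m1 ^+ 2 - m2 ^+ 2) by rewrite -Xm; ring.
  have E2 : 1 - x 2 - x 1 ^+ 2 = D / 2 - r * (m1 ^+ 2 - m2 ^+ 2).
    by rewrite -Xm /D /deficit; field.
  rewrite E1 E2 Ym sqrrN [m2 ^+ 2 + _]addrC m12 mulr1 => /le_trans; apply.
  rewrite le_eqVlt; apply/orP; left; apply/eqP.
  have -> : D / 2 - r = D / 2 * (m1 ^+ 2 + m2 ^+ 2) - r * (m1 ^+ 2 + m2 ^+ 2) ^+ 2.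
    by rewrite m12; ring.
  by ring.
pose vm := x 0 * m1 + x 1 * m2.
have -> : quad (fun i => x i + match i with
    | 0 => - t * - m1 | 1 => t * m2 | 2 => - q * (2 * m2 * - m1)
    | _ => - q * ((- m1) ^+ 2 - m2 ^+ 2) end) a b =
  quad x a b - (2 * t * vm + t ^+ 2) * (m1 * a + m2 * b) ^+ 2.
  transitivity (quad x a b - (2 * t * vm + t ^+ 2) * (m1 * a + m2 * b) ^+ 2 -
      2 * t * (m1 * a + m2 * b) * (x 0 * a + x 1 * b) * (1 - (m1 ^+ 2 + m2 ^+ 2))).
    by rewrite /quad /q /vm /=; ring.
  by rewrite m12; ring.
rewrite qE.
set N := a ^+ 2 + b ^+ 2; set y := m1 * a + m2 * b.
have N0 : 0 <= N by rewrite addr_ge0// sqr_ge0.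
have yN : y ^+ 2 <= N.
  have -> : N = y ^+ 2 + (m2 * a - m1 * b) ^+ 2.
    by rewrite /N -[LHS]mulr1 -m12 /y; ring.
  by rewrite lerDl sqr_ge0.
have y0 : 0 <= y ^+ 2 by exact: sqr_ge0.
have vmb : vm ^+ 2 <= 2.
  have : vm ^+ 2 + (x 0 * m2 - x 1 * m1) ^+ 2 = x 0 ^+ 2 + x 1 ^+ 2.
    by rewrite -[RHS]mulr1 -m12 /vm; ring.
  have := sqr_ge0 (x 0 * m2 - x 1 * m1); move: Db; rewrite /D /deficit => /andP[] ? ? ? ?; lra.
have [D0 D2] := andP Db.
have vmb' : `|vm| <= 3 / 2 by rewrite ler_norml; apply/andP; split; nra.
have tv : t * vm <= D / 8 * (3 / 2).
  by rewrite (le_trans (ler_norm _))// normrM ler_pM.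
have tt : t ^+ 2 <= D / 8 * (1 / 4).
  rewrite -(real_normK (num_real t)) expr2 ler_pM//; first by rewrite (le_trans tL)//; lra.
(* The eigenvalue D / 2 - r >= d is unchanged. The other one, D / 2 + r, loses at most 3 D / 8 + D /
   32, so that at least 3 D / 32 >= 3 d / 16 >= d / 6 remains. This is the origin of the length
   deficit / 8 and of the factor 1 / 6. *)
have [h|h] := leP (2 * t * vm + t ^+ 2) (2 * r); nra.
Qed.

End StateAlgebra.

(** * Perturbation of a constant state in a cell *)

Section Fields.
Context (R : realType).
Local Notation T := (R * (R * R))%type.
Implicit Types (F G : T -> R) (w V : nat -> T -> R) (z : T).

Definition C1f F := continuous F /\ forall j, (j < 3)%N ->
  (forall z, is_derive z (ax R j) F (Dax j F z)) /\ continuous (Dax j F).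

Lemma Dax_val F j z d : is_derive z (ax R j) F d -> Dax j F z = d.
Proof. by case: j => [|[|j]] dF; exact: (@derive_val _ _ _ _ _ _ _ dF). Qed.

Lemma C1f_intro F (F' : nat -> T -> R) : continuous F ->
  (forall j z, (j < 3)%N -> is_derive z (ax R j) F (F' j z)) ->
  (forall j, (j < 3)%N -> continuous (F' j)) ->
  C1f F /\ forall j, (j < 3)%N -> Dax j F = F' j.
Proof.
move=> cF dF cF'.
have E j : (j < 3)%N -> Dax j F = F' j.
  by move=> j3; apply/funext => z; apply: Dax_val; exact: dF.
split => //; split => // j j3; rewrite E//; split; last exact: cF'.
by move=> z; exact: dF.
Qed.

Lemma C1fD F G : C1f F -> C1f G -> C1f (fun z => F z + G z) /\
  forall j, (j < 3)%N -> Dax j (fun z => F z + G z) = fun z => Dax j F z + Dax j G z.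
Proof.
move=> [cF dF] [cG dG]; apply: (@C1f_intro _ (fun j z => Dax j F z + Dax j G z)).
- by move=> z; apply: cvgD; [exact: cF|exact: cG].
- by move=> j z j3; apply: dD; [exact: (dF j j3).1|exact: (dG j j3).1].
- by move=> j j3 z; apply: cvgD; [exact: (dF j j3).2|exact: (dG j j3).2].
Qed.

(* For w = (v1, v2, f, g): div v = 0 and v_t + div [[f, g], [g, -f]] = 0 *)
Definition linsol w := (forall i, (i < 4)%N -> C1f (w i)) /\ forall z,
  [/\ Dax 1 (w 0) z + Dax 2 (w 1) z = 0,
      Dax 0 (w 0) z + Dax 1 (w 2) z + Dax 2 (w 3) z = 0 &
      Dax 0 (w 1) z + Dax 1 (w 3) z - Dax 2 (w 2) z = 0].

Lemma add3ACA (a a' b b' c c' : R) :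
  a + a' + (b + b') + (c + c') = (a + b + c) + (a' + b' + c').
Proof. by ring. Qed.

Lemma linsolD w V : linsol w -> linsol V -> linsol (fun i z => w i z + V i z).
Proof.
move=> [cw pw] [cV pV]; have D i (i4 : (i < 4)%N) := C1fD (cw i i4) (cV i i4).
split; first by move=> i i4; exact: (D i i4).1.
move=> z; have [p1 p2 p3] := pw z; have [q1 q2 q3] := pV z.
have E i j : (i < 4)%N -> (j < 3)%N ->
    Dax j (fun z => w i z + V i z) z = Dax j (w i) z + Dax j (V i) z.
  by move=> i4 j3; rewrite (D i i4).2.
split; rewrite !E//.
- by rewrite addrACA p1 q1 addr0.
- by rewrite add3ACA p2 q2 addr0.
- by rewrite opprD add3ACA p3 q3 addr0.
Qed.

Lemma C1f_cst0 : C1f (fun=> 0) /\ forall j, (j < 3)%N -> Dax j (fun _ : T => 0 : R) = fun=> 0.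
Proof.
apply: (@C1f_intro _ (fun=> fun=> 0)).
- by move=> z; exact: cvg_cst.
- by move=> j ? z; exact: cvg_cst.
Qed.

Lemma linsol0 : linsol (fun _ _ => 0).
Proof.
have [c E] := C1f_cst0; split => // z.
by split; rewrite !E// ?addr0 ?subr0.
Qed.

Lemma cbm_le f g : cbm f -> cbm g -> (forall z : T, f z <= g z) ->
  \int[leb3 R]_z f z <= \int[leb3 R]_z g z.
Proof. by move=> cf cg fg; apply: le_Rintegral => //; exact: integrable3. Qed.

Section Cell.
Variables (n : R) (o : nat -> R).
Hypothesis n0 : 0 < n.

Definition cell_out z := exists2 i, (i < 3)%N & (cellf n o i z <= 0) || (1 <= cellf n o i z).

Lemma cell_in z : ~ cell_out z -> forall i, (i < 3)%N -> 0 < cellf n o i z < 1.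
Proof.
move=> zo i i3; rewrite !ltNge -negb_or; apply/negP => h; apply: zo.
by exists i.
Qed.

Definition cell_radius := 1 + 3 * ((1 + `|o 0| + `|o 1| + `|o 2|) / n).

Lemma cell_radius_closed z : (forall i, (i < 3)%N -> 0 <= cellf n o i z <= 1) ->
  `|z| <= cell_radius.
Proof.
move=> zin.
have h0 := zin 0%N isT; have h1 := zin 1%N isT; have h2 := zin 2%N isT.
rewrite /cell_radius; set q := _ / n.
have lq i : (i < 3)%N -> `|lf i z| <= q.
  move=> i3; rewrite /q ler_pdivlMr// mulrC -{1}(gtr0_norm n0) -normrM.
  have -> : n * lf i z = cellf n o i z + o i by rewrite /cellf subrK.
  rewrite (le_trans (ler_normD _ _))// -!addrA; apply: lerD.
    by have /andP[a b] := zin i i3; rewrite ger0_norm.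
  have a0 := normr_ge0 (o 0); have a1 := normr_ge0 (o 1); have a2 := normr_ge0 (o 2).
  by case: i i3 => [|[|[|]]]// _; lra.
have := lq 0%N isT; have := lq 1%N isT; have := lq 2%N isT.
rewrite /lf !ler_norml => /andP[? ?] /andP[? ?] /andP[? ?].
by rewrite norm3E !ge_max !ler_norml; apply/and3P; split; apply/andP; split; lra.
Qed.

Lemma cell_radiusP z : cell_radius < `|z| -> cell_out z.
Proof.
move=> zr; apply: contrapT => /cell_in zin; move: zr; apply/negP; rewrite -leNgt.
by apply: cell_radius_closed => i /zin/andP[/ltW -> /ltW ->].
Qed.

Variable (B : nat -> R -> R).
Hypothesis bB : bump_family B.

(** Up to the factor a eps^3, third derivatives of one potential phi: v = (- d2 Lap phi, d1 Lap
    phi), f = 2 dt d1 d2 phi, g = dt (d2^2 - d1^2) phi, with Lap = d1^2 + d2^2. Any phi solves the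
    linear equations in this way, so the potential may be cut off to the cell. The flag b selects
    its cosine or its sine. *)
Definition wave_field (k : nat -> R) (b : bool) (a eps : R) i z : R :=
  let W l := wavef n o B k b%:R (~~ b)%:R eps l z in
  match i with
  | 0 => - a * (W [:: 2; 1; 1]%N + W [:: 2; 2; 2]%N)
  | 1 => a * (W [:: 1; 1; 1]%N + W [:: 1; 2; 2]%N)
  | 2 => 2 * a * W [:: 0; 1; 2]%N
  | _ => a * (W [:: 0; 2; 2]%N - W [:: 0; 1; 1]%N)
  end.

Variables (k : nat -> R) (b : bool) (a : R).
Local Notation W eps l := (wavef n o B k b%:R (~~ b)%:R eps l).
Local Notation V := (wave_field k b a).

Lemma wavef_swap eps i j l z : W eps (i :: j :: l) z = W eps (j :: i :: l) z.
Proof. by rewrite /wavef wave_swap. Qed.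

Lemma wavef_congr eps i l l' z : (forall p q s z, wave n o B k b%:R (~~ b)%:R eps l p q s z =
    wave n o B k b%:R (~~ b)%:R eps l' p q s z) ->
  W eps (i :: l) z = W eps (i :: l') z.
Proof. by move=> E; rewrite /wavef (wave_congr i E). Qed.

Lemma wave_field_out eps i z : cell_out z -> V eps i z = 0.
Proof.
move=> zo; rewrite /wave_field.
by case: i => [|[|[|i]]]; rewrite !wavef_out// ?addr0 ?subr0 mulr0.
Qed.

Lemma linsol_wave_field eps : 0 < eps -> linsol (V eps).
Proof.
move=> eps0.
have dW l j z : (j < 3)%N -> size l = 3%N ->
    is_derive z (ax R j) (W eps l) (eps^-1 * W eps (j :: l) z).
  by move=> j3 l3; apply: is_derive_wavef => //; rewrite l3.
have cW l : (size l <= 4)%N -> continuous (W eps l) by exact: continuous_wavef.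
have C2 (c d : R) l l' : size l = 3%N -> size l' = 3%N ->
    C1f (fun z => c * W eps l z + d * W eps l' z) /\
    forall j, (j < 3)%N -> Dax j (fun z => c * W eps l z + d * W eps l' z) =
      fun z => eps^-1 * (c * W eps (j :: l) z + d * W eps (j :: l') z).
  move=> l3 l3'; apply: C1f_intro.
  - by move=> z; apply: cvgD; (apply: cvgM; first exact: cvg_cst); apply: cW; rewrite ?l3 ?l3'.
  - move=> j z j3; apply: dE (dD (dZ c (dW l j z j3 l3)) (dZ d (dW l' j z j3 l3'))) _.
    by ring.
  - move=> j j3 z; apply: cvgM; first exact: cvg_cst.
    by apply: cvgD; (apply: cvgM; first exact: cvg_cst); apply: cW; rewrite /= ?l3 ?l3'.
have V0 : V eps 0 = fun z => (- a) * W eps [:: 2; 1; 1]%N z + (- a) * W eps [:: 2; 2; 2]%N z.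
  by apply/funext => z; rewrite /wave_field mulrDr.
have V1 : V eps 1 = fun z => a * W eps [:: 1; 1; 1]%N z + a * W eps [:: 1; 2; 2]%N z.
  by apply/funext => z; rewrite /wave_field mulrDr.
have V2 : V eps 2 = fun z => 2 * a * W eps [:: 0; 1; 2]%N z + 0 * W eps [:: 0; 1; 2]%N z.
  by apply/funext => z; rewrite /wave_field mul0r addr0.
have V3 : V eps 3 = fun z => a * W eps [:: 0; 2; 2]%N z + (- a) * W eps [:: 0; 1; 1]%N z.
  by apply/funext => z; rewrite /wave_field mulrBr mulNr.
have P0 := (C2 (- a) (- a) [:: 2; 1; 1]%N [:: 2; 2; 2]%N erefl erefl).
have P1 := (C2 a a [:: 1; 1; 1]%N [:: 1; 2; 2]%N erefl erefl).
have P2 := (C2 (2 * a) 0 [:: 0; 1; 2]%N [:: 0; 1; 2]%N erefl erefl).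
have P3 := (C2 a (- a) [:: 0; 2; 2]%N [:: 0; 1; 1]%N erefl erefl).
split.
  move=> [|[|[|[|//]]]] _.
  - by rewrite V0; exact: P0.1.
  - by rewrite V1; exact: P1.1.
  - by rewrite V2; exact: P2.1.
  - by rewrite V3; exact: P3.1.
have [E0 E1] := (P0.2, P1.2); have [E2 E3] := (P2.2, P3.2).
move=> z; rewrite V0 V1 V2 V3 !E0// !E1// !E2// !E3//.
have s0211 : W eps [:: 1; 0; 1; 2]%N z = W eps [:: 0; 2; 1; 1]%N z.
  rewrite wavef_swap; apply: wavef_congr => p q s z'.
  transitivity (wave n o B k b%:R (~~ b)%:R eps [:: 1; 2; 1]%N p q s z'); last exact: wave_swap.
  by apply: wave_congr => *; exact: wave_swap.
have s0122 : W eps [:: 2; 0; 1; 2]%N z = W eps [:: 0; 1; 2; 2]%N z.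
  by rewrite wavef_swap; apply: wavef_congr => p q s z'; exact: wave_swap.
split.
- rewrite (wavef_swap _ 2 1 [:: 1; 1]%N) (wavef_swap _ 2 1 [:: 2; 2]%N); ring.
- rewrite s0211 (wavef_swap _ 2 0 [:: 2; 2]%N) (wavef_swap _ 2 0 [:: 1; 1]%N); ring.
- rewrite s0122 (wavef_swap _ 1 0 [:: 2; 2]%N) (wavef_swap _ 1 0 [:: 1; 1]%N); ring.
Qed.

Lemma cbm_wavef eps l : (size l <= 4)%N -> cbm (W eps l).
Proof.
move=> l4; apply: (@lbm_cbm _ _ cell_radius).
  by apply: continuous_lbm; exact: continuous_wavef.
by move=> z /cell_radiusP zo; exact: wavef_out.
Qed.

Lemma cbm_wave_field eps i : cbm (V eps i).
Proof.
have cl c : lbm (fun _ : T => c : R) by exact: lbm_cst.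
have c3 l : size l = 3%N -> cbm (W eps l) by move=> l3; apply: cbm_wavef; rewrite l3.
case: i => [|[|[|i]]]; rewrite /wave_field.
- by apply: (cbmMl (cl _)); apply: cbmD; exact: c3.
- by apply: (cbmMl (cl _)); apply: cbmD; exact: c3.
- by apply: (cbmMl (cl _)); exact: c3.
- by apply: (cbmMl (cl _)); apply: cbmB; exact: c3.
Qed.

Lemma Rint_wavef eps j l : 0 < eps -> (j < 3)%N -> size l = 2%N ->
  \int[leb3 R]_z W eps (j :: l) z = 0.
Proof.
move=> eps0 j3 l2.
have := @Rint3_derive R j (W eps l) (fun z => eps^-1 * W eps (j :: l) z).
rewrite RintZ3//; last by apply: cbm_wavef; rewrite /= l2.
move=> H; have /eqP : eps^-1 * \int[leb3 R]_z W eps (j :: l) z = 0.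
  apply: H.
  - by apply: continuous_wavef => //; rewrite l2.
  - move=> z; apply: cvgM; first exact: cvg_cst.
    by apply: continuous_wavef => //; rewrite /= l2.
  - by apply: cbm_wavef; rewrite l2.
  - by apply: cbmMl; [exact: lbm_cst|apply: cbm_wavef; rewrite /= l2].
  - by move=> z; apply: is_derive_wavef => //; rewrite l2.
by rewrite mulf_eq0 invr_eq0 gt_eqF//= => /eqP.
Qed.

(** The zero mean makes the increment nearly orthogonal to every field that is almost constant on
    the cell. *)
Lemma Rint_wave_field eps i : 0 < eps -> (i < 2)%N -> \int[leb3 R]_z V eps i z = 0.
Proof.
move=> eps0; case: i => [|[|]]// _; rewrite RintZ3//.
- by rewrite RintD3// ?Rint_wavef// ?addr0 ?mulr0//; exact: cbm_wavef.
- by apply: cbmD; exact: cbm_wavef.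
- by rewrite RintD3// ?Rint_wavef// ?addr0 ?mulr0//; exact: cbm_wavef.
- by apply: cbmD; exact: cbm_wavef.
Qed.

(* The value of the wave to leading order in eps, in units of k *)
Definition carrier eps z := a * chi n o B 0 0 0 z *
  (b%:R * sin (phase k z / eps) - (~~ b)%:R * cos (phase k z / eps)).

Lemma wave_field_leading : exists2 C, 0 <= C & forall eps z i, 0 < eps <= 1 ->
  `|V eps i z - carrier eps z * match i with
     | 0 => - k 2 * (k 1 ^+ 2 + k 2 ^+ 2) | 1 => k 1 * (k 1 ^+ 2 + k 2 ^+ 2)
     | 2 => 2 * k 0 * k 1 * k 2 | _ => k 0 * (k 2 ^+ 2 - k 1 ^+ 2) end| <= C * eps.
Proof.
have H i j l := @wavef_leading R n o B bB k b%:R (~~ b)%:R i j l.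
have [C1 c1 h1] := H 2 1 1; have [C2 c2 h2] := H 2 2 2.
have [C3 c3 h3] := H 1 1 1; have [C4 c4 h4] := H 1 2 2.
have [C5 c5 h5] := H 0 1 2; have [C6 c6 h6] := H 0 2 2; have [C7 c7 h7] := H 0 1 1.
have a0 := normr_ge0 a.
exists (2 * `|a| * (C1 + C2 + C3 + C4 + C5 + C6 + C7)).
  by rewrite mulr_ge0 ?mulr_ge0// !addr_ge0.
move=> eps z i eps01; have /andP[e0 e1] := eps01.
have {}h1 := h1 eps z eps01; have {}h2 := h2 eps z eps01; have {}h3 := h3 eps z eps01.
have {}h4 := h4 eps z eps01; have {}h5 := h5 eps z eps01; have {}h6 := h6 eps z eps01.
have {}h7 := h7 eps z eps01.
have comb (c x y X Y p q : R) : `|c| <= 2 * `|a| -> `|x - X| <= p * eps -> `|y - Y| <= q * eps ->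
    0 <= p -> 0 <= q -> p + q <= C1 + C2 + C3 + C4 + C5 + C6 + C7 ->
    `|c * ((x - X) + (y - Y))| <= 2 * `|a| * (C1 + C2 + C3 + C4 + C5 + C6 + C7) * eps.
  move=> ca xX yY p0 q0 pq; rewrite normrM -mulrA ler_pM//.
  rewrite (le_trans (ler_normD _ _))//.
  by apply: (@le_trans _ _ ((p + q) * eps)); [rewrite mulrDl lerD|rewrite ler_wpM2r// ltW].
have a2 : `|a| <= 2 * `|a| by lra.
have Na2 : `|- a| <= 2 * `|a| by rewrite normrN.
case: i => [|[|[|i]]]; rewrite /wave_field /carrier.
- apply: le_trans (comb (- a) _ _ _ _ _ _ Na2 h1 h2 _ _ _); rewrite //; try lra.
  by rewrite le_eqVlt; apply/orP; left; apply/eqP; congr `|_|; ring.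
- apply: le_trans (comb a _ _ _ _ _ _ a2 h3 h4 _ _ _); rewrite //; try lra.
  by rewrite le_eqVlt; apply/orP; left; apply/eqP; congr `|_|; ring.
- have h0 : `|(0 : R) - 0| <= 0 * eps by rewrite subrr normr0 mul0r.
  apply: le_trans (comb (2 * a) _ _ _ _ _ _ _ h5 h0 _ _ _); rewrite //; try lra.
    by rewrite le_eqVlt; apply/orP; left; apply/eqP; congr `|_|; ring.
  by rewrite normrM ger0_norm.
- have {}h7 : `|- W eps [:: 0; 1; 1]%N z - - (k 0 * k 1 * k 1 * chi n o B 0 0 0 z *
     (b%:R * sin (phase k z / eps) - (~~ b)%:R * cos (phase k z / eps)))| <= C7 * eps.
    by rewrite opprK addrC distrC.
  apply: le_trans (comb a _ _ _ _ _ _ a2 h6 h7 _ _ _); rewrite //; try lra.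
  by rewrite le_eqVlt; apply/orP; left; apply/eqP; congr `|_|; ring.
Qed.

End Cell.
End Fields.

Section CellPerturbation.
Context (R : realType).
Local Notation T := (R * (R * R))%type.
Implicit Types (z : T) (x : nat -> R).

Lemma posdef_eq d x y : (forall i, (i < 4)%N -> x i = y i) -> posdef d x -> posdef d y.
Proof. by move=> xy px a b; have := px a b; rewrite /quad !xy. Qed.

Definition ball_ind (r : R) z : R := (`|z| <= r)%R%:R.

Lemma cbm_ball_ind r : cbm (ball_ind r).
Proof.
split; last first.
  exists 1, r => z; rewrite /ball_ind; split.
    by case: (`|z| <= r); rewrite ?normr1 ?normr0 ?ler01.
  by rewrite ltNge => /negbTE ->.
have mn : measurable_fun setT (fun z : measurableTypeR R * (measurableTypeR R * measurableTypeR R) =>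
    `|(z : T)|).
  apply: (continuous_measurable3 (f := fun z : T => `|z|)) => z.
  exact: norm_continuous.
apply: (measurableT_comp (f := fun b : bool => b%:R : R)) => //.
by apply: measurable_fun_ler => //; exact: measurable_cst.
Qed.

Lemma ball_ind_ge0 r z : 0 <= ball_ind r z. Proof. exact: ler0n. Qed.

Variables (n : R) (o : nat -> R).
Hypothesis n0 : 0 < n.
Variable (B : nat -> R -> R).
Hypotheses (bB : bump_family B) (B01 : forall y, 0 <= B 0 y <= 1).

Local Notation X := (chi n o B 0 0 0).

Lemma chi01 z : 0 <= X z <= 1.
Proof.
rewrite /chi expr0 mul1r.
have /andP[a0 a1] := B01 (cellf n o 0 z); have /andP[b0 b1] := B01 (cellf n o 1 z).
have /andP[c0 c1] := B01 (cellf n o 2 z).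
by rewrite !mulr_ge0//= mulr_ile1 ?mulr_ge0// mulr_ile1.
Qed.

Lemma cbm_chi : cbm X.
Proof.
apply: (@lbm_cbm _ _ (cell_radius n o)); first by apply: continuous_lbm; exact: continuous_chi.
by move=> z /(cell_radiusP n0) zo; exact: chi_out.
Qed.

Lemma cbm_carrier k b a eps : cbm (carrier n o B k b a eps).
Proof.
apply: cbmMr; first by apply: cbmMl; [exact: lbm_cst|exact: cbm_chi].
have cp : continuous (fun z => phase k z / eps).
  by move=> z; apply: cvgM; [exact: continuous_phase|exact: cvg_cst].
apply: lbmB; (apply: lbmM; first exact: lbm_cst); apply: continuous_lbm => z.
  by apply: (@continuous_comp _ _ _ (fun z => phase k z / eps) sin);
    [exact: cp|exact: continuous_sin].
by apply: (@continuous_comp _ _ _ (fun z => phase k z / eps) cos);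
  [exact: cp|exact: continuous_cos].
Qed.

Lemma carrier_le k b a eps z : 0 <= a -> `|carrier n o B k b a eps z| <= a.
Proof.
move=> a0; rewrite /carrier -[leRHS]mulr1 normrM; apply: ler_pM => //.
  rewrite -[leRHS]mulr1 normrM (ger0_norm a0) ler_wpM2l//.
  by have /andP[x0 x1] := chi01 z; rewrite ger0_norm.
case: b; rewrite /= ?mul1r ?mul0r ?subr0 ?sub0r ?normrN ler_norml.
  by rewrite sin_geN1 sin_le1.
by rewrite cos_geN1 cos_le1.
Qed.

Lemma carrier_out k b a eps z : cell_out n o z -> carrier n o B k b a eps z = 0.
Proof. by move=> zo; rewrite /carrier chi_out// mulr0 mul0r. Qed.

(* deficit x ^+ 2 / 128 is half of the squared amplitude (deficit x / 8) ^+ 2: one of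
   the cosine and the sine wave has at least the average energy. *)
Lemma cell_perturbation x d eta : 0 < d -> posdef d x -> 0 < eta ->
  exists V : nat -> T -> R,
    [/\ linsol V, forall i, cbm (V i), forall i z, cell_out n o z -> V i z = 0,
        forall i, (i < 2)%N -> \int[leb3 R]_z V i z = 0 &
        (forall z, posdef (d / 10) (fun i => x i + V i z)) /\
        deficit x ^+ 2 / 128 * (\int[leb3 R]_z X z ^+ 2) - eta <=
          \int[leb3 R]_z (V 0%N z ^+ 2 + V 1%N z ^+ 2)].
Proof.
move=> d0 px eta0.
have [n1 [n2 [n12 seg]]] := wave_segment (ltW d0) px.
have [x0b x1b /andP[D0 D2]] := posdef_bound (posdef_le (ltW d0) px).
(* The time frequency - v . n puts the leading part of the wave on the segment of [wave_segment];
   |n| = 1 removes the factors k1^2 + k2^2. *)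
pose k (j : nat) : R := match j with 0 => - (x 0%N * n1 + x 1%N * n2) | 1 => n1 | _ => n2 end.
pose a := deficit x / 8.
have a0 : 0 <= a by rewrite divr_ge0.
have a1 : a <= 1 / 4 by rewrite /a; lra.
pose V b := wave_field n o B k b a.
have HC b : exists2 C, 0 <= C & forall eps z i, 0 < eps <= 1 ->
  `|V b eps i z - carrier n o B k b a eps z * match i with
     | 0 => - n2 | 1 => n1 | 2 => - (x 0%N * n1 + x 1%N * n2) * (2 * n1 * n2)
     | _ => - (x 0%N * n1 + x 1%N * n2) * (n2 ^+ 2 - n1 ^+ 2) end| <= C * eps.
  have [C C0 hC] := wave_field_leading n o bB k b a; exists C => // eps z i eps01.
  have := hC eps z i eps01; rewrite /k n12 !mulr1.
  case: i => [|[|[|i]]]//; set q := - (x 0%N * n1 + x 1%N * n2).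
  by have -> : 2 * q * n1 * n2 = q * (2 * n1 * n2) by ring.
have [C C0 {}HC] : exists2 C, 0 <= C & forall b eps z i, 0 < eps <= 1 ->
  `|V b eps i z - carrier n o B k b a eps z * match i with
     | 0 => - n2 | 1 => n1 | 2 => - (x 0%N * n1 + x 1%N * n2) * (2 * n1 * n2)
     | _ => - (x 0%N * n1 + x 1%N * n2) * (n2 ^+ 2 - n1 ^+ 2) end| <= C * eps.
  have [C1 C10 h1] := HC true; have [C2 C20 h2] := HC false.
  exists (C1 + C2); first exact: addr_ge0.
  move=> b eps z i eps01; have /andP[e0 _] := eps01.
  case: b; [apply: le_trans (h1 eps z i eps01) _|apply: le_trans (h2 eps z i eps01) _];
    by apply: ler_wpM2r; [exact: ltW|lra].
pose r := cell_radius n o.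
pose m := \int[leb3 R]_z ball_ind r z.
have m0 : 0 <= m by apply: Rintegral_ge0 => z _; exact: ball_ind_ge0.
(* The tolerance for the lower order terms: 36 h <= d / 15 takes the bound d / 6 of the segment to d
   / 10, and h times the measure m of a ball containing the cell is at most eta. *)
pose h := Num.min (d / 540) (Num.min (eta / (m + 1)) 1).
have h0 : 0 < h.
  rewrite !lt_min ltr01 andbT; apply/andP; split; first lra.
  by apply: divr_gt0 => //; lra.
have hd : h <= d / 540 by rewrite ge_min lexx.
have h1 : h <= 1 by rewrite !ge_min lexx !orbT.
have hm : h * m <= eta.
  have : h <= eta / (m + 1) by rewrite !ge_min lexx orbT.
  by rewrite ler_pdivlMr ?ltr_wpDl//; apply: le_trans; rewrite ler_pM2l//; lra.
pose eps := Num.min 1 (h / (C + 1)).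
have eps0 : 0 < eps by rewrite lt_min ltr01/=; apply: divr_gt0 => //; lra.
have eps01 : 0 < eps <= 1 by rewrite eps0 ge_min lexx.
have Ceps : C * eps <= h.
  have : eps <= h / (C + 1) by rewrite ge_min lexx orbT.
  by rewrite ler_pdivlMr ?ltr_wpDl//; apply: le_trans; rewrite mulrC ler_pM2l//; lra.
pose t b := carrier n o B k b a eps.
have tb b z : `|t b z| <= deficit x / 8 by exact: carrier_le.
have pV b z : posdef (d / 10) (fun i => x i + V b eps i z).
  pose q := t b z * (x 0%N * n1 + x 1%N * n2).
  pose L i := x i + match i with | 0 => - t b z * n2 | 1 => t b z * n1
    | 2 => - q * (2 * n1 * n2) | _ => - q * (n2 ^+ 2 - n1 ^+ 2) end.
  have pL : posdef (d / 6) L := seg _ (tb b z).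
  have d6 : 0 <= d / 6 by lra.
  have [L0 L1 _] := posdef_bound (posdef_le d6 pL).
  apply: (@posdef_le _ (d / 6 - 36 * h)); first by lra.
  apply: (@posdef_eq _ (fun i => L i + (x i + V b eps i z - L i))).
    by move=> i _; rewrite addrC subrK.
  apply: posdef_perturb => //.
  - by rewrite ltW.
  - apply: le_trans L0 _; lra.
  - apply: le_trans L1 _; lra.
  - move=> i i4; apply: le_trans Ceps; apply: le_trans (HC b eps z i eps01).
    rewrite le_eqVlt; apply/orP; left; apply/eqP; congr `|_|.
    by rewrite /L /q -/(t b z); case: i i4 => [|[|[|[|]]]]//= _; ring.
have gain b z : t b z ^+ 2 - h * ball_ind r z <= V b eps 0%N z ^+ 2 + V b eps 1%N z ^+ 2.
  have [zr|zr] := leP `|z| r; last first.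
    rewrite /ball_ind (lt_geF zr) mulr0 subr0 /t carrier_out; last exact: cell_radiusP.
    by rewrite expr0n/= addr_ge0// sqr_ge0.
  rewrite /ball_ind zr mulr1.
  have := HC b eps z 0%N eps01; have := HC b eps z 1%N eps01.
  rewrite -/(t b z) => e1 e0; have {}e1 := le_trans e1 Ceps; have {}e0 := le_trans e0 Ceps.
  have tb' : `|t b z| <= 1 / 4 by exact: le_trans (tb b z) a1.
  set v0 := V b eps 0%N z in e0 *; set v1 := V b eps 1%N z in e1 *.
  set s := t b z in e0 e1 tb' *.
  have -> : v0 ^+ 2 + v1 ^+ 2 = s ^+ 2 * (n1 ^+ 2 + n2 ^+ 2) +
    2 * s * (n1 * (v1 - s * n1) - n2 * (v0 - s * - n2)) +
    (v0 - s * - n2) ^+ 2 + (v1 - s * n1) ^+ 2 by ring.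
  rewrite n12 mulr1.
  have n1b : `|n1| <= 1 by rewrite ler_norml; apply/andP; split; nra.
  have n2b : `|n2| <= 1 by rewrite ler_norml; apply/andP; split; nra.
  have : `|2 * s * (n1 * (v1 - s * n1) - n2 * (v0 - s * - n2))| <= h.
    rewrite normrM; have -> : h = (2 * (1 / 4)) * (1 * h + 1 * h) by field.
    apply: ler_pM => //; first by rewrite normrM ger0_norm// ler_pM2l.
    by rewrite (le_trans (ler_normB _ _))// lerD// normrM ler_pM.
  rewrite ler_norml => /andP[+ _].
  have := sqr_ge0 (v0 - s * - n2); have := sqr_ge0 (v1 - s * n1); lra.
have ct b : cbm (t b) by exact: cbm_carrier.
have ct2 b : cbm (fun z => t b z ^+ 2) by under eq_fun do rewrite expr2; apply: cbmMr;
  [exact: ct|exact: cbm_lbm].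
have cV b i : cbm (V b eps i) by exact: cbm_wave_field.
have cV2 b : cbm (fun z => V b eps 0%N z ^+ 2 + V b eps 1%N z ^+ 2).
  by apply: cbmD; under eq_fun do rewrite expr2; apply: cbmMr;
    [exact: cV|exact: cbm_lbm|exact: cV|exact: cbm_lbm].
have Ig b : \int[leb3 R]_z t b z ^+ 2 - eta <=
    \int[leb3 R]_z (V b eps 0%N z ^+ 2 + V b eps 1%N z ^+ 2).
  have ch : cbm (fun z => h * ball_ind r z) by apply: cbmMl; [exact: lbm_cst|exact: cbm_ball_ind].
  have := cbm_le (cbmB (ct2 b) ch) (cV2 b) (gain b).
  apply: le_trans; rewrite RintB3// RintZ3//; last exact: cbm_ball_ind.
  by rewrite lerB.
have Isum : \int[leb3 R]_z t true z ^+ 2 + \int[leb3 R]_z t false z ^+ 2 =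
    a ^+ 2 * \int[leb3 R]_z X z ^+ 2.
  have cX2 : cbm (fun z => X z ^+ 2).
    by under eq_fun do rewrite expr2; apply: cbmMr; [exact: cbm_chi|exact: cbm_lbm cbm_chi].
  rewrite -RintD3// -RintZ3//; apply: eq_Rintegral => z _.
  rewrite /t /carrier /= mul1r !mul0r subr0 sub0r mul1r mulrN sqrrN !exprMn -mulrDr.
  by rewrite [sin _ ^+ 2 + _]addrC cos2Dsin2 mulr1.
have [b hb] : exists b, a ^+ 2 / 2 * \int[leb3 R]_z X z ^+ 2 <= \int[leb3 R]_z t b z ^+ 2.
  have [h2|h2] := leP (a ^+ 2 / 2 * \int[leb3 R]_z X z ^+ 2) (\int[leb3 R]_z t true z ^+ 2).
    by exists true.
  by exists false; move: Isum h2; lra.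
exists (V b eps); split => //.
- exact: linsol_wave_field.
- by move=> i z zo; exact: wave_field_out.
- by move=> i i2; exact: Rint_wave_field.
- split; first exact: pV.
  apply: le_trans (Ig b); rewrite lerD2r; apply: le_trans hb.
  by rewrite le_eqVlt; apply/orP; left; apply/eqP; rewrite /a; field.
Qed.

End CellPerturbation.

(** * Perturbation of a subsolution on a grid *)

Section DominatedConvergence.
Context (R : realType).
Local Notation T := (R * (R * R))%type.
Local Notation T1 := (measurableTypeR R).
Local Notation T3 := (T1 * (T1 * T1))%type.

Lemma ae3S (P Q : T -> Prop) : (forall z, P z -> Q z) ->
  {ae leb3 R, forall z, P z} -> {ae leb3 R, forall z, Q z}.
Proof.
move=> PQ [N [mN N0 PN]]; exists N; split => // z nQ; apply: PN => Pz; exact/nQ/PQ.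
Qed.

Lemma Rint3_dominated (f_ : nat -> T -> R) (f : T -> R) C r :
  (forall k, measurable_fun setT (f_ k : T3 -> R)) -> measurable_fun setT (f : T3 -> R) ->
  (forall k z, `|f_ k z| <= C) -> (forall k z, r < `|z| -> f_ k z = 0) ->
  {ae leb3 R, forall z, (fun k => f_ k z) @ \oo --> f z} ->
  (fun k => \int[leb3 R]_z f_ k z) @ \oo --> \int[leb3 R]_z f z.
Proof.
move=> mf_ mf fC fr ff.
have cg : cbm (fun z => C * ball_ind r z) by apply: cbmMl; [exact: lbm_cst|exact: cbm_ball_ind].
have C0 : 0 <= C by apply: le_trans (fC 0%N (0 : T)).
have mF k : measurable_fun setT (EFin \o f_ k : T3 -> \bar R) by apply/measurable_EFinP.
have mf' : measurable_fun setT (EFin \o f : T3 -> \bar R) by apply/measurable_EFinP.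
have [||iF _ cF] := dominated_convergence (mu := leb3 R) measurableT mF mf' _ (integrable3 cg) _.
- by apply: ae3S ff => z fz _; apply/cvg_EFin => //; exact: nearW.
- apply: aeW => z k _ /=; rewrite lee_fin /ball_ind.
  by have [_|zr] := leP `|z| r; rewrite ?mulr1// fr// normr0 mulr0.
apply: fine_cvg => /=.
rewrite /Rintegral fineK; last exact: integrable_fin_num.
exact: cF.
Qed.

End DominatedConvergence.

(** * Half-open cells and their exhaustion by cutoffs *)

Section CellIndicator.
Context (R : realType).
Local Notation T := (R * (R * R))%type.
Local Notation T1 := (measurableTypeR R).
Local Notation T3 := (T1 * (T1 * T1))%type.
Implicit Types (z : T).

(** Half-open cells tile exactly, while the cutoffs live on open cells; hence two indicators, which
    differ at one point. *)
Definition unit_ind (y : R) : R := (0 <= y < 1)%R%:R.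
Definition ounit_ind (y : R) : R := (0 < y < 1)%R%:R.

Lemma measurable_unit_ind : measurable_fun setT (unit_ind : T1 -> R).
Proof.
apply: (measurableT_comp (f := fun b : bool => b%:R : R)) => //.
apply: measurable_and; [apply: measurable_fun_ler|apply: measurable_fun_ltr];
  by [exact: measurable_cst|exact: measurable_id].
Qed.

Lemma measurable_ounit_ind : measurable_fun setT (ounit_ind : T1 -> R).
Proof.
apply: (measurableT_comp (f := fun b : bool => b%:R : R)) => //.
apply: measurable_and; apply: measurable_fun_ltr;
  by [exact: measurable_cst|exact: measurable_id].
Qed.

Lemma unit_ind01 y : 0 <= unit_ind y <= 1.
Proof. by rewrite /unit_ind; case: (0 <= y < 1); rewrite lexx ler01. Qed.

Lemma ounit_ind01 y : 0 <= ounit_ind y <= 1.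
Proof. by rewrite /ounit_ind; case: (0 < y < 1); rewrite lexx ler01. Qed.

Lemma unit_ind_ounit y : y != 0 -> unit_ind y = ounit_ind y.
Proof. by move=> y0; rewrite /unit_ind /ounit_ind [0 < y]lt_def y0. Qed.

Lemma unit_ind_out y : (y < 0) || (1 < y) -> unit_ind y = 0.
Proof.
rewrite /unit_ind => /orP[y0|y1]; first by rewrite leNgt y0.
by rewrite (ltNge y) (ltW y1) andbF.
Qed.

Variables (n : R) (o : nat -> R).
Hypothesis n0 : 0 < n.

Definition in_hcell z : bool :=
  [&& 0 <= cellf n o 0 z < 1, 0 <= cellf n o 1 z < 1 & 0 <= cellf n o 2 z < 1].

Definition hcell_ind z : R := (in_hcell z)%:R.

Lemma hcell_indE z : hcell_ind z =
  unit_ind (cellf n o 0 z) * unit_ind (cellf n o 1 z) * unit_ind (cellf n o 2 z).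
Proof. by rewrite /hcell_ind /in_hcell /unit_ind -!natrM !mulnb andbA. Qed.

Lemma measurable_cellf i : measurable_fun setT (cellf n o i : T3 -> R).
Proof. by apply: continuous_measurable3; exact: continuous_cellf. Qed.

Definition prod3 (s0 s1 s2 : R -> R) z :=
  s0 (cellf n o 0 z) * s1 (cellf n o 1 z) * s2 (cellf n o 2 z).

Definition unit_fun (s : R -> R) := measurable_fun setT (s : T1 -> R) /\
  forall y, `|s y| <= 1 /\ ((y < 0) || (1 < y) -> s y = 0).

Lemma cbm_prod3 s0 s1 s2 : unit_fun s0 -> unit_fun s1 -> unit_fun s2 ->
  cbm (prod3 s0 s1 s2).
Proof.
move=> [m0 h0] [m1 h1] [m2 h2].
apply: (@lbm_cbm _ _ (cell_radius n o)); last first.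
  move=> z zr; apply: contraTeq zr => zn0; rewrite -leNgt.
  have [[a b] c] : (s0 (cellf n o 0 z) != 0 /\ s1 (cellf n o 1 z) != 0) /\ s2 (cellf n o 2 z) != 0.
    by move: zn0; rewrite /prod3 !mulf_eq0 !negb_or => /andP[/andP[]].
  have H (s : R -> R) (y : R) : (forall y, `|s y| <= 1 /\ ((y < 0) || (1 < y) -> s y = 0)) ->
    s y != 0 -> 0 <= y <= 1.
    move=> hs; apply: contraNT => h; apply/eqP/(hs y).2.
    by rewrite !ltNge -negb_and.
  apply: cell_radius_closed => // -[|[|[|]]]// _; [exact: H h0 a|exact: H h1 b|exact: H h2 c].
split.
  by do 2?apply: measurable_funM; apply: measurableT_comp => //; exact: measurable_cellf.
move=> r; exists 1 => z _; rewrite /prod3 !normrM.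
by rewrite mulr_ile1 ?mulr_ge0 ?mulr_ile1//; [exact: (h0 _).1|exact: (h1 _).1|exact: (h2 _).1].
Qed.

Lemma unit_fun_unit : unit_fun unit_ind.
Proof.
split; first exact: measurable_unit_ind.
move=> y; have /andP[a b] := unit_ind01 y; rewrite ger0_norm//; split => //; exact: unit_ind_out.
Qed.

Lemma unit_fun_ounit : unit_fun ounit_ind.
Proof.
split; first exact: measurable_ounit_ind.
move=> y; have /andP[a b] := ounit_ind01 y; rewrite ger0_norm//; split => // h.
by rewrite -unit_ind_ounit ?unit_ind_out//; apply: contraTN h => /eqP ->; rewrite ltxx ltr10.
Qed.

Lemma unit_fun_diff : unit_fun (fun y => unit_ind y - ounit_ind y).
Proof.
split; first by apply: measurable_funB; [exact: measurable_unit_ind|exact: measurable_ounit_ind].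
move=> y; split; last first.
  by move=> h; rewrite (unit_fun_unit.2 y).2// (unit_fun_ounit.2 y).2// subrr.
have [->|y0] := eqVneq y 0; last by rewrite unit_ind_ounit// subrr normr0.
by rewrite /unit_ind /ounit_ind lexx ltr01 ltxx subr0 normr1.
Qed.

Lemma hcell_ind_prod3 : hcell_ind = prod3 unit_ind unit_ind unit_ind.
Proof. by apply/funext => z; rewrite hcell_indE. Qed.

Lemma cbm_hcell_ind : cbm hcell_ind.
Proof. by rewrite hcell_ind_prod3; apply: cbm_prod3; exact: unit_fun_unit. Qed.

Lemma Rint_line_point (f : R -> R) p : (forall y, y != p -> f y = 0) ->
  \int[@lebesgue_measure R]_y f y = 0.
Proof.
move=> f0; rewrite (@Rintegral_support _ setT [set p])//.
  by rewrite setTI Rintegral_set1.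
by move=> y _ /eqP; exact: f0.
Qed.

(** The faces are null. One half-open factor is replaced at a time, and each difference is carried
    by a face that a line in the x1 direction, or in the x2 direction for the last factor, meets in
    a single point. *)
Lemma Rint_hcell_ind :
  \int[leb3 R]_z hcell_ind z = \int[leb3 R]_z prod3 ounit_ind ounit_ind ounit_ind z.
Proof.
pose D y := unit_ind y - ounit_ind y.
have D0 y : y != 0 -> D y = 0 by move=> y0; rewrite /D unit_ind_ounit// subrr.
have [u v w] := And3 unit_fun_unit unit_fun_ounit unit_fun_diff.
have c0 := cbm_prod3 w u u; have c1 := cbm_prod3 v w u; have c2 := cbm_prod3 v v w.
have c3 := cbm_prod3 v v v.
transitivity (\int[leb3 R]_z (((prod3 D unit_ind unit_ind z + prod3 ounit_ind D unit_ind z) +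
   prod3 ounit_ind ounit_ind D z) + prod3 ounit_ind ounit_ind ounit_ind z)).
  by apply: eq_Rintegral => z _; rewrite hcell_indE /prod3 /D; ring.
have c01 := cbmD c0 c1; have c012 := cbmD c01 c2.
rewrite (RintD3 measurableT c012 c3) (RintD3 measurableT c01 c2) (RintD3 measurableT c0 c1).
have lin t y x : cellf n o 0 (t, (x, y)) = - n * (x - (2 * (t - 1) - o 0 / n)).
  by rewrite /cellf /lf /=; field; rewrite gt_eqF.
have lin1 t y x : cellf n o 1 (t, (x, y)) = n * (x - (o 1%N / n - 2 * (t - 1))).
  by rewrite /cellf /lf /=; field; rewrite gt_eqF.
have lin2 t y x : cellf n o 2 (t, (x, y)) = n * (y - o 2%N / n).
  by rewrite /cellf /lf /=; field; rewrite gt_eqF.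
have nn0 : n != 0 by rewrite gt_eqF.
rewrite (Rint3_1 c0); last first.
  move=> t y; apply: (@Rint_line_point _ (2 * (t - 1) - o 0 / n)) => x xp.
  by rewrite /prod3 -/(D _) D0 ?mul0r// lin mulf_eq0 oppr_eq0 (negbTE nn0)/= subr_eq0.
rewrite (Rint3_1 c1); last first.
  move=> t y; apply: (@Rint_line_point _ (o 1%N / n - 2 * (t - 1))) => x xp.
  by rewrite /prod3 -/(D _)
    (D0 (cellf n o 1 _)) ?mulr0 ?mul0r// lin1 mulf_eq0 (negbTE nn0)/= subr_eq0.
rewrite (Rint3_2 c2); last first.
  move=> t x; apply: (@Rint_line_point _ (o 2%N / n)) => y yp.
  by rewrite /prod3 -/(D _) (D0 (cellf n o 2 _)) ?mulr0// lin2 mulf_eq0 (negbTE nn0)/= subr_eq0.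
by rewrite !add0r.
Qed.

Lemma chi_exhaust eta : 0 < eta -> exists l,
  \int[leb3 R]_z hcell_ind z - eta <= \int[leb3 R]_z chi n o (bumpn l) 0 0 0 z ^+ 2.
Proof.
move=> eta0; rewrite Rint_hcell_ind.
have c01 l z := chi01 n o (@bumpn_01 R l) z.
have co l z : cell_out n o z -> chi n o (bumpn l) 0 0 0 z = 0.
  by move=> zo; apply: chi_out => //; exact: bump_bumpn.
have : (fun l => \int[leb3 R]_z chi n o (bumpn l) 0 0 0 z ^+ 2) @ \oo -->
    \int[leb3 R]_z prod3 ounit_ind ounit_ind ounit_ind z.
  apply: (@Rint3_dominated _ _ _ 1 (cell_radius n o)).
  - by move=> l; have [h _] := cbm_chi o n0 (bump_bumpn R l); exact: measurable_funX.
  - by have [] := cbm_prod3 unit_fun_ounit unit_fun_ounit unit_fun_ounit.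
  - move=> l z; have /andP[a b] := c01 l z.
    by rewrite ger0_norm ?sqr_ge0// exprn_ile1.
  - by move=> l z /(cell_radiusP n0) /(co l) ->; rewrite expr0n.
  - apply: aeW => z.
    have [zo|zi] := pselect (cell_out n o z).
      rewrite (_ : prod3 _ _ _ z = 0).
        by apply: cvg_near_cst; apply: nearW => l; rewrite co// expr0n.
      rewrite /prod3; have [i i3 zi] := zo.
      have U y : (y <= 0) || (1 <= y) -> ounit_ind y = 0.
        by rewrite /ounit_ind !leNgt -negb_and => /negbTE ->.
      by case: i i3 zi => [|[|[|]]]// _ /U ->; rewrite ?mulr0 ?mul0r.
    have zin := cell_in zi.
    have -> : prod3 ounit_ind ounit_ind ounit_ind z = (1 ^+ 0 * (1 * 1 * 1)) ^+ 2.
      by rewrite /prod3 /ounit_ind !zin//= expr0 !mul1r expr1n.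
    rewrite expr2; under eq_fun do rewrite expr2.
    suff h : (fun l => chi n o (bumpn l) 0 0 0 z) @ \oo --> (1 ^+ 0 * (1 * 1 * 1) : R)
      by exact: cvgM.
    apply: cvgM; first exact: cvg_cst.
    by apply: cvgM; [apply: cvgM|]; apply: bumpn_cvg; exact: zin.
move=> /cvgrPdist_le/(_ _ eta0)[l _ /(_ l (leqnn _))]; rewrite ler_norml => /andP[_ h].
by exists l; move: h; lra.
Qed.

End CellIndicator.

Section UniformContinuity.
Context (R : realType).
Local Notation T := (R * (R * R))%type.

Lemma continuous_uniform (f : T -> R) r e : continuous f -> 0 < e ->
  exists2 d : R, 0 < d & forall z z', `|z| <= r -> `|z - z'| < d -> `|f z - f z'| < e.
Proof.
move=> cf e0; have e2 : 0 < e / 2 by rewrite divr_gt0.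
have H := @compact_ball3 R r; rewrite compact_near_coveringP in H.
have [d [d0 hd]] : exists d : R, 0 < d /\
    forall z, `|z| <= r -> forall z', `|z - z'| < d -> `|f z - f z'| < e.
  suff HF : \forall d \near (0 : R)^'+,
      [set z : T | `|z| <= r] `<=` (fun z => forall z', `|z - z'| < d -> `|f z - f z'| < e).
    by apply: (@filter_ex _ (0 : R)^'+); apply: filterI; [exact: nbhs_right_gt|exact: HF].
  apply: H => z _.
  have /cvgrPdist_lt/(_ _ e2) := cf z.
  move=> /nbhs_ballP[q /= q0 qf].
  have q2 : 0 < q / 2 by rewrite divr_gt0.
  exists (ball z (q / 2), [set d | d < q / 2]).
    by split => /=; [exact: nbhsx_ballx|exact: nbhs_right_lt].
  move=> [x d] /= [xz dq] z' xz'.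
  rewrite (splitr e) -(subrKA (f z)) (le_lt_trans (ler_normD _ _))// ltrD//.
    by rewrite distrC; apply: qf; apply: le_ball xz; lra.
  apply: qf; rewrite -ball_normE/= -(subrKA x) (splitr q).
  rewrite (le_lt_trans (ler_normD _ _))// ltrD//.
    by move: xz; rewrite -ball_normE.
  exact: lt_trans xz' dq.
by exists d => // z z' zr; exact: hd.
Qed.

End UniformContinuity.

(** * Subdivision of a cell into a grid *)

Section GridGeometry.
Context (R : realType).
Local Notation T := (R * (R * R))%type.
Implicit Types (z : T) (c : nat * nat * nat).
Variables (o : nat -> R) (N : nat).
Hypothesis N0 : (0 < N)%N.

Definition cidx c (i : nat) : nat := match i with 0 => c.1.1 | 1 => c.1.2 | _ => c.2 end.

(** The offsets of subcell c when the unit cell with offsets [o] is divided into N^3 parts, in the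
    scale where subcells have side 1. *)
Definition gcell c (i : nat) : R := N%:R * o i + (cidx c i)%:R.

Definition in_gcell c z := in_hcell N%:R (gcell c) z.

Lemma in_hcellP n (p : nat -> R) z :
  reflect (forall i, (i < 3)%N -> 0 <= cellf n p i z < 1) (in_hcell n p z).
Proof.
apply: (iffP and3P) => [[a b c] [|[|[|]]]//|H]; split; exact: H.
Qed.

Lemma natr_close (y : R) (i j : nat) : 0 <= y - i%:R < 1 -> 0 <= y - j%:R < 1 -> i = j.
Proof.
have H (a b : nat) : 0 <= y - a%:R < 1 -> 0 <= y - b%:R < 1 -> (a <= b)%N.
  move=> /andP[h1 h2] /andP[h3 h4]; rewrite -ltnS -(ltr_nat R) -natr1; lra.
by move=> hi hj; apply/eqP; rewrite eqn_leq !H.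
Qed.

Lemma cellf_gcell c i z : cellf N%:R (gcell c) i z = N%:R * cellf 1 o i z - (cidx c i)%:R.
Proof. by rewrite /cellf /gcell; ring. Qed.

Lemma gcell_inj c c' z : in_gcell c z -> in_gcell c' z -> c = c'.
Proof.
move=> /in_hcellP h /in_hcellP h'.
have E i : (i < 3)%N -> cidx c i = cidx c' i.
  move=> i3; have := h i i3; have := h' i i3; rewrite !cellf_gcell => a b.
  exact: natr_close b a.
have := E 0%N isT; have := E 1%N isT; have := E 2%N isT.
by case: c c' {h h' E} => [[i j] k] [[i' j'] k'] /= -> -> ->.
Qed.

Definition grid := [seq (p, k) | p <- [seq (i, j) | i <- iota 0 N, j <- iota 0 N], k <- iota 0 N].

Lemma mem_grid c : (c \in grid) = [&& (c.1.1 < N)%N, (c.1.2 < N)%N & (c.2 < N)%N].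
Proof.
case: c => [[i j] k]; apply/allpairsP/and3P => /=.
  move=> [[p q] /= [/allpairsP[[a b] /= [ai bj ->]] kq [-> -> ->]]].
  by move: ai bj kq; rewrite !mem_iota.
move=> [iN jN kN]; exists ((i, j), k); split; rewrite ?mem_iota//=.
by apply/allpairsP; exists (i, j); rewrite !mem_iota.
Qed.

Lemma uniq_grid : uniq grid.
Proof.
apply: allpairs_uniq; rewrite ?iota_uniq//; last by move=> [? ?] [? ?] _ _ [-> ->].
by apply: allpairs_uniq; rewrite ?iota_uniq// => -[? ?] [? ?] _ _ [-> ->].
Qed.

Lemma grid_sub c z : c \in grid -> in_gcell c z -> in_hcell 1 o z.
Proof.
rewrite mem_grid => /and3P[c0 c1 c2] /in_hcellP h; apply/in_hcellP => i i3.
have := h i i3; rewrite cellf_gcell.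
have : (cidx c i < N)%N by case: i i3 => [|[|[|]]].
rewrite -(ler_nat R) -natr1 => iN /andP[h1 h2].
have N1 : 0 < N%:R :> R by rewrite ltr0n.
have i0 : 0 <= (cidx c i)%:R :> R by exact: ler0n.
apply/andP; split.
  by rewrite -(pmulr_rge0 _ N1); lra.
by rewrite -(ltr_pM2l N1) mulr1; lra.
Qed.

Lemma grid_cover z : in_hcell 1 o z -> exists2 c, c \in grid & in_gcell c z.
Proof.
move=> /in_hcellP h.
have N1 : 0 < N%:R :> R by rewrite ltr0n.
have K i : (i < 3)%N -> exists2 k, (k < N)%N & 0 <= N%:R * cellf 1 o i z - k%:R < 1.
  move=> i3; have /andP[h0 h1] := h i i3.
  have y0 : 0 <= N%:R * cellf 1 o i z by rewrite mulr_ge0// ltW.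
  have /andP[t0 t1] := truncn_itv y0.
  exists (Num.truncn (N%:R * cellf 1 o i z)).
    rewrite -(ltr_nat R) (le_lt_trans t0)// -[ltRHS]mulr1 ltr_pM2l//.
  by rewrite subr_ge0 t0/= ltrBlDl natr1.
have [k0 k0N h0] := K 0%N isT; have [k1 k1N h1] := K 1%N isT; have [k2 k2N h2] := K 2%N isT.
exists (k0, k1, k2); first by rewrite mem_grid /= k0N k1N k2N.
by apply/in_hcellP => -[|[|[|]]]// _; rewrite cellf_gcell.
Qed.

Lemma gcell_diam c z z' : in_gcell c z -> in_gcell c z' -> `|z - z'| <= N%:R^-1.
Proof.
move=> /in_hcellP h /in_hcellP h'.
have N1 : 0 < N%:R :> R by rewrite ltr0n.
have L i : (i < 3)%N -> `|lf i z - lf i z'| <= N%:R^-1.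
  move=> i3; have := h i i3; have := h' i i3; rewrite /cellf => /andP[a b] /andP[a' b'].
  rewrite -(ler_pM2l N1) divff ?gt_eqF// -{1}(gtr0_norm N1) -normrM ler_norml.
  by apply/andP; split; lra.
have := L 0%N isT; have := L 1%N isT; have := L 2%N isT.
case: z z' {h h' L} => [t [x y]] [t' [x' y']]; rewrite /lf norm3E /=.
rewrite !ler_norml => /andP[? ?] /andP[? ?] /andP[? ?].
by rewrite !ge_max !ler_norml; apply/and3P; split; apply/andP; split; lra.
Qed.

(** The corner of the subcell, by inverting [lf]: t = 1 + (lf 0 + lf 1) / 4 and x1 = (lf 1 - lf 0) /
    2. *)
Definition gpoint c : T :=
  let p i := gcell c i / N%:R in (1 + (p 0%N + p 1%N) / 4, ((p 1%N - p 0%N) / 2, p 2%N)).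

Lemma in_gpoint c : in_gcell c (gpoint c).
Proof.
have N1 : N%:R != 0 :> R by rewrite pnatr_eq0 -lt0n.
apply/in_hcellP => i i3; suff -> : cellf N%:R (gcell c) i (gpoint c) = 0 by rewrite lexx ltr01.
by case: i i3 => [|[|[|]]]// _; rewrite /cellf /lf /gpoint /=; field.
Qed.

Definition cov (cs : seq (nat * nat * nat)) z : bool := has (fun c => in_gcell c z) cs.

Lemma cov_cons c cs z : c \notin cs ->
  (cov (c :: cs) z)%:R = hcell_ind N%:R (gcell c) z + (cov cs z)%:R :> R.
Proof.
move=> ccs; rewrite /cov /= /hcell_ind -/(in_gcell c z).
have [zc|zc] := boolP (in_gcell c z); last by rewrite add0r.
case: hasP => [[c' c'cs zc']|_]; last by rewrite addr0.
by move: ccs; rewrite (gcell_inj zc zc') c'cs.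
Qed.

Lemma cbm_cov cs : uniq cs -> cbm (fun z => (cov cs z)%:R : R).
Proof.
elim: cs => [_|c cs ih /= /andP[ccs ucs]]; first exact: cbm0.
rewrite (_ : (fun _ => _) = fun z => hcell_ind N%:R (gcell c) z + (cov cs z)%:R).
  by apply: cbmD; [apply: cbm_hcell_ind; rewrite ltr0n|exact: ih].
by apply/funext => z; exact: cov_cons.
Qed.

Lemma cov_grid z : (cov grid z)%:R = hcell_ind 1 o z.
Proof.
rewrite /hcell_ind; congr (nat_of_bool _)%:R; apply/hasP/idP => [[c cg]|].
  exact: grid_sub.
by move=> /grid_cover[c cg zc]; exists c.
Qed.

End GridGeometry.

Section GridStep.
Context (R : realType).
Local Notation T := (R * (R * R))%type.
Implicit Types (z : T) (c : nat * nat * nat) (w V : nat -> T -> R).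
Variable (o : nat -> R).

Definition esq w z : R := w 0%N z ^+ 2 + w 1%N z ^+ 2.

Definition pairing (g : (T -> R) * (T -> R)) w z : R := g.1 z * w 0%N z + g.2 z * w 1%N z.

Lemma cbm_sqr (f : T -> R) : cbm f -> cbm (fun z => f z ^+ 2).
Proof. by move=> cf; under eq_fun do rewrite expr2; apply: cbmMr => //; exact: cbm_lbm. Qed.

Lemma cbm_esq w : (forall i, cbm (w i)) -> cbm (esq w).
Proof. by move=> cw; apply: cbmD; exact: cbm_sqr. Qed.

Lemma Rint_le_cst_ind (f h : T -> R) K : cbm f -> cbm h ->
  (forall z, `|f z| <= K * h z) -> `|\int[leb3 R]_z f z| <= K * \int[leb3 R]_z h z.
Proof.
move=> cf ch fh; rewrite -RintZ3//.
have cK : cbm (fun z => K * h z) by apply: cbmMl => //; exact: lbm_cst.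
rewrite ler_norml -[X in X <= _]mulN1r -RintZ3//; apply/andP; split; apply: cbm_le => //.
- by apply: cbmMl => //; exact: lbm_cst.
- by move=> z; have := fh z; rewrite mulN1r ler_norml => /andP[].
- by move=> z; have := fh z; rewrite ler_norml => /andP[].
Qed.

Lemma hcell_out n (p : nat -> R) z : cell_out n p z \/ in_hcell n p z.
Proof.
have [|zi] := pselect (cell_out n p z); first by left.
by right; apply/in_hcellP => i i3; have /andP[/ltW -> ->] := cell_in zi i3.
Qed.

End GridStep.

(** Each perturbation is built for the state frozen at a corner of a subcell and vanishes outside
    that subcell. A point is thus perturbed at most once: the lower bound falls to d / 20 however
    many subcells are treated, while gains and pairings add up. *)
Lemma grid_list (R : realType) (o : nat -> R) (N : nat) (w : nat -> R * (R * R) -> R)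
    (d e eta : R) (gs : seq ((R * (R * R) -> R) * (R * (R * R) -> R))) :
  (0 < N)%N -> linsol w -> (forall i, cbm (w i)) -> 0 < d ->
  (forall z, posdef d (w ^~ z)) -> 0 < e -> e <= 1 -> e <= d / 720 -> 0 < eta ->
  (forall g, g \in gs -> lbm g.1 /\ lbm g.2) ->
  (forall c z z' i, c \in grid N -> in_gcell o N c z -> in_gcell o N c z' ->
    (i < 4)%N -> `|w i z - w i z'| <= e) ->
  (forall c z z' g, c \in grid N -> in_gcell o N c z -> in_gcell o N c z' ->
    g \in gs -> `|g.1 z - g.1 z'| <= e /\ `|g.2 z - g.2 z'| <= e) ->
  forall cs, uniq cs -> {subset cs <= grid N} -> exists V : nat -> R * (R * R) -> R,
  [/\ linsol V, forall i, cbm (V i), forall i z, ~~ cov o N cs z -> V i z = 0,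
      forall z, posdef (d / 20) (fun i => w i z + V i z) &
      \int[leb3 R]_z esq w z +
        \int[leb3 R]_z ((deficit (w ^~ z) ^+ 2 / 128 - 17 * e) * (cov o N cs z)%:R)
        - (size cs)%:R * eta <= \int[leb3 R]_z esq (fun i z => w i z + V i z) z /\
      forall g, g \in gs ->
        `|\int[leb3 R]_z pairing g V z| <= 8 * e * \int[leb3 R]_z (cov o N cs z)%:R].
Proof.
move=> N0 lw cw d0 pw e0 e1 ed eta0 cg oscw oscg cs.
have N1 : 0 < N%:R :> R by rewrite ltr0n.
elim: cs => [_ _|c cs ih /= /andP[ccs ucs] csg].
  exists (fun _ _ => 0); split => //.
  - exact: linsol0.
  - by move=> i; exact: cbm0.
  - move=> z; apply: (@posdef_eq _ _ (w ^~ z)); first by move=> i _; rewrite addr0.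
    have d20 : d / 20 <= d by rewrite ler_pdivrMr//; have := d0; lra.
    exact: posdef_le d20 (pw z).
  - split.
      rewrite mul0r subr0 (_ : \int[_]_z (_ * _) = 0) ?addr0.
        rewrite le_eqVlt; apply/orP; left; apply/eqP; apply: eq_Rintegral => z _.
        by rewrite /esq !addr0.
      transitivity (\int[leb3 R]_z ((fun=> 0 : R) (z : R * (R * R)))).
        by apply: eq_Rintegral => z _; rewrite mulr0.
      by rewrite Rintegral_cst ?mul0r//.
    move=> g _; rewrite (_ : \int[_]_z pairing _ _ _ = 0) ?normr0.
      by apply: mulr_ge0; [lra|apply: Rintegral_ge0].
    transitivity (\int[leb3 R]_z ((fun=> 0 : R) (z : R * (R * R)))).
      by apply: eq_Rintegral => z _; rewrite /pairing !mulr0 addr0.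
    by rewrite Rintegral_cst ?mul0r//.
have cg' : c \in grid N by apply: csg; rewrite mem_head.
have [|V [lV cV V0 pV [gV tV]]] := ih ucs.
  by move=> c' c'cs; apply: csg; rewrite inE c'cs orbT.
pose p := gcell o N c; pose I z := hcell_ind N%:R p z.
have cI : cbm I by exact: cbm_hcell_ind.
pose zc := gpoint o N c.
have zcc : in_gcell o N c zc by exact: in_gpoint.
pose x i := w i zc.
(* One half of eta pays for replacing the squared cutoff by the indicator of the subcell, the other
   half for the wave. *)
have eta20 : 0 < eta / 2 by rewrite divr_gt0.
have [l hl] := @chi_exhaust R N%:R p N1 (eta / 2) eta20.
have [|P [lP cP P0 IP [pP gP]]] := @cell_perturbation R N%:R p N1 _ (bump_bumpn R l)
  (bumpn_01 l) x d (eta / 2) d0 (pw zc); first by rewrite divr_gt0.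
have PI i z : ~~ in_gcell o N c z -> P i z = 0.
  move=> zn; apply: P0; have [//|zi] := hcell_out N%:R p z.
  by move: zn; rewrite /in_gcell zi.
have [x0b x1b /andP[D0 D2]] := posdef_bound (posdef_le (ltW d0) (pw zc)).
have wb z : `|w 0%N z| <= 2 /\ `|w 1%N z| <= 2.
  by have [] := posdef_bound (posdef_le (ltW d0) (pw z)).
(* Both [x] and the perturbed state are positive semidefinite states, whose velocity components are
   at most 2. *)
have Pb i z : (i < 2)%N -> `|P i z| <= 4 * I z.
  move=> i2; rewrite /I /hcell_ind -/(in_gcell o N c z).
  have [zc'|zn] := boolP (in_gcell o N c z); last by rewrite PI// normr0 mulr0.
  rewrite mulr1; have d10 : 0 <= d / 10 by rewrite divr_ge0// ltW.
  have [b0 b1 _] := posdef_bound (posdef_le d10 (pP z)).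
  case: i i2 => [|[|]]// _.
    rewrite -(addKr (x 0%N) (P 0%N z)) addrC (le_trans (ler_normB _ _))//.
    by have b0' : `|x 0%N + P 0%N z| <= 2 := b0; move: b0' x0b; clear; lra.
  rewrite -(addKr (x 1%N) (P 1%N z)) addrC (le_trans (ler_normB _ _))//.
  by have b1' : `|x 1%N + P 1%N z| <= 2 := b1; move: b1' x1b; clear; lra.
have I0 z : 0 <= I z by exact: ler0n.
have VP i j z : V i z * P j z = 0.
  have [zc'|zn] := boolP (in_gcell o N c z); last by rewrite PI ?mulr0.
  rewrite V0 ?mul0r//; apply/hasPn => c' c'cs; apply: contra ccs => zc2.
  by rewrite (gcell_inj zc' zc2).
(* The mean of P vanishes, so P is almost orthogonal to what varies little in the cell. *)
have orth (f : R * (R * R) -> R) i : (i < 2)%N -> lbm f ->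
    (forall z, in_gcell o N c z -> `|f z - f zc| <= e) ->
    `|\int[leb3 R]_z (f z * P i z)| <= 4 * e * \int[leb3 R]_z I z.
  move=> i2 lf fosc.
  have c1 : cbm (fun z => (f z - f zc) * P i z) by apply: cbmMl => //; apply: lbmB => //;
    exact: lbm_cst.
  have c2 : cbm (fun z => f zc * P i z) by apply: cbmMl => //; exact: lbm_cst.
  have -> : \int[leb3 R]_z (f z * P i z) = \int[leb3 R]_z ((f z - f zc) * P i z).
    transitivity (\int[leb3 R]_z ((f z - f zc) * P i z + f zc * P i z)).
      by apply: eq_Rintegral => z _; rewrite -mulrDl subrK.
    by rewrite RintD3// RintZ3// IP// mulr0 addr0.
  apply: Rint_le_cst_ind => // z.
  have [zc'|zn] := boolP (in_gcell o N c z); last first.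
    by rewrite PI// mulr0 normr0; apply: mulr_ge0 (I0 z); move: e0; clear; lra.
  rewrite normrM mulrAC mulrC ler_pM//; first exact: Pb.
  exact: fosc.
exists (fun i z => V i z + P i z); split.
- exact: linsolD.
- by move=> i; exact: cbmD.
- move=> i z; rewrite /cov /= negb_or => /andP[zn zcs].
  by rewrite V0// PI// addr0.
- move=> z; have [zc'|zn] := boolP (in_gcell o N c z); last first.
    by apply: posdef_eq (pV z) => i _; rewrite PI// addr0.
  apply: (@posdef_le _ (d / 10 - 36 * e)); first by move: ed; clear; lra.
  apply: (@posdef_eq _ _ (fun i => (x i + P i z) + (w i z - x i))).
    move=> i i4; rewrite V0 ?add0r; first by ring.
    apply/hasPn => c' c'cs; apply: contra ccs => zc2.
    by rewrite (gcell_inj zc' zc2).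
  have d10 : 0 <= d / 10 by rewrite divr_ge0// ltW.
  have [b0 b1 _] := posdef_bound (posdef_le d10 (pP z)).
  apply: posdef_perturb => //.
  + by rewrite ltW.
  + by apply: le_trans b0 _; clear; lra.
  + by apply: le_trans b1 _; clear; lra.
  + by move=> i i4; exact: (oscw c _ _ _ cg' zc' zcc i4).
- have lcst (a : R) : lbm (fun _ : R * (R * R) => a) by exact: lbm_cst.
  have lI z : in_gcell o N c z -> forall i, (i < 4)%N -> `|w i z - w i zc| <= e.
    by move=> zc' i i4; exact: oscw zc' zcc i4.
  have covE z := cov_cons o N z ccs.
  have ccov : cbm (fun z => (cov o N cs z)%:R : R) by exact: cbm_cov.
  split; last first.
    move=> g gg; have [lg1 lg2] := cg g gg.
    have -> : \int[leb3 R]_z (cov o N (c :: cs) z)%:R =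
        \int[leb3 R]_z I z + \int[leb3 R]_z (cov o N cs z)%:R.
      by rewrite -RintD3//; apply: eq_Rintegral => z _; exact: covE.
    have cp0 : cbm (fun z => g.1 z * P 0%N z) by exact: cbmMl.
    have cp1 : cbm (fun z => g.2 z * P 1%N z) by exact: cbmMl.
    have cpV : cbm (pairing g V) by apply: cbmD; exact: cbmMl.
    have -> : \int[leb3 R]_z pairing g (fun i z => V i z + P i z) z =
        \int[leb3 R]_z pairing g V z + (\int[leb3 R]_z (g.1 z * P 0%N z) +
         \int[leb3 R]_z (g.2 z * P 1%N z)).
      rewrite -RintD3// -RintD3//; last exact: cbmD.
      by apply: eq_Rintegral => z _; rewrite /pairing; ring.
    have h1 := tV g gg.
    have h2 := orth g.1 0%N isT lg1 (fun z zc' => (oscg c _ _ _ cg' zc' zcc gg).1).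
    have h3 := orth g.2 1%N isT lg2 (fun z zc' => (oscg c _ _ _ cg' zc' zcc gg).2).
    rewrite (le_trans (ler_normD _ _))//.
    have := ler_normD (\int[leb3 R]_z (g.1 z * P 0%N z)) (\int[leb3 R]_z (g.2 z * P 1%N z)).
    by move: h1 h2 h3; clear; lra.
  have cwP0 : cbm (fun z => w 0%N z * P 0%N z) by apply: cbmMl => //; exact: cbm_lbm.
  have cwP1 : cbm (fun z => w 1%N z * P 1%N z) by apply: cbmMl => //; exact: cbm_lbm.
  have h2 := orth (w 0%N) 0%N isT (cbm_lbm (cw 0%N)) (fun z zc' => lI z zc' 0%N isT).
  have h3 := orth (w 1%N) 1%N isT (cbm_lbm (cw 1%N)) (fun z zc' => lI z zc' 1%N isT).
  have cwV : cbm (esq (fun i z => w i z + V i z)) by apply: cbm_esq => i; exact: cbmD.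
  have cP2 : cbm (esq P) by exact: cbm_esq.
  have E1 : \int[leb3 R]_z esq (fun i z => w i z + (V i z + P i z)) z =
     \int[leb3 R]_z esq (fun i z => w i z + V i z) z + \int[leb3 R]_z esq P z +
     2 * (\int[leb3 R]_z (w 0%N z * P 0%N z) + \int[leb3 R]_z (w 1%N z * P 1%N z)).
    rewrite -(RintD3 _ cwP0 cwP1)// -RintZ3//; last exact: cbmD.
    rewrite -(RintD3 _ cwV cP2)// -RintD3//; [|exact: cbmD|by apply: cbmMl => //; exact: cbmD].
    apply: eq_Rintegral => z _; rewrite /esq.
    have := VP 0%N 0%N z; have := VP 1%N 1%N z.
    move: (V 0%N z) (V 1%N z) (P 0%N z) (P 1%N z) (w 0%N z) (w 1%N z) => a b q r s t h4 h5.
    have -> : (s + (a + q)) ^+ 2 + (t + (b + r)) ^+ 2 = (s + a) ^+ 2 + (t + b) ^+ 2 +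
       (q ^+ 2 + r ^+ 2) + 2 * (s * q + t * r) + 2 * (a * q) + 2 * (b * r) by ring.
    by rewrite h4 h5 !mulr0 !addr0.
  have ldef : lbm (fun z => deficit (w ^~ z)).
    by apply: lbmB; [apply: lbmB => //|]; apply: lbmX; exact: cbm_lbm.
  have lG : lbm (fun z => deficit (w ^~ z) ^+ 2 / 128 - 17 * e).
    by apply: lbmB => //; apply: lbmM => //; exact: lbmX.
  have cG1 : cbm (fun z => (deficit (w ^~ z) ^+ 2 / 128 - 17 * e) * I z) by exact: cbmMl.
  have cG2 : cbm (fun z => (deficit (w ^~ z) ^+ 2 / 128 - 17 * e) * (cov o N cs z)%:R).
    exact: cbmMl.
  have E2 : \int[leb3 R]_z ((deficit (w ^~ z) ^+ 2 / 128 - 17 * e) * (cov o N (c :: cs) z)%:R) =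
     \int[leb3 R]_z ((deficit (w ^~ z) ^+ 2 / 128 - 17 * e) * I z) +
     \int[leb3 R]_z ((deficit (w ^~ z) ^+ 2 / 128 - 17 * e) * (cov o N cs z)%:R).
    by rewrite -RintD3//; apply: eq_Rintegral => z _; rewrite covE mulrDr.
  (* The loss 17 e per unit volume is e for the oscillation of deficit^2 / 128 on the subcell,
     bounded here, and 16 e for twice the pairing of w with P. *)
  have h4 : \int[leb3 R]_z ((deficit (w ^~ z) ^+ 2 / 128 - 17 * e) * I z) <=
      (deficit x ^+ 2 / 128 - 16 * e) * \int[leb3 R]_z I z.
    rewrite -RintZ3//; apply: cbm_le => //; first exact: cbmMl.
    move=> z; rewrite /I /hcell_ind -/(in_gcell o N c z).
    have [zc'|zn] := boolP (in_gcell o N c z); last by rewrite !mulr0.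
    rewrite !mulr1.
    have [w0b w1b] := wb z; have o0 := lI z zc' 0%N isT; have o1 := lI z zc' 1%N isT.
    have [_ _ /andP[Dz0 Dz2]] := posdef_bound (posdef_le (ltW d0) (pw z)).
    have dif (a b : R) : `|a| <= 2 -> `|b| <= 2 -> `|a - b| <= e -> `|a ^+ 2 - b ^+ 2| <= 4 * e.
      move=> a2 b2 ab; rewrite subr_sqr normrM mulrC ler_pM//.
      by rewrite (le_trans (ler_normD _ _))//; move: a2 b2; clear; lra.
    have q0 := dif _ _ w0b x0b o0; have q1 := dif _ _ w1b x1b o1.
    have DD : deficit (w ^~ z) <= deficit x + 8 * e.
      move: q0 q1; rewrite /deficit /x !ler_norml; clear => /andP[? ?] /andP[? ?]; lra.
    move: DD Dz0 Dz2 D0 D2; move: (deficit (w ^~ z)) (deficit x) e0; clear => a b; nra.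
  have h5 : deficit x ^+ 2 / 128 * \int[leb3 R]_z I z - eta <= \int[leb3 R]_z esq P z.
    apply: le_trans gP; move: hl; rewrite -/(I _).
    have : 0 <= deficit x ^+ 2 / 128 <= 1.
      by move: D0 D2; rewrite -/x; move: (deficit x); clear => a ? ?; apply/andP; split; nra.
    move: (deficit x ^+ 2 / 128) (\int[_]_z hcell_ind _ _ _) (\int[_]_z _ ^+ 2) eta0;
      clear => a b q; nra.
  rewrite E1 E2 -(@natr1 R (size cs)).
  move: h2 h3; rewrite !ler_norml => /andP[h2 _] /andP[h3 _].
  by move: gV h2 h3 h4 h5; clear; lra.
Qed.

Lemma continuous_uniform_seq (R : realType) (fs : seq (R * (R * R) -> R)) r e : 0 < e ->
  (forall f, f \in fs -> continuous f) -> exists2 d : R, 0 < d &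
  forall f z z', f \in fs -> `|z| <= r -> `|z - z'| < d -> `|f z - f z'| < e.
Proof.
move=> e0; elim: fs => [_|f fs ih cfs]; first by exists 1.
have [|d d0 dfs] := ih; first by move=> g gfs; apply: cfs; rewrite inE gfs orbT.
have [d' d'0 df] := continuous_uniform r (cfs f (mem_head _ _)) e0.
exists (Num.min d d'); first by rewrite lt_min d0.
by move=> g z z'; rewrite inE lt_min => /orP[/eqP->|gfs] zr /andP[? ?]; [apply: df|apply: dfs].
Qed.

Definition subsol (R : realType) (o : nat -> R) (w : nat -> R * (R * R) -> R) :=
  [/\ linsol w, forall i, cbm (w i), forall i z, ~~ in_hcell 1 o z -> w i z = 0 &
      exists2 d, 0 < d & forall z, posdef d (w ^~ z)].

(** The gain involves the deficit alone. The lower bound d of the subsolution decides only how fine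
    the grid must be, so its decay along the iteration does no harm. *)
Lemma grid_step (R : realType) (o : nat -> R) (w : nat -> R * (R * R) -> R)
    (gs : seq ((R * (R * R) -> R) * (R * (R * R) -> R))) (eta : R) :
  subsol o w -> (forall g, g \in gs -> continuous g.1 /\ continuous g.2) -> 0 < eta ->
  exists w', [/\ subsol o w',
    \int[leb3 R]_z esq w z + (\int[leb3 R]_z (deficit (w ^~ z) ^+ 2 * hcell_ind 1 o z)) / 128
      - eta <= \int[leb3 R]_z esq w' z &
    forall g, g \in gs ->
      `|\int[leb3 R]_z pairing g (fun i z => w' i z - w i z) z| <= eta].
Proof.
move=> [lw cw w0 [d d0 pw]] cg eta0.
pose mu := \int[leb3 R]_z hcell_ind 1 o z.
have mu0 : 0 <= mu by apply: Rintegral_ge0 => z _; exact: ler0n.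
(* The oscillation allowed on a subcell. The factor 40 (mu + 1) ensures 17 e mu <= eta / 2 and 8 e
   mu <= eta. *)
pose e := Num.min (Num.min 1 (d / 720)) (eta / (40 * (mu + 1))).
have mu1 : 0 < 40 * (mu + 1) by move: mu0; clear; lra.
have d720 : 0 < d / 720.
  have p720 : 0 < 720 :> R by rewrite ltr0n.
  exact: divr_gt0 d0 p720.
have emu0 : 0 < eta / (40 * (mu + 1)) by exact: divr_gt0 eta0 mu1.
have e0 : 0 < e by rewrite /e lt_min lt_min ltr01 d720 emu0.
have e1 : e <= 1 by rewrite !ge_min lexx.
have ed : e <= d / 720 by rewrite !ge_min lexx orbT.
have emu : e * (40 * (mu + 1)) <= eta by rewrite -ler_pdivlMr// !ge_min lexx !orbT.
pose fs := [seq w i | i <- iota 0 4] ++ [seq g.1 | g <- gs] ++ [seq g.2 | g <- gs].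
have cfs f : f \in fs -> continuous f.
  rewrite !mem_cat => /or3P[/mapP[i + ->]|/mapP[g gg ->]|/mapP[g gg ->]].
  - by rewrite mem_iota => /andP[_ i4]; have [] := lw.1 i i4.
  - by have [] := cg g gg.
  - by have [] := cg g gg.
have [dl dl0 hdl] := continuous_uniform_seq (cell_radius 1 o) e0 cfs.
pose N := (Num.truncn dl^-1).+1.
have N0 : (0 < N)%N by [].
have NR0 : 0 < N%:R :> R by rewrite ltr0n.
have Ndl : N%:R^-1 < dl.
  by rewrite invf_plt ?posrE//; exact: truncnS_gt.
have osc c z z' f : c \in grid N -> in_gcell o N c z -> in_gcell o N c z' -> f \in fs ->
    `|f z - f z'| <= e.
  move=> cN zc zc' ff; apply/ltW/hdl => //.
    have /in_hcellP zi := grid_sub N0 cN zc.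
    apply: cell_radius_closed => // i i3; have /andP[-> /ltW ->] := zi i i3.
    by [].
  by apply: le_lt_trans Ndl; exact: gcell_diam zc zc'.
pose eta' := eta / (2 * (size (grid N)).+1%:R).
have eta'0 : 0 < eta' by rewrite divr_gt0// mulr_gt0.
have [||||V [lV cV V0 pV [gV tV]]] := @grid_list R o N w d e eta' gs N0 lw cw d0 pw e0 e1 ed eta'0
   _ _ _ (grid N) (uniq_grid N).
- by move=> g /cg[? ?]; split; exact: continuous_lbm.
- move=> c z z' i cN zc zc' i4; apply: osc cN zc zc' _.
  by rewrite mem_cat; apply/orP; left; apply: map_f; rewrite mem_iota.
- move=> c z z' g cN zc zc' gg; split; apply: osc cN zc zc' _.
    by rewrite !mem_cat; apply/or3P; constructor 2; apply: (map_f (fun g => g.1)).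
  by rewrite !mem_cat; apply/or3P; constructor 3; apply: (map_f (fun g => g.2)).
- by [].
have covE z := cov_grid o N0 z.
have covI : \int[leb3 R]_z (cov o N (grid N) z)%:R = mu by apply: eq_Rintegral => z _; exact: covE.
exists (fun i z => w i z + V i z); split.
- split.
  + exact: linsolD.
  + by move=> i; exact: cbmD.
  + move=> i z zn; rewrite w0// V0 ?addr0//.
    by have := covE z; rewrite /hcell_ind (negbTE zn); case: cov => //= /eqP; rewrite oner_eq0.
  + by exists (d / 20) => //; rewrite divr_gt0.
- apply: le_trans gV.
  have ch : cbm (hcell_ind 1 o) by exact: cbm_hcell_ind.
  have ldef : lbm (fun z => deficit (w ^~ z) ^+ 2).
    apply/lbmX/lbmB; [apply/lbmB; first exact: lbm_cst|];
      by apply: lbmX; exact: cbm_lbm.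
  have c1 : cbm (fun z => deficit (w ^~ z) ^+ 2 * hcell_ind 1 o z) by exact: cbmMl.
  have c2 a : cbm (fun z => a * hcell_ind 1 o z) by apply: cbmMl => //; exact: lbm_cst.
  have c3 : cbm (fun z => 128^-1 * (deficit (w ^~ z) ^+ 2 * hcell_ind 1 o z)).
    by apply: cbmMl => //; exact: lbm_cst.
  have -> : \int[leb3 R]_z ((deficit (w^~ z) ^+ 2 / 128 - 17 * e) * (cov o N (grid N) z)%:R) =
     (\int[leb3 R]_z (deficit (w ^~ z) ^+ 2 * hcell_ind 1 o z)) / 128 - 17 * e * mu.
    rewrite [X in X - _]mulrC -!RintZ3// -RintB3//.
    by apply: eq_Rintegral => z _; rewrite covE; ring.
  have seta : (size (grid N))%:R * eta' <= eta / 2.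
    have -> : eta / 2 = (size (grid N)).+1%:R * eta'.
      have : (size (grid N)).+1%:R != 0 :> R by rewrite pnatr_eq0.
      by rewrite /eta'; move: ((size (grid N)).+1%:R) => S S0; field; rewrite S0.
    by rewrite ler_wpM2r ?ler_nat// ltW.
  move: (\int[leb3 R]_z esq w z) (\int[leb3 R]_z (_ * _)) seta emu e0 mu0; clear => a b ? ? ? ?;
    nra.
- move=> g gg.
  have -> : \int[leb3 R]_z pairing g (fun i z => w i z + V i z - w i z) z =
      \int[leb3 R]_z pairing g V z.
    by apply: eq_Rintegral => z _; rewrite /pairing !(addrC (w _ _)) !addrK.
  apply: le_trans (tV g gg) _; rewrite covI; move: emu e0 mu0; clear => ? ? ?; nra.
Qed.

(** * Limits of subsolutions in a cell *)

Section WeakLinear.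
Context (R : realType).
Local Notation T := (R * (R * R))%type.
Local Notation T1 := (measurableTypeR R).
Local Notation T3 := (T1 * (T1 * T1))%type.
Implicit Types (F G : T -> R) (w V : nat -> T -> R) (z : T).

(** Tested on all of space-time: the fields are extended by zero from the wedge, where t >= 1, so no
    initial term appears. *)
Definition weak_linsol V := forall psi, test_function psi ->
  [/\ \int[leb3 R]_z (V 0%N z * Dax 1 psi z) + \int[leb3 R]_z (V 1%N z * Dax 2 psi z) = 0,
      \int[leb3 R]_z (V 0%N z * Dax 0 psi z) + \int[leb3 R]_z (V 2%N z * Dax 1 psi z)
        + \int[leb3 R]_z (V 3%N z * Dax 2 psi z) = 0 &
      \int[leb3 R]_z (V 1%N z * Dax 0 psi z) + \int[leb3 R]_z (V 3%N z * Dax 1 psi z)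
        - \int[leb3 R]_z (V 2%N z * Dax 2 psi z) = 0].

Lemma Rint3_parts F psi j : (j < 3)%N -> C1f F -> cbm F -> test_function psi ->
  \int[leb3 R]_z (F z * Dax j psi z) = - \int[leb3 R]_z (Dax j F z * psi z).
Proof.
move=> j3 [cF dF] bF tpsi; have [dFj cDF] := dF j j3.
have [cp bp dp cDp bDp] := test_Dax j tpsi.
have b1 : cbm (fun z => F z * Dax j psi z) by apply: cbmMl => //; exact: cbm_lbm.
have b2 : cbm (fun z => Dax j F z * psi z) by apply: cbmMl => //; exact: continuous_lbm.
apply/eqP; rewrite -addr_eq0 -RintD3//; apply/eqP.
apply: (@Rint3_derive _ j (fun z => F z * psi z)).
- by move=> z; apply: cvgM; [exact: cF|exact: cp].
- move=> z; apply: cvgD; apply: cvgM;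
    [exact: cF|exact: cDp|exact: cDF|exact: cp].
- by apply: cbmMl => //; exact: cbm_lbm.
- exact: cbmD.
- by move=> z; apply: dE (dM (dFj z) (dp z)) _; rewrite addrC.
Qed.

Lemma Rint3_zero F : (forall z, F z = 0) -> \int[leb3 R]_z F z = 0.
Proof.
move=> F0; rewrite (_ : \int[_]_z _ = \int[leb3 R]_z ((fun=> 0 : R) (z : T))).
  by rewrite Rintegral_cst ?mul0r.
by apply: eq_Rintegral => z _; rewrite F0.
Qed.

Lemma Rint3_sum2 F G : cbm F -> cbm G -> (forall z, F z + G z = 0) ->
  - (\int[leb3 R]_z F z) + - (\int[leb3 R]_z G z) = 0.
Proof. by move=> cF cG FG; rewrite -opprD -RintD3// Rint3_zero// oppr0. Qed.

Lemma Rint3_sum3 F G H : cbm F -> cbm G -> cbm H -> (forall z, F z + G z + H z = 0) ->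
  - (\int[leb3 R]_z F z) + - (\int[leb3 R]_z G z) + - (\int[leb3 R]_z H z) = 0.
Proof.
move=> cF cG cH FGH; rewrite -!opprD -RintD3// -RintD3//; last exact: cbmD.
by rewrite Rint3_zero// oppr0.
Qed.

Lemma Rint3_diff3 F G H : cbm F -> cbm G -> cbm H -> (forall z, F z + G z - H z = 0) ->
  - (\int[leb3 R]_z F z) + - (\int[leb3 R]_z G z) - - (\int[leb3 R]_z H z) = 0.
Proof.
move=> cF cG cH FGH; rewrite -!opprD -RintD3// -RintB3//; last exact: cbmD.
by rewrite Rint3_zero// oppr0.
Qed.

Lemma linsol_weak w : linsol w -> (forall i, cbm (w i)) -> weak_linsol w.
Proof.
move=> [C1 pde] cw psi tpsi; have [_ bp _ _ _] := test_Dax 0 tpsi.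
have bD i j : (i < 4)%N -> (j < 3)%N -> cbm (fun z => Dax j (w i) z * psi z).
  by move=> i4 j3; apply: cbmMl => //; exact: continuous_lbm ((C1 i i4).2 j j3).2.
have P i j (i4 : (i < 4)%N) (j3 : (j < 3)%N) := Rint3_parts j3 (C1 i i4) (cw i) tpsi.
have [b01 b12] := (bD 0%N 1%N isT isT, bD 1%N 2%N isT isT).
have [b00 [b21 b32]] := (bD 0%N 0%N isT isT, (bD 2%N 1%N isT isT, bD 3%N 2%N isT isT)).
have [b10 [b31 b22]] := (bD 1%N 0%N isT isT, (bD 3%N 1%N isT isT, bD 2%N 2%N isT isT)).
split.
- apply: eq_trans (congr2 +%R (P 0%N 1%N isT isT) (P 1%N 2%N isT isT)) _.
  by apply: (Rint3_sum2 b01 b12) => z; have [h _ _] := pde z; rewrite -mulrDl h mul0r.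
- apply: eq_trans (congr2 +%R (congr2 +%R (P 0%N 0%N isT isT) (P 2%N 1%N isT isT))
    (P 3%N 2%N isT isT)) _.
  by apply: (Rint3_sum3 b00 b21 b32) => z; have [_ h _] := pde z; rewrite -!mulrDl h mul0r.
- apply: eq_trans (congr2 (fun a b => a - b) (congr2 +%R (P 1%N 0%N isT isT)
    (P 3%N 1%N isT isT)) (P 2%N 2%N isT isT)) _.
  by apply: (Rint3_diff3 b10 b31 b22) => z; have [_ _ h] := pde z; rewrite -mulrDl -mulrBl h mul0r.
Qed.

(** The sequence e k - 2^-k is nondecreasing, as the errors 2^-(j+1) from k on sum to 2^-k, and it
    is bounded. Its increments dominate [a k]. *)
Lemma almost_increasing_cauchy (e a : nat -> R) B :
  (forall k, 0 <= a k) -> (forall k, e k <= B) ->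
  (forall k, e k + a k - 2^-1 ^+ k.+1 <= e k.+1) -> forall tol, 0 < tol ->
  exists n, forall k, (n <= k)%N ->
    a k <= tol /\ forall l, (k <= l)%N -> e l - e k <= tol.
Proof.
move=> a0 eB ea tol tol0; pose E k := e k - 2^-1 ^+ k.
have h0 k : 0 < 2^-1 ^+ k :> R by rewrite exprn_gt0.
have hS k : 2^-1 ^+ k = 2 * 2^-1 ^+ k.+1 :> R by rewrite exprS mulrA divff ?mul1r.
have EaS k : E k + a k <= E k.+1.
  rewrite /E (hS k); have := ea k; move: (e k) (e k.+1) (_ ^+ k.+1) (a k); clear => *; lra.
have ES : nondecreasing_seq E.
  apply/nondecreasing_seqP => k; apply: le_trans (EaS k).
  by rewrite lerDl.
have EB : has_ubound (range E).
  exists B => _ [k _ <-]; apply: le_trans (eB k); rewrite /E.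
  by rewrite gerBl ltW.
have cE := nondecreasing_is_cvgn ES EB.
have El k : E k <= limn E by exact: nondecreasing_cvgn_le.
have t2 : 0 < tol / 2 by move: tol0; clear; lra.
have /cvgrPdist_lt/(_ _ t2)[n1 _ n1E] : E @ \oo --> limn E by [].
have : (fun k => 2^-1 ^+ k : R) @ \oo --> 0.
  by apply: cvg_expr; rewrite ger0_norm// invf_lt1 ?ltr1n.
move=> /cvgrPdist_lt/(_ _ t2)[n2 _ n2E].
exists (maxn n1 n2) => k; rewrite geq_max => /andP[kn1 kn2].
have := n1E k kn1; have := n2E k kn2; rewrite /= sub0r normrN (ger0_norm (ltW (h0 k))).
rewrite ger0_norm ?subr_ge0// => hk Ek; split.
  by have := EaS k; have := El k.+1; move: Ek t2; clear; lra.
move=> l kl; have := El l; have := h0 l.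
have -> : 2^-1 ^+ l = e l - E l by rewrite /E opprB addrCA subrr addr0.
have : 2^-1 ^+ l <= 2^-1 ^+ k :> R.
  by rewrite ler_wiXn2l// invf_le1 ?ler1n.
move: hk Ek; rewrite /E; move: (limn _) (2^-1 ^+ l) (2^-1 ^+ k) (e k) (e l); clear => *; lra.
Qed.

(* Monotone convergence: the sum of the F_j is integrable, hence finite a.e. *)
Lemma ae_bounded_terms (F : nat -> T -> R) :
  (forall j, cbm (F j)) -> (forall j z, 0 <= F j z) ->
  (forall j, \int[leb3 R]_z F j z <= 2^-1 ^+ j) ->
  {ae leb3 R, forall z, exists M, forall j, F j z <= M}.
Proof.
move=> cF F0 FI.
have mF j : measurable_fun setT (fun z : T3 => (F j z)%:E).
  by apply/measurable_EFinP; case: (cF j).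
have F0' j (z : T3) : setT z -> (0 <= (F j z)%:E)%E by rewrite lee_fin.
have IE j : (\int[leb3 R]_(z in setT) (F j z)%:E = (\int[leb3 R]_z F j z)%:E)%E.
  rewrite /Rintegral fineK//; exact: integrable_fin_num (integrable3 (cF j)).
have S2 : (\int[leb3 R]_(z in setT) (\sum_(j <oo) (F j z)%:E) < +oo)%E.
  rewrite integral_nneseries//.
  apply: (@le_lt_trans _ _ (2%:E)); last exact: ltry.
  apply: lime_le.
    by apply: is_cvg_nneseries => j _ _; rewrite IE lee_fin Rintegral_ge0.
  apply: nearW => n; rewrite (eq_bigr (fun j => (\int[leb3 R]_z F j z)%:E)); last by move=> j _;
    exact: IE.
  rewrite sumEFin lee_fin.
  apply: (@le_trans _ _ (\sum_(0 <= j < n) 2^-1 ^+ j)); first exact: ler_sum.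
  suff -> : \sum_(0 <= j < n) 2^-1 ^+ j = 2 - 2 * 2^-1 ^+ n :> R.
    by rewrite gerBl mulr_ge0// exprn_ge0.
  elim: n => [|n ih]; first by rewrite big_nil expr0 mulr1 subrr.
  by rewrite big_nat_recr//= ih exprS mulrA divff// mul1r; ring.
have mS : measurable_fun setT (fun z : T3 => \sum_(j <oo) (F j z)%:E)%E.
  by apply: ge0_emeasurable_sum => // j z _ _; rewrite lee_fin.
have iS : (leb3 R).-integrable setT (fun z : T3 => \sum_(j <oo) (F j z)%:E)%E.
  apply/integrableP; split => //.
  under eq_integral => z _.
    rewrite gee0_abs; first over.
    by apply: nneseries_ge0 => j _ _; rewrite lee_fin.
  exact: S2.
have [N [mN N0 NP]] := integrable_ae measurableT iS.
exists N; split => // z nz; apply: NP => /= /(_ I) fz; apply: nz.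
exists (fine (\sum_(j <oo) (F j z)%:E)%E) => j; rewrite -lee_fin fineK//.
apply: le_trans (nneseries_lim_ge j.+1 _) => /=.
  by rewrite big_nat_recr//= leeDr// sume_ge0// => i _; rewrite lee_fin.
by move=> i _ _; rewrite lee_fin.
Qed.

Lemma geometric_increments_cvg (f : nat -> R) M :
  (forall j, `|f j.+1 - f j| <= M * 2^-1 ^+ j) -> cvgn f.
Proof.
move=> fM; have M0 : 0 <= M by have := le_trans (normr_ge0 _) (fM 0%N); rewrite expr0 mulr1.
have /normed_cvg cs : cvgn [normed series (fun j => f j.+1 - f j)].
  apply: series_le_cvg (is_cvg_geometric_series (a := M) (z := 2^-1) _) => //.
  - by move=> n; exact: normr_ge0.
  - by move=> n; apply: mulr_ge0 => //; rewrite exprn_ge0.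
  - by rewrite ger0_norm// invf_lt1 ?ltr1n.
have -> : f = (fun n => series (fun j => f j.+1 - f j) n + f 0%N).
  by apply/funext => n; rewrite /series /= telescope_sumr// subrK.
by apply: is_cvgD => //; exact: is_cvg_cst.
Qed.

End WeakLinear.

Section WildLimit.
Context (R : realType).
Local Notation T := (R * (R * R))%type.
Local Notation T1 := (measurableTypeR R).
Local Notation T3 := (T1 * (T1 * T1))%type.
Implicit Types (w V : nat -> T -> R) (z : T).
Variable o : nat -> R.
Local Notation Q := (@hcell_ind R 1 o).

(** In the cell this says u = v (x) v - I: the entry - f = v2^2 - 1 follows from |v|^2 = 2. The
    relations hold at every point, so the pointwise algebra with the background has no exceptional
    set. *)
Definition wild V := [/\ forall i, (i < 4)%N -> cbm (V i),
  forall z, V 0%N z ^+ 2 + V 1%N z ^+ 2 = 2 * Q z,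
  forall z, V 2%N z = V 0%N z ^+ 2 - Q z /\ V 3%N z = V 0%N z * V 1%N z & weak_linsol V].

Lemma hcell_far z : cell_radius 1 o < `|z| -> ~~ in_hcell 1 o z.
Proof.
apply: contraTN => /in_hcellP zi; rewrite -leNgt; apply: cell_radius_closed => // i i3.
by have /andP[-> /ltW ->] := zi i i3.
Qed.

Lemma subsol_posdef w z : subsol o w -> posdef 0 (w ^~ z).
Proof. by move=> [_ _ _ [d d0 /(_ z)]]; apply: posdef_le; exact: ltW. Qed.

Lemma subsol_bound w z i : subsol o w -> (i < 4)%N -> `|w i z| <= 8.
Proof.
move=> sw; have pw := subsol_posdef z sw.
have [a0 a1 /andP[d0 d2]] := posdef_bound pw; have [b2 b3] := posdef_stress pw.
have p01 : `|w 0%N z * w 1%N z| <= 4.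
  by rewrite normrM (_ : 4 = 2 * 2 :> R) ?ler_pM// -natrM.
have p0 : `|w 0%N z ^+ 2| <= 4.
  by rewrite normrX (_ : 4 = 2 ^+ 2 :> R) ?lerXn2r ?nnegrE// -natrX.
move: a0 a1 d0 d2 b2 b3 p01 p0; move: (deficit _) => D.
case: i => [|[|[|[|]]]]//= a0 a1 d0 d2 b2 b3 p01 p0 _; clear -a0 a1 d0 d2 b2 b3 p01 p0.
- lra.
- lra.
- rewrite (_ : w 2%N z = (1 + w 2%N z - w 0%N z ^+ 2) + w 0%N z ^+ 2 - 1); last by ring.
  by have := ler_normB (1 + w 2%N z - w 0%N z ^+ 2 + w 0%N z ^+ 2) 1;
    have := ler_normD (1 + w 2%N z - w 0%N z ^+ 2) (w 0%N z ^+ 2); rewrite normr1; lra.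
- rewrite (_ : w 3%N z = (w 3%N z - w 0%N z * w 1%N z) + w 0%N z * w 1%N z); last by ring.
  by have := ler_normD (w 3%N z - w 0%N z * w 1%N z) (w 0%N z * w 1%N z); lra.
Qed.

Lemma cvg_const (f : nat -> R) (a : R) : (forall j, f j = a) -> f @ \oo --> a.
Proof. by move=> fa; rewrite (_ : f = cst a); [exact: cvg_cst|exact/funext]. Qed.

Lemma squeeze0_cvg (f g h : nat -> R) (a : R) : (forall j, `|f j - g j| <= h j) ->
  h @ \oo --> 0 -> g @ \oo --> a -> f @ \oo --> a.
Proof.
move=> fgh h0 ga; rewrite -[a]addr0 (_ : f = (fun j => g j + (f j - g j))); last first.
  by apply/funext => j; rewrite addrC subrK.
apply: cvgD => //; apply: (@norm_cvg0 _ _ _ \oo).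
apply: (@squeeze_cvgr _ _ _ _ (cst 0) h) => //; last exact: cvg_cst.
by apply: nearW => j; rewrite normr_ge0/= fgh.
Qed.

(** The linear equations pass to the limit by dominated convergence. The nonlinear relation does
    too, because the deficit bounds the distance of u from v (x) v - I at each point. *)
Lemma wild_limit (W : nat -> nat -> T -> R) (N : set T3) :
  (forall j, subsol o (W j)) -> measurable N -> leb3 R N = 0%E ->
  (forall z, ~ N z -> [/\ cvgn (fun j => W j 0%N z), cvgn (fun j => W j 1%N z) &
     (fun j => deficit ((W j) ^~ z) * Q z) @ \oo --> 0]) ->
  exists2 V, wild V & forall g, lbm g.1 -> lbm g.2 ->
    (fun j => \int[leb3 R]_z pairing g (W j) z) @ \oo --> \int[leb3 R]_z pairing g V z.
Proof.
move=> sW mN N0 cW.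
(* On N both components are 1, so that |V|^2 = 2 everywhere in the cell. *)
pose u i z : R := if z \in N then Q z else limn (fun j => W j i z).
pose V (i : nat) z : R := match i with 0 => u 0%N z | 1 => u 1%N z
  | 2 => u 0%N z ^+ 2 - Q z | _ => u 0%N z * u 1%N z end.
have cu i z : (i < 2)%N -> ~ N z -> (fun j => W j i z) @ \oo --> u i z.
  by rewrite /u => i2 nz; rewrite memNset//; case: i i2 (cW z nz) => [|[|]]// _ [].
have W0 j i z : ~~ in_hcell 1 o z -> W j i z = 0.
  by have [_ _ h _] := sW j; exact: h.
have Q01 z : Q z = 1 /\ in_hcell 1 o z \/ Q z = 0 /\ ~~ in_hcell 1 o z.
  by rewrite /hcell_ind; case: in_hcell; [left|right].
have ec z : V 0%N z ^+ 2 + V 1%N z ^+ 2 = 2 * Q z.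
  rewrite /V; have [zN|zN] := pselect (N z).
    rewrite /u !mem_set//; case: (Q01 z) => -[-> _]; first by rewrite expr1n mulr1.
    by rewrite expr0n mulr0 addr0.
  have c2 : (fun j => W j 0%N z ^+ 2 + W j 1%N z ^+ 2) @ \oo --> u 0%N z ^+ 2 + u 1%N z ^+ 2.
    by rewrite !expr2; apply: cvgD; apply: cvgM; exact: cu.
  apply: (cvg_unique (@Rhausdorff R) c2).
  have [_ _ dW] := cW z zN.
  case: (Q01 z) => -[Qz zi]; last first.
    by apply: cvg_const => j; rewrite !W0// expr0n addr0 Qz mulr0.
  apply: (@squeeze0_cvg _ (cst 2) (fun j => deficit ((W j) ^~ z) * Q z)) => //; last first.
    by rewrite Qz mulr1; exact: cvg_cst.
  move=> j; rewrite Qz mulr1 /= distrC /deficit opprD addrA ger0_norm//.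
  by have [_ _ /andP[]] := posdef_bound (subsol_posdef z (sW j)).
have cV i z : (i < 4)%N -> ~ N z -> (fun j => W j i z) @ \oo --> V i z.
  move=> i4 zN; have c0 := cu 0%N z isT zN; have c1 := cu 1%N z isT zN.
  have [_ _ dW] := cW z zN.
  have st j := posdef_stress (subsol_posdef z (sW j)).
  have u0 : ~~ in_hcell 1 o z -> u 0%N z = 0.
    move=> zi; apply: (cvg_unique (@Rhausdorff R) c0); apply: cvg_const => j; exact: W0.
  case: i i4 => [|[|[|[|]]]]// _.
  - case: (Q01 z) => -[Qz zi].
      apply: (@squeeze0_cvg _ (fun j => W j 0%N z ^+ 2 - Q z)
        (fun j => deficit ((W j) ^~ z) * Q z)) => //; last first.
        by rewrite /V expr2; apply: cvgB; [exact: cvgM|exact: cvg_cst].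
      move=> j; rewrite Qz mulr1 opprB addrCA addrA; exact: (st j).1.
    rewrite /V Qz subr0 u0 ?expr0n//; apply: cvg_const => j; exact: W0.
  - case: (Q01 z) => -[Qz zi].
      apply: (@squeeze0_cvg _ (fun j => W j 0%N z * W j 1%N z)
        (fun j => deficit ((W j) ^~ z) * Q z)) => //; last exact: cvgM.
      by move=> j; rewrite Qz mulr1; have [_] := st j.
    rewrite /V u0 ?mul0r//; apply: cvg_const => j; exact: W0.
have mu i : (i < 2)%N -> measurable_fun setT (u i : T3 -> R).
  move=> i2; have [mQ _] := cbm_hcell_ind o (@ltr01 R).
  apply: (@measurable_fun_cvg _ _ _ _ (fun j (z : T3) => W j i z * \1_(~` N) z + Q z * \1_N z)).
    move=> j; have [_ cWj _ _] := sW j; have [mWj _] := cWj i.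
    apply: measurable_funD; apply: measurable_funM => //; apply: measurable_indic => //.
    exact: measurableC.
  move=> z _; rewrite /u; have [zN|zN] := pselect (N z).
    by apply: cvg_const => j; rewrite !indicE in_setC mem_set// mulr0 add0r mulr1.
  rewrite (_ : (fun j => _) = (fun j => W j i z)); last first.
    by apply/funext => j; rewrite !indicE in_setC memNset// mulr0 addr0 mulr1.
  by have := cu i z i2 zN; rewrite /u memNset.
have cu' i : (i < 2)%N -> cbm (u i).
  move=> i2; split; first exact: mu.
  exists 2, (cell_radius 1 o) => z.
  have u2 : u i z ^+ 2 <= 2 * Q z.
    by case: i i2 => [|[|]]// _; rewrite -ec /V ?lerDl ?lerDr sqr_ge0.
  split.
    rewrite ler_norml; case: (Q01 z) u2 => -[-> _]; move: (u i z); clear => a ?; nra.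
  move=> /hcell_far zn; move: u2; rewrite /hcell_ind (negbTE zn) mulr0 => u2.
  by apply/eqP; rewrite -sqrf_eq0 eq_le u2 sqr_ge0.
have bV i : (i < 4)%N -> cbm (V i).
  have cQ := cbm_hcell_ind o (@ltr01 R).
  have [c0 c1] := (cu' 0%N isT, cu' 1%N isT).
  case: i => [|[|[|[|]]]]// _.
  - by apply: cbmB => //; exact: cbm_sqr.
  - by apply: cbmMl => //; exact: cbm_lbm.
have lim i h : (i < 4)%N -> lbm h ->
    (fun j => \int[leb3 R]_z (W j i z * h z)) @ \oo --> \int[leb3 R]_z (V i z * h z).
  move=> i4 lh; have [mh bh] := lh; have [C hC] := bh (cell_radius 1 o).
  apply: (@Rint3_dominated _ _ _ (8 * `|C|) (cell_radius 1 o)).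
  - by move=> j; have [_ cWj _ _] := sW j; have [mWj _] := cWj i; exact: measurable_funM.
  - by apply: measurable_funM => //; case: (bV i i4).
  - move=> j z; have [zr|/hcell_far zn] := leP `|z| (cell_radius 1 o); last first.
      by rewrite W0// mul0r normr0 mulr_ge0.
    rewrite normrM ler_pM//; first exact: (subsol_bound z (sW j) i4).
    exact: le_trans (hC z zr) (ler_norm C).
  - by move=> j z /hcell_far zn; rewrite W0// mul0r.
  - exists N; split => // z /= nz; apply: contrapT => zN; apply: nz.
    by apply: cvgM; [exact: cV|exact: cvg_cst].
exists V.
  split => //.
  move=> psi tpsi.
  have lD j : lbm (Dax j psi) by have [_ _ _ cD _] := test_Dax j tpsi; exact: continuous_lbm.
  have wk j : weak_linsol (W j) by have [lj cj _ _] := sW j; exact: linsol_weak.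
  have cst0 (f : nat -> R) a : (forall j, f j = 0) -> f @ \oo --> a -> a = 0.
    move=> f0 fa; apply: (cvg_unique (@Rhausdorff R) fa).
    exact: cvg_const.
  split.
  - apply: (cst0 _ _ _ (cvgD (lim 0%N _ isT (lD 1%N)) (lim 1%N _ isT (lD 2%N)))) => j.
    by case: (wk j psi tpsi).
  - apply: (cst0 _ _ _ (cvgD (cvgD (lim 0%N _ isT (lD 0%N)) (lim 2%N _ isT (lD 1%N)))
      (lim 3%N _ isT (lD 2%N)))) => j.
    by case: (wk j psi tpsi).
  - apply: (cst0 _ _ _ (cvgB (cvgD (lim 1%N _ isT (lD 0%N)) (lim 3%N _ isT (lD 1%N)))
      (lim 2%N _ isT (lD 2%N)))) => j.
    by case: (wk j psi tpsi).
move=> g lg1 lg2.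
have E w : cbm (w 0%N) -> cbm (w 1%N) -> \int[leb3 R]_z pairing g w z =
    \int[leb3 R]_z (w 0%N z * g.1 z) + \int[leb3 R]_z (w 1%N z * g.2 z).
  move=> c0 c1; rewrite -RintD3//; try exact: cbmMr.
  by apply: eq_Rintegral => z _; rewrite /pairing mulrC [_ * w _ _]mulrC.
rewrite E; [|exact: (bV 0%N isT)|exact: (bV 1%N isT)].
rewrite (_ : (fun j => _) = (fun j => \int[leb3 R]_z (W j 0%N z * g.1 z) +
   \int[leb3 R]_z (W j 1%N z * g.2 z))).
  by apply: cvgD; exact: lim.
by apply/funext => j; have [_ cj _ _] := sW j; exact: E.
Qed.

End WildLimit.

(** * Strong convergence of the iteration *)

Section WildExists.
Context (R : realType).
Local Notation T := (R * (R * R))%type.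
Local Notation field := (nat -> T -> R).
Local Notation half k := ((2^-1 : R) ^+ k).
Implicit Types (w V : field) (z : T).

Definition vel w : (T -> R) * (T -> R) := (w 0%N, w 1%N).

Lemma telescope_half (f : nat -> R) m k : 0 <= m ->
  (forall i, (k <= i)%N -> `|f i.+1 - f i| <= m * half i.+1) ->
  forall l, (k <= l)%N -> `|f l - f k| <= m * half k.
Proof.
move=> m0 fi l kl; rewrite -(subnKC kl); move: (l - k)%N => {kl} d.
suff : `|f (k + d)%N - f k| <= m * (half k - half (k + d)).
  by move=> h; apply: le_trans h _; rewrite ler_wpM2l// gerBl exprn_ge0.
elim: d => [|d ih]; first by rewrite addn0 !subrr normr0 mulr0.
rewrite addnS -(subrKA (f (k + d)%N)) (le_trans (ler_normD _ _))//.
have -> : m * (half k - half (k + d).+1) = m * half (k + d).+1 + m * (half k - half (k + d)).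
  have hS : half (k + d) = 2 * half (k + d).+1 by rewrite exprS mulrA divff ?mul1r.
  by rewrite hS; ring.
by apply: lerD => //; apply: fi; rewrite leq_addr.
Qed.

Lemma pairing_sub g w w' : lbm g.1 -> lbm g.2 -> (forall i, cbm (w i)) -> (forall i, cbm (w' i)) ->
  \int[leb3 R]_z pairing g (fun i z => w' i z - w i z) z =
  \int[leb3 R]_z pairing g w' z - \int[leb3 R]_z pairing g w z.
Proof.
move=> l1 l2 cw cw'; rewrite -RintB3//; try by apply: cbmD; exact: cbmMl.
by apply: eq_Rintegral => z _; rewrite /pairing; ring.
Qed.

(** Near orthogonality of w and w' - w turns convergence of the energies into convergence in L^2. *)
Lemma esq_sub w w' : (forall i, cbm (w i)) -> (forall i, cbm (w' i)) ->
  \int[leb3 R]_z esq (fun i z => w' i z - w i z) z =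
  \int[leb3 R]_z esq w' z - \int[leb3 R]_z esq w z
  - 2 * (\int[leb3 R]_z pairing (vel w) w' z - \int[leb3 R]_z pairing (vel w) w z).
Proof.
move=> cw cw'; have lw i : lbm (w i) by exact: cbm_lbm.
have cp u : (forall i, cbm (u i)) -> cbm (pairing (vel w) u) 
  by move=> cu; exact: (cbmD (cbmMl (lw 0%N) (cu 0%N)) (cbmMl (lw 1%N) (cu 1%N))).
rewrite -RintB3//; [|exact: cbm_esq|exact: cbm_esq].
rewrite -RintB3//; [|exact: cp|exact: cp].
rewrite -RintZ3//; last by apply: cbmB; exact: cp.
rewrite -RintB3//; [|by apply: cbmB; exact: cbm_esq|]; last first.
  by apply: cbmMl; [exact: lbm_cst|apply: cbmB; exact: cp].
by apply: eq_Rintegral => z _; rewrite /esq /pairing /=; ring.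
Qed.

Local Notation gain o w := (\int[leb3 R]_z (deficit (w ^~ z) ^+ 2 * hcell_ind 1 o z)).

(** Since each increment must be nearly orthogonal to all earlier velocities, the recursion runs on
    the list of all fields so far, newest first, and [grid_step] is tested against the whole
    list. *)
Lemma subsol_sequence (o : nat -> R) (w0 : field) (g : (T -> R) * (T -> R)) (m : R) :
  subsol o w0 -> continuous g.1 -> continuous g.2 -> 0 < m -> m <= 1 -> exists w : nat -> field,
  [/\ w 0%N = w0, forall k, subsol o (w k),
    forall k, \int[leb3 R]_z esq (w k) z + gain o (w k) / 128 - half k.+1
      <= \int[leb3 R]_z esq (w k.+1) z,
    forall j k, (j <= k)%N -> `|\int[leb3 R]_z pairing (vel (w j)) (w k.+1) z -
      \int[leb3 R]_z pairing (vel (w j)) (w k) z| <= m * half k.+1 &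
    forall k, `|\int[leb3 R]_z pairing g (w k.+1) z - \int[leb3 R]_z pairing g (w k) z|
      <= m * half k.+1].
Proof.
move=> sw0 cg1 cg2 m0 m1.
have mh k : 0 < m * half k by rewrite mulr_gt0// exprn_gt0.
have cont w i : subsol o w -> (i < 2)%N -> continuous (w i).
  by move=> [[C1 _] _ _ _] i2; have [] := C1 i (leq_trans i2 (isT : 2 <= 4)%N).
(* The premises make [P l] trivial for lists that never occur, so that [choice] yields a total step
   function. *)
pose P (l : seq field) w' := (forall u, u \in l -> subsol o u) -> l != [::] ->
  [/\ subsol o w',
   \int[leb3 R]_z esq (head w0 l) z + gain o (head w0 l) / 128 - m * half (size l)
     <= \int[leb3 R]_z esq w' z &
   forall h, h \in g :: [seq vel u | u <- l] ->
     `|\int[leb3 R]_z pairing h (fun i z => w' i z - head w0 l i z) z| <= m * half (size l)].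
have [F HF] : {F : seq field -> field & forall l, P l (F l)}.
  apply: choice => l; have [sl|nsl] := pselect (forall u, u \in l -> subsol o u); last first.
    by exists w0 => /nsl.
  have [l0|l0] := eqVneq l [::]; first by exists w0 => _; rewrite l0.
  have sh : subsol o (head w0 l).
    by move: (sl (head w0 l)); apply; case: l l0 {sl} => //= a l _; rewrite mem_head.
  have [|w' [? ? ?]] := grid_step (gs := g :: [seq vel u | u <- l]) sh _ (mh (size l)).
    move=> h; rewrite inE => /orP[/eqP->//|/mapP[u ul ->]].
    by split; apply: cont => //; exact: sl.
  by exists w' => _ _; split.
pose L k := iter k (fun l => F l :: l) [:: w0].
pose w k := head w0 (L k).
have sL k : size (L k) = k.+1 by elim: k => //= k ->.
have L0 k : L k != [::] by rewrite -size_eq0 sL.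
have LS k u : u \in L k -> subsol o u.
  elim: k u => [u|k ih u]; first by rewrite inE => /eqP->.
  by rewrite [L _]/= inE => /orP[/eqP->|/ih//]; have [] := HF _ ih (L0 k).
have wL j k : (j <= k)%N -> w j \in L k.
  move=> /subnKC <-; elim: (k - j)%N => [|d ih].
    by rewrite addn0 /w; case: (L j) (L0 j) => //= a l _; rewrite mem_head.
  by rewrite addnS /= inE ih orbT.
have sw k : subsol o (w k) by apply: (LS k); exact: wL.
have st k := HF _ (LS k) (L0 k).
have pS h k : lbm h.1 -> lbm h.2 -> h \in g :: [seq vel u | u <- L k] ->
    `|\int[leb3 R]_z pairing h (w k.+1) z - \int[leb3 R]_z pairing h (w k) z| <= m * half k.+1.
  move=> l1 l2 hL; have [_ _ /(_ h hL)] := st k; rewrite sL.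
  by rewrite pairing_sub//; [have [] := sw k|have [] := sw k.+1].
exists w; split => //.
- move=> k; have [_ + _] := st k; rewrite sL; apply: le_trans.
  by rewrite lerD2l lerN2 ler_piMl// exprn_ge0.
- move=> j k jk; apply: pS; try by apply/continuous_lbm/cont.
  by rewrite inE map_f ?orbT// wL.
- by move=> k; apply: pS; [exact: continuous_lbm|exact: continuous_lbm|rewrite mem_head].
Qed.

Lemma subsol_esq (o : nat -> R) w : subsol o w ->
  \int[leb3 R]_z esq w z <= 2 * \int[leb3 R]_z hcell_ind 1 o z.
Proof.
move=> sw; have [_ cw w0' _] := sw; have cQ := cbm_hcell_ind o (@ltr01 R).
rewrite -RintZ3//; apply: cbm_le; [exact: cbm_esq|by apply: cbmMl => //; exact: lbm_cst|].
move=> z; have [_ _ /andP[d0 _]] := posdef_bound (subsol_posdef z sw).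
have [zi|zi] := boolP (in_hcell 1 o z); last by rewrite /esq !w0'// expr0n addr0 mulr_ge0 ?ler0n.
rewrite /hcell_ind zi mulr1; move: d0; rewrite /deficit /esq.
by move: (w 0%N z) (w 1%N z); clear => a b; lra.
Qed.

(** The pairing with g drifts in total by at most m times the sum of the 2^-(k+1), that is by m <=
    eta: the limit remembers its starting subsolution. *)
Lemma wild_exists (o : nat -> R) (w0 : field) (g : (T -> R) * (T -> R)) (eta : R) :
  subsol o w0 -> continuous g.1 -> continuous g.2 -> 0 < eta -> exists2 V, wild o V &
  `|\int[leb3 R]_z pairing g V z - \int[leb3 R]_z pairing g w0 z| <= eta.
Proof.
move=> sw0 cg1 cg2 eta0; pose Q := @hcell_ind R 1 o; pose m := Num.min 1 eta.
have m0 : 0 < m by rewrite /m lt_min ltr01 eta0.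
have m1 : m <= 1 by rewrite /m ge_min lexx.
have meta : m <= eta by rewrite /m ge_min lexx orbT.
have [w [w00 sw gw pw gg]] := subsol_sequence sw0 cg1 cg2 m0 m1.
have cw k i : cbm (w k i) by have [] := sw k.
have cQ := cbm_hcell_ind o (@ltr01 R).
(* Against the weight 4^j / 2 in [F], two errors of size 8^-j leave an integral of at most 2^-j.
   Where the [F j] are bounded, increments and deficits are then of order 2^-j. *)
pose tol j : R := 8^-1 ^+ j.
have tol0 j : 0 < tol j by rewrite exprn_gt0// invr_gt0 ltr0n.
have gain0 k : 0 <= gain o (w k) / 128.
  apply: divr_ge0 => //; apply: Rintegral_ge0 => z _.
  by rewrite mulr_ge0 ?sqr_ge0 ?ler0n.
have cau := almost_increasing_cauchy gain0 (fun k => subsol_esq (sw k)) gw.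
have wk1 : (fun k => half k) @ \oo --> 0.
  by apply: cvg_expr; rewrite ger0_norm// invf_lt1 ?ltr1n.
pose P j n := forall k, (n <= k)%N -> gain o (w k) <= tol j /\
  forall l, (k <= l)%N -> \int[leb3 R]_z esq (fun i z => w l i z - w k i z) z <= tol j.
have [n hn] : {n : nat -> nat & forall j, P j (n j)}.
  (* The divisor 128 undoes the factor of the gain and leaves room for the L^2 distance, which is at
     most 3 tol / 128: one part from the energies and two from the pairing. *)
  apply: choice => j; have t3 : 0 < tol j / 128.
    have p128 : 0 < 128 :> R by rewrite ltr0n.
    exact: divr_gt0 (tol0 j) p128.
  have [n1 hn1] := cau _ t3.
  have /cvgrPdist_lt/(_ _ t3)[n2 _ hn2] := wk1.
  exists (maxn n1 n2) => k; rewrite geq_max => /andP[kn1 kn2].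
  have [g1 e1] := hn1 k kn1; split.
    by move: g1; rewrite ler_pM2r// invr_gt0 ltr0n.
  move=> l kl; rewrite esq_sub//.
  have := telescope_half (ltW m0) (fun i => @pw k i) kl.
  rewrite ler_norml => /andP[p1 _].
  have := e1 l kl; have := hn2 k kn2; rewrite /= sub0r normrN ger0_norm ?exprn_ge0// => h1 h2.
  have h0 : 0 <= half k by rewrite exprn_ge0.
  have hm : m * half k <= half k by rewrite ler_piMl.
  by move: p1 h1 h2 hm (tol0 j); clear; lra.
(* Partial sums make the index nondecreasing and at least [n j]. *)
pose phi j := (\sum_(i < j.+1) n i)%N.
have phiS j : (phi j <= phi j.+1)%N by rewrite /phi [X in (_ <= X)%N]big_ord_recr leq_addr.
have phin j : (n j <= phi j)%N by rewrite /phi big_ord_recr leq_addl.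
pose W j := w (phi j).
pose D j := esq (fun i z => W j.+1 i z - W j i z).
pose G j z := deficit ((W j) ^~ z) ^+ 2 * Q z.
have cD j : cbm (D j) by apply: cbm_esq => i; exact: (cbmB (cw _ i) (cw _ i)).
have cG j : cbm (G j).
  apply: cbmMl => //; apply/lbmX/lbmB; [apply/lbmB; first exact: lbm_cst|];
    by apply: lbmX; exact: cbm_lbm (cw _ _).
pose F j z := 4 ^+ j / 2 * (D j z + G j z).
have D0 j z : 0 <= D j z by rewrite addr_ge0// sqr_ge0.
have G0 j z : 0 <= G j z by rewrite mulr_ge0 ?sqr_ge0// ler0n.
have p4 j : 0 < 4 ^+ j / 2 :> R by rewrite divr_gt0// exprn_gt0// ltr0n.
have F0 j z : 0 <= F j z by exact: mulr_ge0 (ltW (p4 j)) (addr_ge0 (D0 j z) (G0 j z)).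
have cF j : cbm (F j) by apply: cbmMl; [exact: lbm_cst|exact: cbmD].
have IF j : \int[leb3 R]_z F j z <= half j.
  rewrite RintZ3//; last exact: cbmD.
  rewrite RintD3//; have [gj Dj] := hn j (phi j) (phin j).
  have -> : half j = 4 ^+ j / 2 * (tol j + tol j).
    rewrite /tol (_ : 2^-1 = 4 * 8^-1 :> R) ?exprMn; first by field.
    by field.
  by rewrite ler_pM2l// lerD// Dj.
have [N [mN N0 NF]] := ae_bounded_terms cF F0 IF.
have small (a M : R) j : 4 ^+ j / 2 * a ^+ 2 <= M -> `|a| <= (2 * M + 1) * half j.
  have h0 : 0 < half j by rewrite exprn_gt0.
  have ph : 4 ^+ j * half j ^+ 2 = 1 :> R.
    by rewrite -exprM mulnC exprM -exprMn (_ : 4 * _ = 1) ?expr1n//; field.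
  move: ph h0 (p4 j); move: (4 ^+ j) (half j); clear => p h ph h0 p0 aM.
  have M0 : 0 <= M by apply: le_trans aM; rewrite mulr_ge0 ?sqr_ge0// ltW.
  have hh0 : 0 <= h ^+ 2 by rewrite sqr_ge0.
  have a2 : a ^+ 2 <= 2 * M * h ^+ 2.
    have -> : a ^+ 2 = p * h ^+ 2 * a ^+ 2 by rewrite ph mul1r.
    by have := ler_wpM2r hh0 aM; lra.
  have Mh : 0 <= M * h ^+ 2 by rewrite mulr_ge0.
  have MMh : 0 <= M ^+ 2 * h ^+ 2 by rewrite mulr_ge0// sqr_ge0.
  rewrite -(ler_pXn2r (n := 2))// ?nnegrE//; last by rewrite mulr_ge0 ?(ltW h0)//; lra.
  by rewrite -normrX ger0_norm ?sqr_ge0// exprMn; lra.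
have [|V wV cV] := @wild_limit R o W N (fun j => sw _) mN N0.
  move=> z zN; have [M FM] : exists M, forall j, F j z <= M.
    by apply: contrapT => nz; apply: zN; exact: NF.
  have FD j a : a ^+ 2 <= D j z + G j z -> `|a| <= (2 * M + 1) * half j.
    by move=> aD; apply: small; apply: le_trans (FM j); rewrite /F ler_pM2l.
  have incr i : (i < 2)%N -> cvgn (fun j => W j i z).
    move=> i2; apply: (@geometric_increments_cvg _ _ (2 * M + 1)) => j; apply: FD.
    have := G0 j z; rewrite /D /esq.
    case: i i2 => [|[|]]// _ h.
      by rewrite -addrA lerDl addr_ge0// sqr_ge0.
    by rewrite [leRHS]addrAC lerDr addr_ge0// sqr_ge0.
  split; [exact: incr|exact: incr|].
  apply: (@squeeze0_cvg _ _ (cst 0) (fun j => (2 * M + 1) * half j)); last exact: cvg_cst.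
    move=> j; rewrite subr0; apply: FD; rewrite exprMn -/(G j z).
    have -> : Q z ^+ 2 = Q z by rewrite /Q /hcell_ind; case: (in_hcell _ _ _);
      rewrite ?expr1n// expr0n.
    by rewrite -/(G j z) lerDr.
  by rewrite -[X in _ --> X](mulr0 (2 * M + 1)); apply: cvgM => //; exact: cvg_cst.
exists V => //.
have cg := cV g (continuous_lbm cg1) (continuous_lbm cg2).
pose c := \int[leb3 R]_z pairing g w0 z.
have c2 : (fun j => `|\int[leb3 R]_z pairing g (W j) z - c| : R) @ \oo -->
    (`|\int[leb3 R]_z pairing g V z - c| : R).
  by apply: cvg_norm; apply: cvgB => //; exact: cvg_const.
have c3 : (fun _ : nat => eta) @ \oo --> eta by exact: cvg_const.
apply: (ler_cvg_to c2 c3); apply: nearW => j /=; apply: le_trans meta.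
have := telescope_half (ltW m0) (fun i _ => gg i) (leq0n (phi j)).
by rewrite expr0 mulr1 w00.
Qed.

End WildExists.

(** * Two different wild fields in one cell *)

Section TwoWild.
Context (R : realType).
Local Notation T := (R * (R * R))%type.
Local Notation T1 := (measurableTypeR R).
Local Notation T3 := (T1 * (T1 * T1))%type.
Local Notation field := (nat -> T -> R).
Implicit Types (w V : field) (z : T) (o : nat -> R).

Lemma measure_box3 (a b c d : R) : 0 < d ->
  leb3 R (`[a, a + d]%classic `*` (`[b, b + d]%classic `*` `[c, c + d]%classic)) = (d ^+ 3)%:E.
Proof.
move=> d0.
have L (x : R) : lebesgue_measure (`[x, x + d]%classic : set R) = d%:E.
  by rewrite lebesgue_measure_itv/= lte_fin ltrDl d0 -EFinB addrC addKr.
have L2 : leb2 R (`[b, b + d]%classic `*` `[c, c + d]%classic) = (d * d)%:E.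
  rewrite /leb2 product_measure1E// EFinM.
  by congr (_ * _)%E; exact: L.
rewrite /leb3 product_measure1E//; last exact: measurableX.
rewrite (_ : d ^+ 3 = d * (d * d)); last by rewrite !exprS expr0 mulr1.
by rewrite EFinM; congr (_ * _)%E; [exact: L|exact: L2].
Qed.

Lemma Rint_hcell_gt0 o : 0 < \int[leb3 R]_z hcell_ind 1 o z.
Proof.
(* From the corner p of the slanted cell, a box of side 1 / 8 parallel to the axes is placed inside
   the cell. *)
pose p := gpoint o 1 (0%N, 0%N, 0%N); pose d : R := 1 / 8.
have d0 : 0 < d by rewrite divr_gt0// ltr0n.
pose t := p.1 + 1 / 8; pose x := p.2.1 - 1 / 16; pose y := p.2.2 + 1 / 8.
pose B : set T3 := `[t, t + d]%classic `*` (`[x, x + d]%classic `*` `[y, y + d]%classic).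
have mB : measurable B by apply: measurableX => //; exact: measurableX.
have cB : cbm (fun z : T => \1_B z : R).
  split; first exact: measurable_indic.
  exists 1, (Num.max `|t| `|t + d| + Num.max `|x| `|x + d| + Num.max `|y| `|y + d|) => z.
  split; first by rewrite indicE; case: (_ \in _); rewrite ?normr1 ?normr0.
  move=> zr; rewrite indicE memNset// => -[/= zt [/= zx zy]].
  have H (u v : R) : v \in `[u, u + d] -> `|v| <= Num.max `|u| `|u + d|.
    rewrite in_itv /= => /andP[uv vu]; rewrite le_max.
    have [v0|v0] := leP 0 v.
      by rewrite ger0_norm// orbC (le_trans vu) ?ler_norm.
    by rewrite ltr0_norm// -normrN (le_trans _ (ler_norm _))// lerN2.
  move: zr; apply/negP; rewrite -leNgt norm3E !ge_max.
  have := H _ _ zt; have := H _ _ zx; have := H _ _ zy.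
  have N0 (u v : R) : 0 <= Num.max `|u| `|v| by rewrite le_max normr_ge0.
  have := N0 t (t + d); have := N0 x (x + d); have := N0 y (y + d).
  move: (Num.max _ _) (Num.max _ _) (Num.max _ _); clear => a b c *.
  by apply/and3P; split; lra.
apply: (@lt_le_trans _ _ (\int[leb3 R]_z \1_B z)).
  have mBd : leb3 R B = (d ^+ 3)%:E by exact: measure_box3.
  by rewrite /Rintegral integral_indic// setIT [X in fine X]mBd /= exprn_gt0.
apply: cbm_le => //; first exact: cbm_hcell_ind.
move=> z; rewrite indicE; case: (boolP (z \in B)) => [|_]; last exact: ler0n.
rewrite inE => -[/= + [/= + +]]; rewrite !in_itv /= /t /x /y /d /p /gpoint /gcell /= => zt zx zy.
rewrite /hcell_ind (_ : in_hcell 1 o z) //; apply/in_hcellP => i i3.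
have hlf : lf i z - o i = cellf 1 o i z by rewrite /cellf mul1r.
rewrite -hlf; case: i i3 {hlf} => [|[|[|]]]// _; rewrite /lf.
- by apply/andP; split; move: zt zx; clear; lra.
- by apply/andP; split; move: zt zx; clear; lra.
- by apply/andP; split; move: zy; clear; lra.
Qed.

Lemma subsol0 o : subsol o (fun _ _ => 0 : R).
Proof.
split => //; [exact: linsol0|by move=> i; exact: cbm0|].
exists 1 => // z a b; rewrite /quad; lra.
Qed.

(** The zero subsolution and a subsolution S one step away are told apart by the velocity of S: the
    pairings are 0 and the energy E of S, and passing to the limit moves each by at most E / 4. *)
Lemma wild_two o : exists V1 V2 g, [/\ wild o V1, wild o V2, lbm g.1, lbm g.2 &
  \int[leb3 R]_z pairing g V1 z != \int[leb3 R]_z pairing g V2 z].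
Proof.
have mu0 := Rint_hcell_gt0 o; set mu := (X in 0 < X) in mu0.
(* At zero the deficit is 2, so one step gains 4 mu / 128 = mu / 32; the tolerance gives up half of
   it. *)
have h64 : 0 < mu / 64 by apply: divr_gt0 => //; rewrite ltr0n.
have [S [sS eS _]] := grid_step (gs := [::]) (subsol0 o) (fun g => ltac:(by [])) h64.
have E0 : 0 < \int[leb3 R]_z esq S z.
  apply: lt_le_trans eS.
  have -> : \int[leb3 R]_z esq (fun _ _ => 0 : R) z = 0.
    by apply: Rint3_zero => z; rewrite /esq expr0n addr0.
  have -> : \int[leb3 R]_z (deficit ((fun (_ : nat)
    (_ : T) => 0 : R) ^~ z) ^+ 2 * hcell_ind 1 o z) =
      4 * mu.
    rewrite /mu -RintZ3//; last exact: cbm_hcell_ind.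
    apply: eq_Rintegral => z _; congr (_ * _); rewrite /deficit expr0n !subr0.
    by rewrite -natrX.
  by move: mu0; clear; lra.
set E := (X in 0 < X) in E0.
have E4 : 0 < E / 4 by apply: divr_gt0 => //; rewrite ltr0n.
have cS i : (i < 2)%N -> continuous (S i).
  by move=> i2; have [[C1 _] _ _ _] := sS; have [] := C1 i (leq_trans i2 (isT : 2 <= 4)%N).
have [V1 w1 e1] := @wild_exists R o S (vel S) (E / 4) sS (cS 0%N isT) (cS 1%N isT) E4.
have [V2 w2 e2] := @wild_exists R o _ (vel S) (E / 4) (subsol0 o) (cS 0%N isT) (cS 1%N isT) E4.
exists V1, V2, (vel S); split => //; try by apply: continuous_lbm; exact: cS.
have SS : \int[leb3 R]_z pairing (vel S) S z = E.
  by apply: eq_Rintegral => z _; rewrite /pairing /esq /= !expr2.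
have S0 : \int[leb3 R]_z pairing (vel S) (fun _ _ => 0 : R) z = 0.
  by apply: Rint3_zero => z; rewrite /pairing !mulr0 addr0.
move: e1 e2; rewrite SS S0 subr0 !ler_norml => /andP[a1 a2] /andP[b1 b2].
apply/eqP => e12; move: a1 b2; rewrite e12; move: E4; clear; lra.
Qed.

End TwoWild.

(** * Tiling of the wedge *)

Section Tiling.
Context (R : realType).
Local Notation T := (R * (R * R))%type.
Local Notation T1 := (measurableTypeR R).
Local Notation T3 := (T1 * (T1 * T1))%type.
Local Notation field := (nat -> T -> R).
Local Notation cell := (nat * nat * int)%type.
Implicit Types (W : field) (z : T) (c : cell).

Definition off c (i : nat) : R :=
  match i with 0 => c.1.1%:R | 1 => c.1.2%:R | _ => c.2%:~R end.

Definition wedge z : bool := (0 <= lf 0 z) && (0 <= lf 1 z).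

Definition cellof z : cell := (Num.truncn (lf 0 z), Num.truncn (lf 1 z), Num.floor (lf 2 z)).

Lemma in_hcell_off c z : in_hcell 1 (off c) z = wedge z && (cellof z == c).
Proof.
case: c => [[i j] k]; rewrite /in_hcell /cellf /= !mul1r /wedge -!pair_eqE/= /pair_eq/=.
have trunc (x : R) n : (0 <= x - n%:R < 1) = (0 <= x) && (Num.truncn x == n).
  have [x0|x0] := leP 0 x.
    by rewrite truncn_eq// subr_ge0 ltrBlDr -natr1 addrC.
  by rewrite subr_ge0; apply/negP => /andP[/(le_trans (ler0n _ n))]; rewrite leNgt x0.
have flr (x : R) (n : int) : (0 <= x - n%:~R < 1) = (Num.floor x == n).
  by rewrite floor_eq subr_ge0 ltrBlDr intrD addrC.
rewrite trunc trunc flr.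
by case: (0 <= lf 0 z) => //=; case: (0 <= lf 1 z); rewrite /= ?andbA ?andbF.
Qed.

Lemma cells_bound r : exists2 cs : seq cell, uniq cs &
  forall z, `|z| <= r -> wedge z -> cellof z \in cs.
Proof.
have [M M3] : exists M : nat, 3 * r + 3 < M%:R.
  by exists (Num.truncn (3 * r + 3)).+1; exact: truncnS_gt.
exists [seq (p, k) | p <- [seq (i, j) | i <- iota 0 M, j <- iota 0 M],
   k <- [seq n%:Z - M%:Z | n <- iota 0 (M + M)]].
  apply: allpairs_uniq.
  - apply: allpairs_uniq; rewrite ?iota_uniq// => -[? ?] [? ?] _ _ /= [-> ->] //.
  - by rewrite map_inj_uniq ?iota_uniq// => a b /addIr[].
  - by move=> -[? ?] [? ?] _ _ /= [-> ->].
move=> z zr /andP[z0 z1].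
have r0 : 0 <= r by exact: le_trans zr.
move: zr; rewrite norm3E !ge_max => /and3P[+ + +]; rewrite !ler_norml.
move=> /andP[t0 t1] /andP[x0 x1] /andP[y0 y1].
have L (x : R) : 0 <= x -> x <= 3 * r + 3 -> Num.truncn x \in iota 0 M.
  move=> xge xM; rewrite mem_iota add0n /= -(ltr_nat R).
  apply: le_lt_trans M3; apply: le_trans xM.
  by have /andP[] := truncn_itv xge.
apply/allpairsP; exists ((Num.truncn (lf 0 z), Num.truncn (lf 1 z)), Num.floor (lf 2 z)).
split => //.
  apply/allpairsP; exists (Num.truncn (lf 0 z), Num.truncn (lf 1 z)).
  split => //=; apply: L => //; rewrite /lf; move: t0 t1 x0 x1 r0; clear; lra.
have f0 : 0 <= Num.floor (lf 2 z) + M%:Z.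
  rewrite -lerBlDr sub0r floor_ge_int/= /lf intrN; move: y0 M3 r0; rewrite -pmulrn; clear; lra.
have f1 : Num.floor (lf 2 z) < M%:Z.
  by rewrite floor_lt_int /lf /= -pmulrn; move: y1 M3 r0; clear; lra.
apply/mapP; exists `|(Num.floor (lf 2 z) + M%:Z)%R|%N.
  rewrite mem_iota /= add0n -ltz_nat gez0_abs//.
  by rewrite PoszD ltrD2r.
by rewrite gez0_abs// addrK.
Qed.

Lemma weak_linsolD W W' : (forall i, (i < 4)%N -> cbm (W i)) ->
  (forall i, (i < 4)%N -> cbm (W' i)) -> weak_linsol W -> weak_linsol W' ->
  weak_linsol (fun i z => W i z + W' i z).
Proof.
move=> cW cW' wW wW' psi tpsi.
have E i j : (i < 4)%N -> \int[leb3 R]_z ((W i z + W' i z) * Dax j psi z) =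
    \int[leb3 R]_z (W i z * Dax j psi z) + \int[leb3 R]_z (W' i z * Dax j psi z).
  move=> i4; have [_ _ _ cD _] := test_Dax j tpsi; have lD := continuous_lbm cD.
  rewrite -(RintD3 measurableT (cbmMr (cW i i4) lD) (cbmMr (cW' i i4) lD)).
  by apply: eq_Rintegral => z _; rewrite mulrDl.
have [a1 a2 a3] := wW psi tpsi; have [b1 b2 b3] := wW' psi tpsi.
split.
- apply: eq_trans (congr2 +%R (E 0%N 1%N isT) (E 1%N 2%N isT)) _.
  by rewrite addrACA; apply: eq_trans (congr2 +%R a1 b1) (addr0 _).
- apply: eq_trans (congr2 +%R (congr2 +%R (E 0%N 0%N isT) (E 2%N 1%N isT)) (E 3%N 2%N isT)) _.
  by rewrite add3ACA; apply: eq_trans (congr2 +%R a2 b2) (addr0 _).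
- apply: eq_trans (congr2 (fun a b => a - b) (congr2 +%R (E 1%N 0%N isT) (E 3%N 1%N isT))
    (E 2%N 2%N isT)) _.
  by rewrite opprD add3ACA; apply: eq_trans (congr2 +%R a3 b3) (addr0 _).
Qed.

Lemma weak_linsol_sum (cs : seq cell) (V : cell -> field) :
  (forall c i, (i < 4)%N -> cbm (V c i)) -> (forall c, weak_linsol (V c)) ->
  (forall i, (i < 4)%N -> cbm (fun z => \sum_(c <- cs) V c i z)) /\
  weak_linsol (fun i z => \sum_(c <- cs) V c i z).
Proof.
move=> cV wV; elim: cs => [|c cs [ihc ihw]].
  have E : (fun (i : nat) z => \sum_(c <- [::]) V c i z) = (fun _ _ => 0).
    by apply/funext => i; apply/funext => z; rewrite big_nil.
  split; first by move=> i _; under eq_fun do rewrite big_nil; exact: cbm0.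
  by rewrite E; apply: linsol_weak; [exact: linsol0|move=> i; exact: cbm0].
have E : (fun (i : nat) z => \sum_(c <- c :: cs) V c i z) =
    (fun i z => V c i z + \sum_(c <- cs) V c i z).
  by apply/funext => i; apply/funext => z; rewrite big_cons.
rewrite E; split; last by apply: weak_linsolD => //; exact: cV.
move=> i i4; rewrite (_ : (fun _ => _) = (fun z => V c i z + \sum_(c <- cs) V c i z)).
  by apply: cbmD; [exact: cV|exact: ihc].
by apply/funext => z; rewrite big_cons.
Qed.

(** The sum of all [V c], written by selecting the cell of z. On a ball it is a finite sum, and a
    test function sees only a ball. *)
Definition tile (V : cell -> field) i z := if wedge z then V (cellof z) i z else 0.

Section TileProperties.
Variable V : cell -> field.
Hypothesis wV : forall c, wild (off c) (V c).

Lemma wild_out o W i z : wild o W -> (i < 4)%N -> ~~ in_hcell 1 o z -> W i z = 0.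
Proof.
move=> [_ eW sW _] i4 zi; have := eW z; rewrite /hcell_ind (negbTE zi) mulr0 => /eqP.
rewrite paddr_eq0 ?sqr_ge0// !sqrf_eq0 => /andP[/eqP W0 /eqP W1].
have [W2 W3] := sW z; move: W2 W3; rewrite W0 W1 mulr0 expr0n /hcell_ind (negbTE zi) subr0.
by case: i i4 => [|[|[|[|]]]].
Qed.

Lemma tile_sum (cs : seq cell) i z : (i < 4)%N -> uniq cs -> (wedge z -> cellof z \in cs) ->
  tile V i z = \sum_(c <- cs) V c i z.
Proof.
move=> i4 ucs zcs.
have V0 c : ~~ (wedge z && (cellof z == c)) -> V c i z = 0.
  by rewrite -in_hcell_off => zi; exact: (wild_out (wV c) i4 zi).
rewrite /tile; have [wz|wz] := boolP (wedge z); last first.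
  by rewrite big1_seq// => c _; apply: V0; rewrite (negbTE wz).
rewrite (bigD1_seq (cellof z))/= ?zcs// big1_seq ?addr0// => c /andP[cz _]; apply: V0.
by rewrite wz/= eq_sym.
Qed.

Lemma tile_ball r : exists2 cs : seq cell, uniq cs &
  forall i z, (i < 4)%N -> `|z| <= r -> tile V i z = \sum_(c <- cs) V c i z.
Proof.
have [cs ucs zcs] := cells_bound r; exists cs => // i z i4 zr.
by apply: tile_sum => //; exact: zcs.
Qed.

Lemma lbm_tile i : (i < 4)%N -> lbm (tile V i).
Proof.
move=> i4; have cV c j : (j < 4)%N -> cbm (V c j) by move=> j4; have [+ _ _ _] := wV c; exact.
have wsV c : weak_linsol (V c) by case: (wV c).
have H n : {cs : seq cell | forall z, `|z| <= n%:R -> tile V i z = \sum_(c <- cs) V c i z}.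
  by apply: cid; have [cs _ h] := tile_ball n%:R; exists cs => z; exact: h.
split.
  apply: (@measurable_fun_cvg _ _ _ _ (fun n (z : T3) => \sum_(c <- sval (H n)) V c i z)).
    by move=> n; have [+ _] := weak_linsol_sum (sval (H n)) cV wsV => /(_ i i4)[].
  move=> z _; apply: cvg_near_cst; exists (Num.truncn `|z : T|).+1 => // n /= zn.
  rewrite (svalP (H n))//; apply/ltW; apply: lt_le_trans (truncnS_gt _) _.
  by rewrite ler_nat.
move=> r; have [cs _ h] := tile_ball r.
have [+ _] := weak_linsol_sum cs cV wsV => /(_ i i4)[_ [C [q hC]]].
by exists C => z zr; rewrite h//; case: (hC z).
Qed.

Lemma tile_sq z : tile V 0 z ^+ 2 + tile V 1 z ^+ 2 = 2 * (wedge z)%:R.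
Proof.
rewrite /tile; have [wz|wz] := boolP (wedge z); last by rewrite expr0n addr0 mulr0.
by have [_ -> _ _] := wV (cellof z); rewrite /hcell_ind in_hcell_off wz eqxx.
Qed.

Lemma tile_stress z : tile V 2 z = tile V 0 z ^+ 2 - (wedge z)%:R /\
  tile V 3 z = tile V 0 z * tile V 1 z.
Proof.
rewrite /tile; have [wz|wz] := boolP (wedge z); last by rewrite expr0n subr0 mulr0.
by have [_ _ /(_ z) + _] := wV (cellof z); rewrite /hcell_ind in_hcell_off wz eqxx.
Qed.

Lemma weak_linsol_tile : weak_linsol (tile V).
Proof.
move=> psi tpsi.
have cV c j : (j < 4)%N -> cbm (V c j) by move=> j4; have [+ _ _ _] := wV c; exact.
have wsV c : weak_linsol (V c) by case: (wV c).
have [r hr] : exists r, forall j z, (j < 3)%N -> r < `|z| -> Dax j psi z = 0.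
  have [_ _ _ _ [_ [? [r0 h0]]]] := test_Dax 0 tpsi.
  have [_ _ _ _ [_ [? [r1 h1]]]] := test_Dax 1 tpsi.
  have [_ _ _ _ [_ [? [r2 h2]]]] := test_Dax 2 tpsi.
  exists (Num.max r0 (Num.max r1 r2)) => j z j3; rewrite !gt_max => /and3P[z0 z1 z2].
  case: j j3 => [|[|[|]]]// _.
  - exact: (h0 z).2 z0.
  - exact: (h1 z).2 z1.
  - exact: (h2 z).2 z2.
have [cs ucs hcs] := tile_ball r.
have [_ /(_ psi tpsi)[p1 p2 p3]] := weak_linsol_sum cs cV wsV.
have E i j : (i < 4)%N -> (j < 3)%N -> \int[leb3 R]_z (tile V i z * Dax j psi z) =
    \int[leb3 R]_z ((\sum_(c <- cs) V c i z) * Dax j psi z).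
  move=> i4 j3; apply: eq_Rintegral => z _.
  by have [zr|zr] := leP `|z| r; [rewrite hcs|rewrite hr// !mulr0].
split.
- exact: eq_trans (congr2 +%R (E 0%N 1%N isT isT) (E 1%N 2%N isT isT)) p1.
- exact: eq_trans (congr2 +%R (congr2 +%R (E 0%N 0%N isT isT) (E 2%N 1%N isT isT))
    (E 3%N 2%N isT isT)) p2.
- exact: eq_trans (congr2 (fun a b => a - b) (congr2 +%R (E 1%N 0%N isT isT)
    (E 3%N 1%N isT isT)) (E 2%N 2%N isT isT)) p3.
Qed.

End TileProperties.
End Tiling.

(** * The background flow *)

Section Clamp.
Context (R : realType).
Implicit Types a b x y : R.

Definition clamp a b x := Num.max a (Num.min b x).

Lemma clamp_bound a b x : a <= b -> a <= clamp a b x <= b.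
Proof. by move=> ab; rewrite /clamp le_max lexx ge_max ab /= ge_min lexx. Qed.

Lemma clamp_id a b x : a <= x <= b -> clamp a b x = x.
Proof. by move=> /andP[ax xb]; rewrite /clamp min_r// max_r. Qed.

Lemma clamp_le a b x : a <= b -> x <= a -> clamp a b x = a.
Proof. by move=> ab xa; rewrite /clamp min_r ?max_l// (le_trans xa). Qed.

Lemma clamp_ge a b x : a <= b -> b <= x -> clamp a b x = b.
Proof. by move=> ab bx; rewrite /clamp min_l// max_r. Qed.

Lemma clamp_lipschitz a b x y : a <= b -> `|clamp a b x - clamp a b y| <= `|x - y|.
Proof.
move=> ab; wlog xy : x y / x <= y.
  by move=> W; have [/W//|/ltW/W] := leP x y; rewrite distrC [leRHS]distrC.
rewrite distrC [leRHS]distrC [leRHS]ger0_norm ?subr_ge0//.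
have [xa|ax] := leP x a; have [ya|ay] := leP y a; rewrite ?(clamp_le ab xa) ?(clamp_le ab ya);
  rewrite ?subrr ?normr0 ?subr_ge0//; try lra.
  have [yb|yb] := leP y b; [rewrite clamp_id ?(ltW ay)//|rewrite clamp_ge ?(ltW yb)//];
    by rewrite ger0_norm ?subr_ge0; lra.
have [xb|bx] := leP x b; have [yb|yb] := leP y b.
- by rewrite !clamp_id ?(ltW ax) ?(ltW ay)// ger0_norm ?subr_ge0.
- rewrite (clamp_ge ab (ltW yb)) (clamp_id (_ : a <= x <= b)) ?(ltW ax)// ger0_norm ?subr_ge0//;
    lra.
- lra.
- by rewrite !clamp_ge ?(ltW bx) ?(ltW yb)// subrr normr0 subr_ge0.
Qed.

Lemma continuous_clamp a b : continuous (clamp a b).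
Proof.
by move=> x; apply: cvg_max; [exact: cvg_cst|apply: cvg_min; [exact: cvg_cst|exact: cvg_id]].
Qed.

Lemma clamp_derive a b x : a <= b -> x != a -> x != b ->
  is_derive x 1 (clamp a b) (if a < x < b then 1 else 0).
Proof.
move=> ab xa xb.
have C (c : R) : (\forall y \near x, c = clamp a b y) -> is_derive x 1 (clamp a b) 0.
  by move=> h; apply: (@near_eq_is_derive _ _ _ (fun=> c)) => //; exact: dC.
have [ax|xa'] := ltP a x; last first.
  have {}xa' : x < a by rewrite lt_neqAle xa.
  by apply: (C a); apply: filterS (lt_nbhsl xa') => y /ltW; move/(clamp_le ab) => ->.
have [bx|xb'] := ltP x b; last first.
  have {}xb' : b < x by rewrite lt_neqAle eq_sym xb.
  by apply: (C b); apply: filterS (lt_nbhsr xb') => y /ltW; move/(clamp_ge ab) => ->.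
apply: (@near_eq_is_derive _ _ _ id).
by apply: filterS2 (lt_nbhsl bx) (lt_nbhsr ax) => y /ltW yb /ltW ya; rewrite clamp_id// ya.
Qed.

End Clamp.

(* Two simple waves, functions of y = x1 / (1 - t), which focus at t = 1, x1 = 0. The
   density is sound ^+ 2 / 2 because the pressure rho ^+ 2 makes the sound speed
   sqrt (2 rho), and d(dens * speed) = - y d(dens). *)
Section Profiles.
Context (R : realType).
Implicit Types x y : R.
Local Notation P := (clamp (1 : R) 4).
Local Notation N := (clamp (- 4 : R) (- 1)).

(** With c the sound speed and u the flow speed: for |y| <= 1 the gas is at rest with c = 1. On
    [1, 4], u - c = - y and the Riemann invariant u + 2 c is 2; on [- 4, - 1], u + c = - y and u - 2
    c = - 2. Clamping joins these pieces. *)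
Definition sound x := (P x - N x + 1) / 3.
Definition dens x := sound x ^+ 2 / 2.
Definition speed x := - (2 / 3) * (P x + N x).

Lemma le14 : (1 : R) <= 4. Proof. by rewrite ler1n. Qed.
Lemma leN41 : (- 4 : R) <= - 1. Proof. by rewrite lerN2 ler1n. Qed.

Lemma sound_bound x : 1 <= sound x <= 3.
Proof.
have /andP[p1 p4] := clamp_bound x le14; have /andP[n1 n4] := clamp_bound x leN41.
by rewrite /sound; apply/andP; split; move: p1 p4 n1 n4; clear; lra.
Qed.

Lemma dens_bound x : 1 / 2 <= dens x <= 9 / 2.
Proof.
have /andP[] := sound_bound x; rewrite /dens; move: (sound x); clear => s s1 s3.
by apply/andP; split; nra.
Qed.

Lemma speed_bound x : `|speed x| <= 2.
Proof.
have /andP[p1 p4] := clamp_bound x le14; have /andP[n1 n4] := clamp_bound x leN41.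
by rewrite /speed ler_norml; apply/andP; split; move: p1 p4 n1 n4; clear; lra.
Qed.

Lemma profiles_ge4 x : 4 <= x -> dens x = dens 4 /\ speed x = speed 4.
Proof.
move=> x4; rewrite /dens /speed /sound !(clamp_ge le14 x4) (clamp_ge le14 (lexx _)).
by rewrite !(clamp_ge leN41)//; move: x4; clear; lra.
Qed.

Lemma profiles_leN4 x : x <= - 4 -> dens x = dens (- 4) /\ speed x = speed (- 4).
Proof.
move=> x4; rewrite /dens /speed /sound !(clamp_le leN41 x4) (clamp_le leN41 (lexx _)).
by rewrite !(clamp_le le14)//; move: x4; clear; lra.
Qed.

Lemma profiles_at4 : dens 4 = 2 /\ speed 4 = - 2.
Proof.
rewrite /dens /speed /sound (clamp_ge le14 (lexx _)) (clamp_ge leN41); last lra.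
by split; field.
Qed.

Lemma profiles_atN4 : dens (- 4) = 2 /\ speed (- 4) = 2.
Proof.
rewrite /dens /speed /sound (clamp_le leN41 (lexx _)) (clamp_le le14); last lra.
by split; field.
Qed.

Lemma continuous_sound : continuous sound.
Proof.
move=> x; apply: cvgM; last exact: cvg_cst.
by apply: cvgD; [apply: cvgB; exact: continuous_clamp|exact: cvg_cst].
Qed.

Lemma continuous_dens : continuous dens.
Proof.
move=> x; apply: cvgM; last exact: cvg_cst.
by rewrite expr2; apply: cvgM; exact: continuous_sound.
Qed.

Lemma continuous_speed : continuous speed.
Proof.
move=> x; apply: cvgM; first exact: cvg_cst.
by apply: cvgD; exact: continuous_clamp.
Qed.

Definition kinks : seq R := [:: 1; 4; - 4; - 1].

(** Here c and u are the slopes of [sound] and [speed]. The relation between sound speed, flow speed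
    and x in each simple wave is what reduces the three laws to [field]. *)
Lemma profiles_derive x : x \notin kinks -> exists c, exists2 u,
  is_derive x 1 dens (sound x * c) /\ is_derive x 1 speed u &
  [\/ c = 0 /\ u = 0, [/\ c = 1 / 3, u = - (2 / 3) & sound x = speed x + x] |
      [/\ c = - (1 / 3), u = - (2 / 3) & sound x = - speed x - x]].
Proof.
rewrite !inE !negb_or => /and4P[x1 x4 xN4 xN1].
have dP := clamp_derive le14 x1 x4; have dN' := clamp_derive leN41 xN4 xN1.
set p := (if 1 < x < 4 then _ else _) in dP; set m := (if _ then _ else _) in dN'.
have dS : is_derive x 1 sound ((p - m) / 3).
  apply: dE (dM (dD (dB dP dN') (dC 1 _ _)) (dC 3^-1 _ _)) _.
  by rewrite mulr0 !addr0.
exists ((p - m) / 3), (- (2 / 3) * (p + m)).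
  split; last exact: dZ (dD dP dN').
  by apply: dE (dM (dM dS dS) (dC 2^-1 _ _)) _; field.
rewrite /p /m; have [/andP[xl xr]|_] := boolP (1 < x < 4).
  have -> : (- 4 < x < - 1) = false by apply/negbTE/negP => /andP[_]; move: xl; clear; lra.
  apply: Or32; rewrite subr0 addr0 mulr1; split => //.
  rewrite /sound /speed (clamp_id (_ : 1 <= x <= 4)) ?(ltW xl) ?(ltW xr)//.
  rewrite (clamp_ge leN41); last by move: xl; clear; lra.
  by field.
have [/andP[xl xr]|_] := boolP (- 4 < x < - 1).
  apply: Or33; rewrite sub0r add0r mulr1 mulN1r div1r; split => //.
  rewrite /sound /speed (clamp_id (_ : - 4 <= x <= - 1)) ?(ltW xl) ?(ltW xr)//.
  rewrite (clamp_le le14); last by move: xr; clear; lra.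
  by field.
by apply: Or31; rewrite subrr mul0r addr0 mulr0.
Qed.

End Profiles.

Section BackgroundLaws.
Context (R : realType).
Local Notation T := (R * (R * R))%type.
Local Notation dens := (@dens R).
Local Notation speed := (@speed R).

Definition momentum_flux y : R := dens y * speed y ^+ 2 + dens y ^+ 2.
Definition energy_density y : R := 2^-1 * dens y * speed y ^+ 2 + dens y ^+ 2.
Definition energy_flux y : R := (energy_density y + dens y ^+ 2) * speed y.

(** As A and B depend only on density and speed, they inherit the constancy of these beyond - 4 and
    4. *)
Lemma profile_law (A B : R -> R) wA wB C psi : continuous A -> continuous B ->
  (forall x y, dens x = dens y -> speed x = speed y -> A x = A y /\ B x = B y) ->
  (forall x, x \notin kinks R -> exists a, is_derive x 1 A a /\ is_derive x 1 B (- x * a)) ->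
  2 * (A 4 - wA) = B 4 - wB -> - 2 * (A (- 4) - wA) = B (- 4) - wB ->
  (forall x, `|A x| <= C) -> (forall x, `|B x| <= C) -> test_function psi ->
  \int[leb3 R]_(z in halfspace R) (selfsim A wA z.1 z.2.1 * Dt psi z +
    selfsim B wB z.1 z.2.1 * D1 psi z) + \int[leb2 R]_x (A x.1 * psi (0, x)) = 0.
Proof.
move=> cA cB AB dAB h4 hN4 bA bB tpsi.
have g4 x : 4 <= x -> A x = A 4 /\ B x = B 4.
  by move=> /profiles_ge4[? ?]; exact: AB.
have lN4 x : x <= - 4 -> A x = A (- 4) /\ B x = B (- 4).
  by move=> /profiles_leN4[? ?]; exact: AB.
apply: (@selfsim_weak_law R A B wA wB (kinks R) _ _ _ _ _ _ _ _ _ _ C) => //.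
- by move=> x /g4[].
- by move=> x /lN4[].
- by move=> x /g4[].
- by move=> x /lN4[].
- by rewrite !inE !negb_or; clear; apply/and4P; split; apply/eqP => h; lra.
Qed.

Local Lemma continuous_mulf (f g : R -> R) : continuous f -> continuous g ->
  continuous (fun x => f x * g x).
Proof. by move=> cf cg x; apply: cvgM; [exact: cf|exact: cg]. Qed.

Local Lemma continuous_addf (f g : R -> R) : continuous f -> continuous g ->
  continuous (fun x => f x + g x).
Proof. by move=> cf cg x; apply: cvgD; [exact: cf|exact: cg]. Qed.

Local Lemma continuous_cstf (a : R) : continuous (fun _ : R => a).
Proof. by move=> x; exact: cvg_cst. Qed.

Lemma continuous_momentum : continuous (fun y => dens y * speed y).
Proof. exact: continuous_mulf (@continuous_dens R) (@continuous_speed R). Qed.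

Lemma continuous_momentum_flux : continuous momentum_flux.
Proof.
have [cd cs] := (@continuous_dens R, @continuous_speed R).
by apply: continuous_addf; [apply: continuous_mulf => //|]; exact: (continuous_mulf _ _).
Qed.

Lemma continuous_energy_density : continuous energy_density.
Proof.
have [cd cs] := (@continuous_dens R, @continuous_speed R).
apply: continuous_addf; last exact: (continuous_mulf cd cd).
by apply: continuous_mulf; [apply: continuous_mulf => //;
  exact: continuous_cstf|exact: (continuous_mulf cs cs)].
Qed.

Lemma continuous_energy_flux : continuous energy_flux.
Proof.
have [cd cs] := (@continuous_dens R, @continuous_speed R).
by apply: continuous_mulf => //; apply: continuous_addf;
  [exact: continuous_energy_density|exact: (continuous_mulf cd cd)].
Qed.

Lemma flux_bounds y : [/\ `|dens y| <= 5, `|dens y * speed y| <= 10,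
  `|momentum_flux y| <= 50, `|energy_density y| <= 40 & `|energy_flux y| <= 130].
Proof.
have /andP[d0 d1] := dens_bound y; have u2 := speed_bound y.
have d5 : `|dens y| <= 5 by rewrite ler_norml; apply/andP; split; lra.
have d0' : 0 <= dens y by lra.
have u4 : 0 <= speed y ^+ 2 <= 4.
  by move: u2; rewrite ler_norml => /andP[? ?]; rewrite sqr_ge0; nra.
have dd : 0 <= dens y ^+ 2 <= 25 by rewrite sqr_ge0; nra.
have du : 0 <= dens y * speed y ^+ 2 <= 20.
  by move: u4 => /andP[? ?]; apply/andP; split; nra.
have e40 : 0 <= energy_density y <= 40.
  rewrite /energy_density -mulrA; move: du dd; clear => /andP[? ?] /andP[? ?].
  by apply/andP; split; lra.
split => //.
- by rewrite normrM (_ : 10 = 5 * 2 :> R) ?ler_pM// -natrM.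
- by rewrite /momentum_flux ler_norml; move: du dd => /andP[? ?] /andP[? ?]; apply/andP; split; lra.
- by rewrite ler_norml; move: e40 => /andP[? ?]; apply/andP; split; lra.
- rewrite /energy_flux normrM (_ : 130 = 65 * 2 :> R); last by rewrite -natrM.
  by apply: ler_pM => //; rewrite ger0_norm; move: e40 dd => /andP[? ?] /andP[? ?]; lra.
Qed.

(** At y = 4 the densities of mass, momentum and energy are 2, - 4, 8 with fluxes - 4, 12, - 24. The
    wedge has 4, 0, 20 with fluxes 0, 20, 0. In this law and the next two, the flux thus jumps by
    the shock speed 2 times the jump of the density. *)
Lemma background_mass psi : test_function psi ->
  \int[leb3 R]_(z in halfspace R) (selfsim dens 4 z.1 z.2.1 * Dt psi z +
    selfsim (fun y => dens y * speed y) 0 z.1 z.2.1 * D1 psi z)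
  + \int[leb2 R]_x (dens x.1 * psi (0, x)) = 0.
Proof.
have [d4 s4] := profiles_at4 R; have [dN4 sN4] := profiles_atN4 R.
apply: (@profile_law _ _ _ _ 10).
- exact: continuous_dens.
- exact: continuous_momentum.
- by move=> x y -> ->.
- move=> x /profiles_derive[c [u [dd du] cases]].
  exists (sound x * c); split => //; apply: dE (dM dd du) _; rewrite /dens.
  by case: cases => [[-> ->]|[-> -> ->]|[-> -> ->]]; field.
- by rewrite d4 s4; ring.
- by rewrite dN4 sN4; ring.
- by move=> y; have [h _ _ _ _] := flux_bounds y; apply: le_trans h _; rewrite ler_nat.
- by move=> y; have [_ h _ _ _] := flux_bounds y.
Qed.

Lemma background_momentum psi : test_function psi ->
  \int[leb3 R]_(z in halfspace R) (selfsim (fun y => dens y * speed y) 0 z.1 z.2.1 * Dt psi z +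
    selfsim momentum_flux 20 z.1 z.2.1 * D1 psi z)
  + \int[leb2 R]_x (dens x.1 * speed x.1 * psi (0, x)) = 0.
Proof.
have [d4 s4] := profiles_at4 R; have [dN4 sN4] := profiles_atN4 R.
apply: (@profile_law (fun y => dens y * speed y) _ _ _ 50).
- exact: continuous_momentum.
- exact: continuous_momentum_flux.
- by move=> x y; rewrite /momentum_flux => -> ->.
- move=> x /profiles_derive[c [u [dd du] cases]].
  eexists; split; first exact: dM dd du.
  apply: dE (dD (dM dd (dM du du)) (dM dd dd)) _; rewrite /dens.
  by case: cases => [[-> ->]|[-> -> ->]|[-> -> ->]]; field.
- by rewrite /momentum_flux d4 s4; ring.
- by rewrite /momentum_flux dN4 sN4; ring.
- by move=> y; have [_ h _ _ _] := flux_bounds y; apply: le_trans h _; rewrite ler_nat.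
- by move=> y; have [_ _ h _ _] := flux_bounds y.
Qed.

Lemma background_energy psi : test_function psi ->
  \int[leb3 R]_(z in halfspace R) (selfsim energy_density 20 z.1 z.2.1 * Dt psi z +
    selfsim energy_flux 0 z.1 z.2.1 * D1 psi z)
  + \int[leb2 R]_x (energy_density x.1 * psi (0, x)) = 0.
Proof.
have [d4 s4] := profiles_at4 R; have [dN4 sN4] := profiles_atN4 R.
apply: (@profile_law _ _ _ _ 130).
- exact: continuous_energy_density.
- exact: continuous_energy_flux.
- by move=> x y; rewrite /energy_flux /energy_density => -> ->.
- move=> x /profiles_derive[c [u [dd du] cases]].
  have de := dD (dM (dM (dC 2^-1 x 1) dd) (dM du du)) (dM dd dd).
  eexists; split; first exact: de.
  apply: dE (dM (dD de (dM dd dd)) du) _; rewrite /= /energy_density /dens.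
  by case: cases => [[-> ->]|[-> -> ->]|[-> -> ->]]; field.
- by rewrite /energy_flux /energy_density d4 s4; field.
- by rewrite /energy_flux /energy_density dN4 sN4; field.
- by move=> y; have [_ _ _ h _] := flux_bounds y; apply: le_trans h _; rewrite ler_nat.
- by move=> y; have [_ _ _ _ h] := flux_bounds y.
Qed.

End BackgroundLaws.

(** * Energy conserving solutions *)

Section VectorTestFunctions.
Context (R : realType).
Local Notation T := (R * (R * R))%type.
Variable l : R * R -> R.
Hypotheses (lZ : forall (h : R) x, l (h *: x) = h * l x) (lB : forall x y, l (x - y) = l x - l y)
  (cl : continuous l).

Lemma is_derive_linear_comp (f : T -> R * R) z v : derivable f z v ->
  is_derive z v (fun x => l (f x)) (l ('D_v f z)).
Proof.
move=> df.
have c : (fun h : R => h^-1 *: (((fun x => l (f x)) \o shift z) (h *: v) - l (f z))) @ 0^' -->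
    l ('D_v f z).
  rewrite (_ : (fun h : R => _) = l \o (fun h => h^-1 *: ((f \o shift z) (h *: v) - f z))).
    by apply: cvg_comp df _; exact: cl.
  by apply/funext => h; rewrite /= lZ lB.
by split; [apply/cvg_ex; exists (l ('D_v f z))|exact: cvg_lim c].
Qed.

Lemma derive_linear_comp (f : T -> R * R) v : (forall z, derivable f z v) ->
  'D_v (fun z => l (f z)) = (fun z => l ('D_v f z)).
Proof.
move=> dv; apply/funext => z.
exact: (@derive_val _ _ _ _ _ _ _ (is_derive_linear_comp (dv z))).
Qed.

Lemma Ck_linear_comp n (f : T -> R * R) : Ck n f -> Ck n (fun z => l (f z)).
Proof.
elim: n f => [|n ih] f /=.
  by move=> cf z; apply: (@continuous_comp _ _ _ f l); [exact: cf|exact: cl].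
move=> [cf df ft f1 f2].
have e0 : Dt (fun z => l (f z)) = (fun z => l (Dt f z)).
  by apply: derive_linear_comp => z; case: (df z).
have e1 : D1 (fun z => l (f z)) = (fun z => l (D1 f z)).
  by apply: derive_linear_comp => z; case: (df z).
have e2 : D2 (fun z => l (f z)) = (fun z => l (D2 f z)).
  by apply: derive_linear_comp => z; case: (df z).
split.
- by move=> z; apply: (@continuous_comp _ _ _ f l); [exact: cf|exact: cl].
- move=> z; have [d0 d1 d2] := df z.
  by split; [case: (is_derive_linear_comp d0)|case: (is_derive_linear_comp d1)|
    case: (is_derive_linear_comp d2)].
- by rewrite e0; exact: (ih (Dt f)).
- by rewrite e1; exact: (ih (D1 f)).
- by rewrite e2; exact: (ih (D2 f)).
Qed.

Lemma test_linear_comp (f : T -> R * R) : test_function f ->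
  [/\ test_function (fun z => l (f z)), Dt (fun z => l (f z)) = (fun z => l (Dt f z)),
   D1 (fun z => l (f z)) = (fun z => l (D1 f z)) & D2 (fun z => l (f z)) = (fun z => l (D2 f z))].
Proof.
move=> [Cf Kf]; have [_ df _ _ _] := Cf 1%N.
have e0 : Dt (fun z => l (f z)) = (fun z => l (Dt f z)).
  by apply: derive_linear_comp => z; case: (df z).
have e1 : D1 (fun z => l (f z)) = (fun z => l (D1 f z)).
  by apply: derive_linear_comp => z; case: (df z).
have e2 : D2 (fun z => l (f z)) = (fun z => l (D2 f z)).
  by apply: derive_linear_comp => z; case: (df z).
split => //; split; first by move=> n; exact: Ck_linear_comp.
apply: (subclosed_compact (@closed_closure _ _) Kf).
apply: closure_subset => z /=; apply: contra => /eqP ->.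
by rewrite -(scale0r (0 : R * R)) lZ mul0r.
Qed.

End VectorTestFunctions.

(** The projections are continuous and linear, hence commute with the axis derivatives; the vector
    momentum law splits into scalar ones. *)
Lemma test_components (R : realType) (f : R * (R * R) -> R * R) : test_function f ->
  exists f1 f2, [/\ test_function f1, test_function f2, forall z, f z = (f1 z, f2 z) &
    [/\ forall z, Dt f z = (Dt f1 z, Dt f2 z), forall z, D1 f z = (D1 f1 z, D1 f2 z) &
      forall z, D2 f z = (D2 f1 z, D2 f2 z)]].
Proof.
move=> tf; exists (fun z => (f z).1), (fun z => (f z).2).
have [t1 e10 e11 e12] := test_linear_comp (l := @fst R R) (fun _ _ => erefl) (fun _ _ => erefl)
  (fun x => @cvg_fst _ _ _ _ _) tf.
have [t2 e20 e21 e22] := test_linear_comp (l := @snd R R) (fun _ _ => erefl) (fun _ _ => erefl)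
  (fun x => @cvg_snd _ _ _ _ _) tf.
split => //; first by move=> z; case: (f z).
by split => z; rewrite ?e10 ?e20 ?e11 ?e21 ?e12 ?e22; case: (_ f z).
Qed.

(** * Superposition of the background and the wild field *)

Section Assembly.
Context (R : realType).
Local Notation T := (R * (R * R))%type.
Local Notation T1 := (measurableTypeR R).
Local Notation T3 := (T1 * (T1 * T1))%type.
Local Notation dens := (@dens R).
Local Notation speed := (@speed R).
Implicit Types (z : T).

(** A single y serves all profiles F at once, so outside the wedge algebraic relations between
    profiles pass to their self-similar extensions. *)
Lemma selfsim_cases z :
  wedge z /\ (forall (F : R -> R) w, selfsim F w z.1 z.2.1 = w) \/
  ~~ wedge z /\ exists y, forall (F : R -> R) w, selfsim F w z.1 z.2.1 = F y.
Proof.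
have wE : wedge z = (1 <= z.1) && (`|z.2.1| <= 2 * (z.1 - 1)).
  rewrite /wedge /lf ler_norml; apply/andP/andP => [[h1 h2]|[h1 /andP[h2 h3]]].
    by split; [|apply/andP; split]; lra.
  by split; lra.
rewrite wE; have [h|h] := boolP (_ && _); [left|right]; split => //.
  by move=> F w; move: h => /andP[? ?]; exact: selfsim_in.
move: h; rewrite /selfsim ltNge; case: (1 <= z.1) => /= h; last by eexists.
by rewrite (negbTE h); case: (z.2.1 < 0); [exists (- 4)|exists 4].
Qed.

Lemma Rint_half_wedge (f : T -> R) : cbm f -> (forall z, ~~ wedge z -> f z = 0) ->
  \int[leb3 R]_(z in halfspace R) f z = \int[leb3 R]_z f z.
Proof.
move=> cf f0; rewrite Rintegral_mkcond; apply: eq_Rintegral => z _.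
rewrite /patch; case: ifPn => // zh; rewrite f0//; apply: contra zh.
by rewrite inE /halfspace /= /wedge /lf => /andP[h1 h2]; lra.
Qed.

(** For the pressure in the second momentum equation: its coefficient is constant in x2. *)
Lemma Rint_half_D2 (k : R -> R -> R) psi : lbm (fun z : T => k z.1 z.2.1) -> test_function psi ->
  \int[leb3 R]_(z in halfspace R) (k z.1 z.2.1 * D2 psi z) = 0.
Proof.
move=> lk tpsi; have [cp bp dp cDp bDp] := test_Dax 2 tpsi.
change (\int[leb3 R]_(z in halfspace R) (k z.1 z.2.1 * Dax 2 psi z) = 0).
have bb : cbm (fun z => k z.1 z.2.1 * Dax 2 psi z) by exact: cbmMl.
apply: Rint_half_2 => // t x _ /=.
have [_ [? [r f0]]] := bp; have [_ [? [q g0]]] := bDp.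
apply: (@Rintegral_derive_line _ (fun y => k t x * psi (t, (x, y)))
  (fun y => k t x * Dax 2 psi (t, (x, y))) [::] (Num.max r q)).
- by move=> y; apply: cvgM; [exact: cvg_cst|exact: continuous_section_2].
- exact: (cbm_section_2 t x bb).
- move=> y; rewrite gt_max => /andP[yr yq].
  have N : `|y| <= `|(t, (x, y)) : T| by rewrite norm3E/= !le_max lexx !orbT.
  have fr := (f0 (t, (x, y))).2 (lt_le_trans yr N).
  have gr := (g0 (t, (x, y))).2 (lt_le_trans yq N).
  by rewrite fr gr mulr0.
- move=> y _; split.
    by apply: dZ; apply/(is_derive_axis_2 psi t x y); exact: dp.
  by apply: cvgM; [exact: cvg_cst|exact: (continuous_section_2 cDp)].
Qed.

Section Solution.
Variable U : nat -> T -> R.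
Hypotheses (lU : forall i, (i < 4)%N -> lbm (U i))
  (sqU : forall z, U 0%N z ^+ 2 + U 1%N z ^+ 2 = 2 * (wedge z)%:R)
  (stU : forall z, U 2%N z = U 0%N z ^+ 2 - (wedge z)%:R /\ U 3%N z = U 0%N z * U 1%N z)
  (wU : weak_linsol U).

Definition rho z : R := selfsim dens 4 z.1 z.2.1.
Definition velocity z : R * R := (selfsim speed 0 z.1 z.2.1 + U 0%N z, U 1%N z).

Lemma U_out z i : (i < 4)%N -> ~~ wedge z -> U i z = 0.
Proof.
move=> i4 zw; have := sqU z; have [U2 U3] := stU z.
move: U2 U3; rewrite (negbTE zw) mulr0 => U2 U3 /eqP.
rewrite paddr_eq0 ?sqr_ge0// !sqrf_eq0 => /andP[/eqP U0 /eqP U1].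
move: U2 U3; rewrite U0 U1 mulr0 expr0n subr0.
by case: i i4 => [|[|[|[|]]]].
Qed.

Lemma mass_identity z a b c :
  rho z * a + rho z * dot (velocity z) (b, c) =
  (selfsim dens 4 z.1 z.2.1 * a + selfsim (fun y => dens y * speed y) 0 z.1 z.2.1 * b)
  + 4 * (U 0%N z * b + U 1%N z * c).
Proof.
rewrite /rho /velocity /dot /=; case: (selfsim_cases z) => -[wz E].
  by rewrite !E; ring.
by case: E => y E; rewrite !E !U_out//; ring.
Qed.

(** In the wedge rho v (x) v + rho^2 I = 4 (u + I) + 16 I = 4 u + 20 I. The integrand splits into
    the background law in x1, four times the two linear momentum equations of [U], and a pressure
    depending on t and x1 only. *)
Lemma momentum_identity z a1 a2 b1 b2 c1 c2 :
  rho z * dot (velocity z) (a1, a2) +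
  rho z * ((velocity z).1 * (velocity z).1 * b1 + (velocity z).1 * (velocity z).2 * c1 +
    (velocity z).2 * (velocity z).1 * b2 + (velocity z).2 * (velocity z).2 * c2) +
  rho z ^+ 2 * (b1 + c2) =
  (selfsim (fun y => dens y * speed y) 0 z.1 z.2.1 * a1 +
   selfsim (@momentum_flux R) 20 z.1 z.2.1 * b1)
  + 4 * (U 0%N z * a1 + U 2%N z * b1 + U 3%N z * c1)
  + 4 * (U 1%N z * a2 + U 3%N z * b2 - U 2%N z * c2)
  + selfsim (fun y => dens y ^+ 2) 20 z.1 z.2.1 * c2.
Proof.
rewrite /rho /velocity /dot /=; case: (selfsim_cases z) => -[wz E]; last first.
  by case: E => y E; rewrite !E !U_out// /momentum_flux; ring.
rewrite !E; have := sqU z; have [-> ->] := stU z; rewrite wz.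
move: (U 0%N z) (U 1%N z) => p q pq; apply/eqP; rewrite -subr_eq0.
rewrite (_ : _ - _ = 4 * c2 * (p ^+ 2 + q ^+ 2 - 2 * true%:R)); last by rewrite /=; ring.
by rewrite pq subrr mulr0.
Qed.

(** In the wedge the energy is 20 and energy plus pressure is 36, so the energy flux is 36 v and is
    controlled by the divergence constraint alone. *)
Lemma energy_identity z a b c :
  energy (fun r => r ^+ 2) (rho z) (velocity z) * a +
  (energy (fun r => r ^+ 2) (rho z) (velocity z) + rho z ^+ 2) * dot (velocity z) (b, c) =
  (selfsim (@energy_density R) 20 z.1 z.2.1 * a + selfsim (@energy_flux R) 0 z.1 z.2.1 * b)
  + 36 * (U 0%N z * b + U 1%N z * c).
Proof.
rewrite /energy /rho /velocity /dot /=; case: (selfsim_cases z) => -[wz E]; last first.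
  by case: E => y E; rewrite !E !U_out// /energy_flux /energy_density; field.
rewrite !E; have := sqU z; rewrite wz.
move: (U 0%N z) (U 1%N z) => p q pq.
have -> : (0 + p) * (0 + p) + q * q = 2 by rewrite add0r -!expr2 pq mulr1.
by field.
Qed.

End Solution.
End Assembly.

(** * Verification of the weak formulations *)

Section WeakSolution.
Context (R : realType).
Local Notation T := (R * (R * R))%type.
Local Notation T1 := (measurableTypeR R).
Local Notation T3 := (T1 * (T1 * T1))%type.
Local Notation dens := (@dens R).
Local Notation speed := (@speed R).
Implicit Types (z : T).
Variable U : nat -> T -> R.
Hypotheses (lU : forall i, (i < 4)%N -> lbm (U i))
  (sqU : forall z, U 0%N z ^+ 2 + U 1%N z ^+ 2 = 2 * (wedge z)%:R)
  (stU : forall z, U 2%N z = U 0%N z ^+ 2 - (wedge z)%:R /\ U 3%N z = U 0%N z * U 1%N z)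
  (wU : weak_linsol U).
Local Notation v := (velocity U).
Local Notation rho := (@rho R).
Local Notation mom := (fun y => dens y * speed y).

Lemma Rint_half_split (X Y : T -> R) k : cbm X -> cbm Y -> (forall z, ~~ wedge z -> Y z = 0) ->
  \int[leb3 R]_(z in halfspace R) (X z + k * Y z) =
  \int[leb3 R]_(z in halfspace R) X z + k * \int[leb3 R]_z Y z.
Proof.
move=> cX cY Y0; have mh := @measurable_halfspace R.
have ck : cbm (fun z => k * Y z) by apply: cbmMl => //; exact: lbm_cst.
by rewrite (RintD3 mh cX ck) (RintZ3 _ mh cY) (Rint_half_wedge cY Y0).
Qed.

Lemma test_derivatives (psi : T -> R) : test_function psi ->
  [/\ cbm (Dt psi), cbm (D1 psi) & cbm (D2 psi)].
Proof.
move=> tpsi; have [_ _ _ _ b0] := test_Dax 0 tpsi; have [_ _ _ _ b1] := test_Dax 1 tpsi.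
have [_ _ _ _ b2] := test_Dax 2 tpsi; exact: And3 b0 b1 b2.
Qed.

Let Uout i z : (i < 4)%N -> ~~ wedge z -> U i z = 0.
Proof. exact: (U_out sqU stU). Qed.

Lemma U_mass psi : test_function psi ->
  cbm (fun z => U 0%N z * D1 psi z + U 1%N z * D2 psi z) /\
  \int[leb3 R]_z (U 0%N z * D1 psi z + U 1%N z * D2 psi z) = 0.
Proof.
move=> tpsi; have [b0 b1 b2] := test_derivatives tpsi; have [w1 _ _] := wU tpsi.
have c1 := cbmMl (lU (isT : 0 < 4)%N) b1; have c2 := cbmMl (lU (isT : 1 < 4)%N) b2.
by split; [exact: cbmD|rewrite (RintD3 measurableT c1 c2)].
Qed.

Lemma U_momentum1 psi : test_function psi ->
  cbm (fun z => U 0%N z * Dt psi z + U 2%N z * D1 psi z + U 3%N z * D2 psi z) /\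
  \int[leb3 R]_z (U 0%N z * Dt psi z + U 2%N z * D1 psi z + U 3%N z * D2 psi z) = 0.
Proof.
move=> tpsi; have [b0 b1 b2] := test_derivatives tpsi; have [_ w2 _] := wU tpsi.
have c0 := cbmMl (lU (isT : 0 < 4)%N) b0; have c1 := cbmMl (lU (isT : 2 < 4)%N) b1.
have c2 := cbmMl (lU (isT : 3 < 4)%N) b2; have c01 := cbmD c0 c1.
split; first exact: cbmD.
by rewrite (RintD3 measurableT c01 c2) (RintD3 measurableT c0 c1).
Qed.

Lemma U_momentum2 psi : test_function psi ->
  cbm (fun z => U 1%N z * Dt psi z + U 3%N z * D1 psi z - U 2%N z * D2 psi z) /\
  \int[leb3 R]_z (U 1%N z * Dt psi z + U 3%N z * D1 psi z - U 2%N z * D2 psi z) = 0.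
Proof.
move=> tpsi; have [b0 b1 b2] := test_derivatives tpsi; have [_ _ w3] := wU tpsi.
have c0 := cbmMl (lU (isT : 1 < 4)%N) b0; have c1 := cbmMl (lU (isT : 3 < 4)%N) b1.
have c2 := cbmMl (lU (isT : 2 < 4)%N) b2; have c01 := cbmD c0 c1.
split; first exact: cbmB.
by rewrite (RintB3 measurableT c01 c2) (RintD3 measurableT c0 c1).
Qed.

Lemma cbm_background (A B : R -> R) wA wB C psi : continuous A -> continuous B ->
  (forall y, `|A y| <= C) -> (forall y, `|B y| <= C) -> test_function psi ->
  cbm (fun z => selfsim A wA z.1 z.2.1 * Dt psi z + selfsim B wB z.1 z.2.1 * D1 psi z).
Proof.
move=> cA cB bA bB tpsi; have [b0 b1 b2] := test_derivatives tpsi.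
exact: cbmD (cbmMl (lbm_selfsim wA cA bA) b0) (cbmMl (lbm_selfsim wB cB bB) b1).
Qed.

Lemma zero_comb2 (a b p q : R) : a = 0 -> b = 0 -> a * p + b * q = 0.
Proof. by move=> -> ->; rewrite !mul0r addr0. Qed.

Lemma solution_mass : weak_mass (fun x => dens x.1) rho v.
Proof.
move=> psi tpsi; have [cY IY] := U_mass tpsi.
have cX : cbm (fun z => selfsim dens 4 z.1 z.2.1 * Dt psi z + selfsim mom 0 z.1 z.2.1 * D1 psi z).
  apply: (@cbm_background _ _ _ _ 10) => //.
  - exact: continuous_dens.
  - exact: continuous_momentum.
  - by move=> y; have [h _ _ _ _] := flux_bounds y; apply: le_trans h _; rewrite ler_nat.
  - by move=> y; have [_ h _ _ _] := flux_bounds y.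
rewrite -[RHS](background_mass tpsi); congr (_ + _).
transitivity (\int[leb3 R]_(z in halfspace R)
  ((selfsim dens 4 z.1 z.2.1 * Dt psi z + selfsim mom 0 z.1 z.2.1 * D1 psi z) +
   4 * (U 0%N z * D1 psi z + U 1%N z * D2 psi z))).
  by apply: eq_Rintegral => z _; exact: (mass_identity sqU stU).
rewrite (Rint_half_split 4 cX cY); first by rewrite IY mulr0 addr0.
by move=> z zw; exact: (zero_comb2 _ _ (Uout (isT : 0 < 4)%N zw) (Uout (isT : 1 < 4)%N zw)).
Qed.

Lemma solution_energy : weak_energy (fun r => r ^+ 2) (fun r => r ^+ 2) (fun x => dens x.1)
  (fun x => (speed x.1, 0)) rho v.
Proof.
move=> psi tpsi; have [cY IY] := U_mass tpsi.
have cX : cbm (fun z => selfsim (@energy_density R) 20 z.1 z.2.1 * Dt psi z +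
    selfsim (@energy_flux R) 0 z.1 z.2.1 * D1 psi z).
  apply: (@cbm_background _ _ _ _ 130) => //.
  - exact: continuous_energy_density.
  - exact: continuous_energy_flux.
  - by move=> y; have [_ _ _ h _] := flux_bounds y; apply: le_trans h _; rewrite ler_nat.
  - by move=> y; have [_ _ _ _ h] := flux_bounds y.
rewrite -[RHS](background_energy tpsi); congr (_ + _); last first.
  apply: eq_Rintegral => x _; congr (_ * _).
  by rewrite /energy /dot /energy_density /=; ring.
transitivity (\int[leb3 R]_(z in halfspace R)
  ((selfsim (@energy_density R) 20 z.1 z.2.1 * Dt psi z +
    selfsim (@energy_flux R) 0 z.1 z.2.1 * D1 psi z) +
   36 * (U 0%N z * D1 psi z + U 1%N z * D2 psi z))).
  by apply: eq_Rintegral => z _; exact: (energy_identity sqU stU).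
rewrite (Rint_half_split 36 cX cY); first by rewrite IY mulr0 addr0.
by move=> z zw; exact: (zero_comb2 _ _ (Uout (isT : 0 < 4)%N zw) (Uout (isT : 1 < 4)%N zw)).
Qed.

Lemma solution_momentum : weak_momentum (fun r => r ^+ 2) (fun x => dens x.1)
  (fun x => (speed x.1, 0)) rho v.
Proof.
move=> phi /test_components[f1 [f2 [t1 t2 ff [fDt fD1 fD2]]]].
have [cY1 IY1] := U_momentum1 t1; have [cY2 IY2] := U_momentum2 t2.
have cX : cbm (fun z => selfsim mom 0 z.1 z.2.1 * Dt f1 z +
    selfsim (@momentum_flux R) 20 z.1 z.2.1 * D1 f1 z).
  apply: (@cbm_background _ _ _ _ 50) => //.
  - exact: continuous_momentum.
  - exact: continuous_momentum_flux.
  - by move=> y; have [_ h _ _ _] := flux_bounds y; apply: le_trans h _; rewrite ler_nat.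
  - by move=> y; have [_ _ h _ _] := flux_bounds y.
have lk : lbm (fun z => selfsim (fun y => dens y ^+ 2) 20 z.1 z.2.1).
  apply: (@lbm_selfsim _ _ _ 25).
    have -> : (fun y => dens y ^+ 2) = (fun y => dens y * dens y) by apply/funext.
    by move=> y; apply: cvgM; exact: continuous_dens.
  move=> y; have [h _ _ _ _] := flux_bounds y.
  by rewrite normrX (_ : 25 = 5 ^+ 2 :> R) ?lerXn2r ?nnegrE// -natrX.
have IZ := Rint_half_D2 lk t2; have [_ _ bD2] := test_derivatives t2.
have cZ : cbm (fun z => selfsim (fun y => dens y ^+ 2) 20 z.1 z.2.1 * D2 f2 z) by exact: cbmMl.
rewrite -[RHS](background_momentum t1); congr (_ + _); last first.
  by apply: eq_Rintegral => x _; rewrite ff /dot /=; ring.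
pose X z := selfsim mom 0 z.1 z.2.1 * Dt f1 z + selfsim (@momentum_flux R) 20 z.1 z.2.1 * D1 f1 z.
pose Y1 z := U 0%N z * Dt f1 z + U 2%N z * D1 f1 z + U 3%N z * D2 f1 z.
pose Y2 z := U 1%N z * Dt f2 z + U 3%N z * D1 f2 z - U 2%N z * D2 f2 z.
pose Z z := selfsim (fun y => dens y ^+ 2) 20 z.1 z.2.1 * D2 f2 z.
transitivity (\int[leb3 R]_(z in halfspace R) (X z + 4 * Y1 z + 4 * Y2 z + Z z)).
  apply: eq_Rintegral => z _; rewrite fDt /tensor_contract /div fD1 fD2.
  exact: (momentum_identity sqU stU).
have mh := @measurable_halfspace R; have l4 : lbm (fun _ : T => 4 : R) by exact: lbm_cst.
have c1 : cbm (fun z => X z + 4 * Y1 z) by exact: cbmD cX (cbmMl l4 cY1).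
have c2 : cbm (fun z => X z + 4 * Y1 z + 4 * Y2 z) by exact: cbmD c1 (cbmMl l4 cY2).
have Y10 z : ~~ wedge z -> Y1 z = 0.
  move=> zw; have h := zero_comb2 (Dt f1 z) (D1 f1 z) (Uout (isT : 0 < 4)%N zw)
    (Uout (isT : 2 < 4)%N zw).
  apply: eq_trans (congr2 +%R h (congr1 ( *%R^~ (D2 f1 z)) (Uout (isT : 3 < 4)%N zw))) _.
  by rewrite add0r mul0r.
have Y20 z : ~~ wedge z -> Y2 z = 0.
  move=> zw; have h := zero_comb2 (Dt f2 z) (D1 f2 z) (Uout (isT : 1 < 4)%N zw)
    (Uout (isT : 3 < 4)%N zw).
  apply: eq_trans (congr2 (fun a b => a - b) h
    (congr1 ( *%R^~ (D2 f2 z)) (Uout (isT : 2 < 4)%N zw))) _.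
  by rewrite sub0r mul0r oppr0.
rewrite (RintD3 mh c2 cZ) (Rint_half_split 4 c1 cY2 Y20) (Rint_half_split 4 cX cY1 Y10).
by rewrite IY1 IY2 IZ !mulr0 !addr0.
Qed.

Lemma lbm_Linfty_loc (f : T -> R) : lbm f -> Linfty_loc f.
Proof.
move=> [mf bf]; split; first exact: measurable_funTS.
move=> K /compact_bounded[M [_ KM]] _; have [C hC] := bf (M + 1).
exists C; apply: aeW => z Kz; apply: hC; apply: KM Kz; by rewrite ltrDl.
Qed.

Lemma solution_energy_conserving :
  energy_conserving_weak_solution (fun r => r ^+ 2) (fun r => r ^+ 2) (fun x => dens x.1)
    (fun x => (speed x.1, 0)) rho v.
Proof.
split; last exact: solution_energy.
split; [split| |exact: solution_mass|exact: solution_momentum].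
- apply: lbm_Linfty_loc; apply: (@lbm_selfsim _ _ _ 5); first exact: continuous_dens.
  by move=> y; have [h _ _ _ _] := flux_bounds y.
- apply: lbm_Linfty_loc; apply: lbmD; last exact: lU.
  by apply: (@lbm_selfsim _ _ _ 2); [exact: continuous_speed|exact: speed_bound].
- by apply: lbm_Linfty_loc; exact: lU.
- apply: aeW => z _; rewrite /rho; have dp y : 0 < dens y.
    by have /andP[h _] := dens_bound y; apply: lt_le_trans h; rewrite divr_gt0.
  case: (selfsim_cases z) => -[_ E]; first by rewrite E ltr0n.
  by case: E => y E; rewrite E.
Qed.

End WeakSolution.

Lemma profiles_lipschitz (R : realType) (x y : R) :
  `|dens x - dens y| <= 2 * `|x - y| /\ `|speed x - speed y| <= 2 * `|x - y|.
Proof.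
have hp := clamp_lipschitz x y (@le14 R); have hn := clamp_lipschitz x y (@leN41 R).
have /andP[s1 s2] := sound_bound x; have /andP[s3 s4] := sound_bound y.
have hs : `|sound x - sound y| <= 2 / 3 * `|x - y|.
  move: hp hn; rewrite /sound; move: (`|x - y|) => d; rewrite !ler_norml => /andP[? ?] /andP[? ?].
  by apply/andP; split; lra.
split.
  have -> : dens x - dens y = (sound x - sound y) * ((sound x + sound y) / 2).
    by rewrite /dens; field.
  have h3 : `|(sound x + sound y) / 2| <= 3 by rewrite ler_norml; apply/andP; split; lra.
  rewrite normrM (_ : 2 * _ = 2 / 3 * `|x - y| * 3); first exact: ler_pM.
  by field.
move: hp hn; rewrite /speed; move: (`|x - y|) => d; rewrite !ler_norml => /andP[? ?] /andP[? ?].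
by apply/andP; split; lra.
Qed.

Lemma initial_lipschitz (R : realType) :
  lipschitz (fun x : R * R => (dens x.1, (speed x.1, 0 : R))).
Proof.
exists 2; split; first exact: num_real.
move=> k k2 /= -[x y] _ /=.
have [hd hs] := profiles_lipschitz x.1 y.1.
have h1 : `|x.1 - y.1| <= `|x - y| by rewrite [leRHS]norm2E le_max lexx.
have h0 : 0 <= `|x - y| by exact: normr_ge0.
have h : forall a : R, a <= 2 * `|x.1 - y.1| -> a <= k * `|x - y|.
  by move=> a ha; nra.
rewrite [leLHS]norm3E /= !ge_max subrr normr0 (h _ hd) (h _ hs) /=.
by apply: mulr_ge0 => //; lra.
Qed.

Lemma ae_eq_Rint3 (R : realType) (f g : R * (R * R) -> R) : cbm f -> cbm g ->
  {ae leb3 R, forall z, f z = g z} -> \int[leb3 R]_z f z = \int[leb3 R]_z g z.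
Proof.
move=> [mf _] [mg _] fg; rewrite /Rintegral; congr fine; apply: ae_eq_integral => //.
- exact/measurable_EFinP.
- exact/measurable_EFinP.
- by apply: ae3S fg => z -> .
Qed.

Lemma wild_pairing_eq (R : realType) (o : nat -> R) V1 V2 g : wild o V1 -> wild o V2 ->
  lbm g.1 -> lbm g.2 ->
  {ae leb3 R, forall z, in_hcell 1 o z -> V1 0%N z = V2 0%N z /\ V1 1%N z = V2 1%N z} ->
  \int[leb3 R]_z pairing g V1 z = \int[leb3 R]_z pairing g V2 z.
Proof.
move=> w1 w2 l1 l2 V12; have [c1 _ _ _] := w1; have [c2 _ _ _] := w2.
apply: ae_eq_Rint3.
- exact: cbmD (cbmMl l1 (c1 0%N isT)) (cbmMl l2 (c1 1%N isT)).
- exact: cbmD (cbmMl l1 (c2 0%N isT)) (cbmMl l2 (c2 1%N isT)).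
apply: ae3S V12 => z; rewrite /pairing; have [zi /(_ isT)[-> ->]//|zi _] := boolP (in_hcell 1 o z).
by rewrite !(wild_out w1)// !(wild_out w2).
Qed.

Theorem corollary1p4 (R : realType) :
  let p : R -> R := fun r => r ^+ 2 in
  let P : R -> R := fun r => r ^+ 2 in
  exists (rho0 : R * R -> R) (v0 : R * R -> R * R),
    [/\ forall x, 0 < rho0 x,
        lipschitz (fun x : R * R => (rho0 x, v0 x)) &
        infinite_modulo (@same_solution R)
          [set u | energy_conserving_weak_solution p P rho0 v0 u.1 u.2]].
Proof.
move=> p P; exists (fun x => dens x.1), (fun x => (speed x.1, 0)); split.
- by move=> x; have /andP[h _] := dens_bound x.1; apply: lt_le_trans h; rewrite divr_gt0.
- exact: initial_lipschitz.
pose cell := (nat * nat * int)%type.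
pose distinct c (W : (nat -> R * (R * R) -> R) * (nat -> R * (R * R) -> R)) :=
  exists g, [/\ wild (off R c) W.1, wild (off R c) W.2, lbm g.1, lbm g.2 &
    \int[leb3 R]_z pairing g W.1 z != \int[leb3 R]_z pairing g W.2 z].
have [F HF] : {F & forall c, distinct c (F c)}.
  by apply: choice => c; have [V1 [V2 [g h]]] := wild_two (off R c); exists (V1, V2), g.
(* The K-th solution differs from the others in the cell (0, 0, K). *)
pose pillar (K : nat) : cell := (0%N, 0%N, K%:Z).
pose V K c := if c == pillar K then (F c).1 else (F c).2.
have wV K c : wild (off R c) (V K c).
  by have [g [w1 w2 _ _ _]] := HF c; rewrite /V; case: ifP.
pose sol K := (@rho R, velocity (tile (V K))).
have sS K : energy_conserving_weak_solution p P (fun x => dens x.1) (fun x => (speed x.1, 0))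
    (sol K).1 (sol K).2.
  apply: solution_energy_conserving.
  - exact: lbm_tile (wV K).
  - exact: tile_sq (wV K).
  - exact: tile_stress (wV K).
  - exact: weak_linsol_tile (wV K).
pose f K := [set w | same_solution (sol K) w].
have finj : injective f.
  move=> K K' fKK'; apply: contrapT => /eqP KK'.
  have same : same_solution (sol K) (sol K').
    have h : f K' (sol K') by apply: aeW.
    by move: h; rewrite -fKK'.
  have [g [w1 w2 l1 l2 /eqP]] := HF (pillar K); apply.
  apply: (wild_pairing_eq w1 w2 l1 l2); apply: ae3S same => z zs zi.
  have : wedge z && (cellof z == pillar K) by rewrite -in_hcell_off.
  move=> /andP[wz /eqP cz].
  have z0 : 0 < z.1 by move: wz; rewrite /wedge /lf => /andP[? ?]; lra.
  (* The background speed cancels, and in this cell solution K carries the first wild field and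
     solution K' the second. *)
  have [_ /pair_equal_spec[/addrI + +]] := zs z0.
  by rewrite /tile wz cz /V eqxx xpair_eqE eqxx /= eqz_nat (negbTE KK').
move=> fin; apply: infinite_nat; apply: sub_finite_set (finite_preimage (in2W finj) fin).
by move=> K _; exists (sol K); [exact: sS|].
Qed.
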